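(* Let $\kappa>0$, let $(X^{n+1},g_+)$ be $\mathrm{AH}(-\kappa^2)$, and let $1<p<\infty$. Then $$\lambda_{1,p}(X)\le \left(\frac{n\kappa}{p}\right)^p.$$
   Context: Let $\overline{X}^{n+1}$ be a compact manifold with boundary $M=\partial\overline{X}$ and interior $X$. A defining function for $M$ is a function $r$ on $\overline{X}$ with $r>0$ on $X$, $r=0$ on $M$ and $dr\neq 0$ on $M$. A complete Riemannian metric $g_+$ on $X$ is conformally compact (CC) if, for a defining function $r$, $\overline{g}:=r^2g_+$ extends to a metric on $\overline{X}$; throughout, the extension is assumed to be of class $C^{3,\theta}(\overline{X})$ for a Hölder exponent $\theta\in(0,1)$. The sectional curvatures of a CC metric approach $-|dr|^2_{\overline g}$ at $M$, and $|dr|^2_{\overline g}|_M$ is independent of the choice of $r$. For $\kappa>0$, a CC manifold $(X^{n+1},g_+)$ is $\mathrm{AH}(-\kappa^2)$ if its asymptotic sectional curvatures at $M$ are equal to the constant $-\kappa^2$, equivalently $|dr|^2_{r^2g_+}=\kappa^2$ on $M$ for any defining function $r$. For a bounded domain $\Omega\subset X$ with smooth boundary, $$\lambda_{1,p}(\Omega)=\inf_{f\in W^{1,p}_0(\Omega)\setminus\{0\}}\frac{\int_\Omega|\nabla_{g_+}f|^p\,dv_{g_+}}{\int_\Omega|f|^p\,dv_{g_+}},$$ where $W^{1,p}_0(\Omega)$ is the completion of $C^\infty_0(\Omega)$ in the Sobolev norm. The first $p$-Dirichlet eigenvalue of $(X,g_+)$ is $\lambda_{1,p}(X):=\inf_\Omega\lambda_{1,p}(\Omega)$,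 the infimum being over all bounded domains of $X$ with smooth boundary. *)

(* Defs.v *)
From HB Require Import structures.
From mathcomp Require Import all_boot all_order all_algebra.
From mathcomp Require Import all_classical all_reals all_analysis.

Set Implicit Arguments.
Unset Strict Implicit.
Unset Printing Implicit Defensive.
Import Order.TTheory GRing.Theory Num.Theory.
Import numFieldNormedType.Exports.

Local Open Scope classical_set_scope.
Local Open Scope ring_scope.

Section euclidean.
Context {R : realType}.

(* For Borel functions with values in [0, +oo] this is, by Tonelli, the
   integral against m-dimensional Lebesgue measure. *)
Fixpoint lebesgue_int (m : nat) : ('rV[R]_m -> \bar R) -> \bar R :=
  match m with
  | 0%N => fun f => f 0
  | m'.+1 => fun f =>
      (\int[@lebesgue_measure R]_t
         lebesgue_int (fun v : 'rV[R]_m' => f (row_mx (t%:M : 'rV_1) v)))%E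
  end.

Context {n : nat}.
Local Notation E := 'rV[R]_n.+1.
Implicit Types (U V : set E) (f : E -> R) (i : 'I_n.+1).

Definition basis_vec i : E := delta_mx 0 i.

Definition half_space : set E := [set y | 0 <= y 0 0].

Definition continuous_on U f : Prop := forall y, U y -> {for y, continuous f}.

Definition hoelder_on (theta : R) U f : Prop :=
  exists L : R, forall y z, U y -> U z ->
    `|f y - f z| <= L * `|y - z| `^ theta.

(* For U open: f has continuous partial derivatives up to order k - 1, and
   those of order k exist and satisfy B. *)
Fixpoint class_C (B : set E -> (E -> R) -> Prop) (k : nat) U f : Prop :=
  match k with
  | 0%N => B U f
  | k'.+1 => continuous_on U f /\
      forall i, (forall y, U y -> derivable f y (basis_vec i)) /\
                class_C B k' U (fun y => 'D_(basis_vec i) f y)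
  end.

Definition Cinfty U f : Prop := forall k, class_C continuous_on k U f.

Definition Choelder (k : nat) (theta : R) U f : Prop :=
  class_C (fun W h => continuous_on W h /\ hoelder_on theta W h) k U f.

(* Regularity on a set V that is only relatively open in the half-space:
   near each point of V, f is the restriction of a function of class P defined
   on an open subset of R^(n+1). *)
Definition local_class (P : set E -> (E -> R) -> Prop) V f : Prop :=
  forall y, V y -> exists (W : set E) (F : E -> R),
    [/\ open W, W y, P W F & forall z, W z -> V z -> F z = f z].

(* Right-sided, so that it only involves points of the half-space; it is the
   ordinary partial derivative for functions that are C^1 up to the boundary. *)
Definition rpartial i f (y : E) : R :=
  lim ((fun h : R => h^-1 * (f (y + h *: basis_vec i) - f y)) @ 0^'+).

End euclidean.

(* The charts have domain dom c, coordinates phi c and inverse psi c;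
   chart_at x is a chart around x. *)
Record atlas (R : realType) (n : nat) (T : ptopologicalType) := Atlas {
  idx : Type;
  dom : idx -> set T;
  phi : idx -> T -> 'rV[R]_n.+1;
  psi : idx -> 'rV[R]_n.+1 -> T;
  chart_at : T -> idx }.

Section manifold.
Context {R : realType} {n : nat} {T : ptopologicalType}.
Variable A : atlas R n T.
Implicit Types (c : idx A) (x : T) (S : set T).

Definition chart_image c S : set 'rV[R]_n.+1 := phi c @` (dom c `&` S).

Definition is_chart c : Prop :=
  [/\ open (dom c),
      exists2 W, open W & chart_image c setT = W `&` half_space,
      {within dom c, continuous (phi c)},
      {within chart_image c setT, continuous (psi c)} &
      forall x, dom c x -> psi c (phi c x) = x].

Definition smooth_transition c c' : Prop :=
  forall j, local_class Cinfty (chart_image c (dom c'))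
              (fun y => phi c' (psi c y) 0 j).

Definition minterior : set T := [set x | exists2 c : idx A, dom c x & 0 < phi c x 0 0].

Definition mboundary : set T := [set x | exists2 c : idx A, dom c x & phi c x 0 0 = 0].

Definition compact_manifold_with_boundary : Prop :=
  [/\ hausdorff_space T, compact [set: T], mboundary !=set0,
      forall x, dom (chart_at A x) x &
      (forall c, is_chart c) /\ (forall c c', smooth_transition c c')].

Definition smooth_on S (f : T -> R) : Prop :=
  forall c, local_class Cinfty (chart_image c S) (f \o psi c).

(* Covector fields and symmetric 2-tensors are given by their components in
   each chart. *)
Definition cofield := idx A -> T -> 'rV[R]_n.+1.
Definition tensor := idx A -> T -> 'M[R]_n.+1.

Definition differential (f : T -> R) : cofield :=
  fun c x => \row_i rpartial i (f \o psi c) (phi c x).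

Definition jacobian c c' x : 'M[R]_n.+1 :=
  \matrix_(i, j) rpartial i (fun y => phi c' (psi c y) 0 j) (phi c x).

Definition riemannian_metric (theta : R) S (g : tensor) : Prop :=
  [/\ forall c x, dom c x -> S x -> (g c x)^T = g c x,
      forall c x (v : 'rV[R]_n.+1), dom c x -> S x -> v != 0 ->
        0 < (v *m g c x *m v^T) 0 0,
      forall c i j, local_class (Choelder 3 theta) (chart_image c S)
                      (fun y => g c (psi c y) i j) &
      forall c c' x, dom c x -> dom c' x -> S x ->
        g c x = jacobian c c' x *m g c' x *m (jacobian c c' x)^T].

(* |w|_g^2 at x, in the coordinates of c *)
Definition conorm2 (g : tensor) (w : cofield) c x : R :=
  (w c x *m invmx (g c x) *m (w c x)^T) 0 0.

(* As |grad f|_g = |df|_g, gradients enter only through differentials. *)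
Definition conorm (g : tensor) (w : cofield) x : R :=
  Num.sqrt (conorm2 g w (chart_at A x) x).

(* C^1 on [0, 1], i.e. the restriction of a C^1 curve defined near [0, 1] *)
Definition C1_curve (gamma : R -> T) : Prop :=
  forall t : R, 0 <= t <= 1 ->
    [/\ minterior (gamma t), {for t, continuous gamma} &
        forall c, dom c (gamma t) ->
          (\forall s \near t, derivable (phi c \o gamma) s 1) /\
          {for t, continuous (derive1 (phi c \o gamma))}].

Definition speed (g : tensor) (gamma : R -> T) (t : R) : R :=
  let c := chart_at A (gamma t) in
  let v := derive1 (phi c \o gamma) t in
  Num.sqrt ((v *m g c (gamma t) *m v^T) 0 0).

Definition curve_length (g : tensor) (gamma : R -> T) : \bar R :=
  (\int[@lebesgue_measure R]_(t in `[0%R, 1%R]) (speed g gamma t)%:E)%E.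

Definition rdist (g : tensor) x y : \bar R :=
  ereal_inf [set l | exists gamma : R -> T,
    [/\ C1_curve gamma, gamma 0 = x, gamma 1 = y & l = curve_length g gamma]].

Definition complete_metric (g : tensor) : Prop :=
  forall u : nat -> T, (forall k, minterior (u k)) ->
    (forall e : R, 0 < e -> exists N : nat, forall j k : nat,
        (N <= j)%N -> (N <= k)%N -> (rdist g (u j) (u k) < e%:E)%E) ->
    exists2 x, minterior x &
      forall e : R, 0 < e -> exists N : nat, forall k : nat,
        (N <= k)%N -> (rdist g (u k) x < e%:E)%E.

Definition defining_function (r : T -> R) : Prop :=
  [/\ smooth_on setT r,
      forall x, minterior x -> 0 < r x,
      forall x, mboundary x -> r x = 0 &
      forall c x, dom c x -> mboundary x -> differential r c x != 0].

(* gbar is a metric on all of T and equals r^2 g in the interior. *)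
Definition compactification (theta : R) (g : tensor) (r : T -> R)
    (gbar : tensor) : Prop :=
  [/\ defining_function r, riemannian_metric theta setT gbar &
      forall c x, dom c x -> minterior x -> gbar c x = r x ^+ 2 *: g c x].

Definition conformally_compact (theta : R) (g : tensor) : Prop :=
  [/\ riemannian_metric theta minterior g, complete_metric g &
      exists r gbar, compactification theta g r gbar].

(* AH(-kappa^2) *)
Definition asymptotically_hyperbolic (theta kappa : R) (g : tensor) : Prop :=
  conformally_compact theta g /\
  forall r gbar, compactification theta g r gbar ->
    forall c x, dom c x -> mboundary x ->
      conorm2 gbar (differential r) c x = kappa ^+ 2.

Definition borel : Type := g_sigma_algebraType (@open T).
HB.instance Definition _ := Measurable.on borel.

(* Characterizes the Riemannian measure dv_g on the Borel sets of the
   interior. *)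
Definition riemannian_volume (g : tensor) (vol : {measure set borel -> \bar R})
    : Prop :=
  forall c (B : set borel), measurable B -> B `<=` dom c `&` minterior ->
    vol B = lebesgue_int (fun y : 'rV[R]_n.+1 =>
      (\1_(phi c @` B) y * Num.sqrt (\det (g c (psi c y))))%:E).

Definition smooth_bounded_domain (g : tensor) (Omega : set T) : Prop :=
  [/\ [/\ Omega !=set0, open Omega & connected Omega],
      Omega `<=` minterior,
      exists d : R, forall x y, Omega x -> Omega y ->
        (rdist g x y <= d%:E)%E &
      forall x, minterior x -> closure Omega x -> ~ Omega x ->
        exists (U : set T) (rho : T -> R),
          [/\ open U, U x, U `<=` minterior, smooth_on U rho &
              (forall c, dom c x -> differential rho c x != 0) /\
              (forall y, U y -> (Omega y <-> rho y < 0))]].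

Section spectrum.
Variables (g : tensor) (vol : {measure set borel -> \bar R}) (p : R).
Implicit Types (Omega : set T) (f : T -> R) (w : cofield).

Definition test_function Omega f : Prop :=
  smooth_on Omega f /\
  exists K : set T, [/\ compact K, K `<=` Omega & forall x, ~ K x -> f x = 0].

Definition measurable_cofield Omega w : Prop :=
  (forall c j,
     measurable_fun (dom c `&` Omega : set borel) (fun x : borel => w c x 0 j))
  /\ forall c c' x, dom c x -> dom c' x -> Omega x ->
       w c x = w c' x *m (jacobian c c' x)^T.

Definition Lp_int Omega f : \bar R :=
  (\int[vol]_(x in (Omega : set borel)) (`|f x| `^ p)%:E)%E.

(* f belongs to the completion W^{1,p}_0(Omega), with differential w: the pair
   (f, w) is an L^p limit of pairs (u, du), u in C^infty_0(Omega). *)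
Definition W1p0 Omega f w : Prop :=
  [/\ measurable_fun (Omega : set borel) (f : borel -> R),
      measurable_cofield Omega w,
      (Lp_int Omega f < +oo)%E,
      (Lp_int Omega (conorm g w) < +oo)%E &
      exists u : nat -> T -> R,
        [/\ forall k, test_function Omega (u k),
            Lp_int Omega (u k \- f) @[k --> \oo] --> 0%E &
            Lp_int Omega (conorm g (fun c x => differential (u k) c x - w c x))
              @[k --> \oo] --> 0%E]].

Definition lambda1_domain Omega : \bar R :=
  ereal_inf [set q | exists f w,
    [/\ W1p0 Omega f w, Lp_int Omega f != 0%E &
        q = (Lp_int Omega (conorm g w) / Lp_int Omega f)%E]].

Definition lambda1 : \bar R :=
  ereal_inf [set lambda1_domain Omega | Omega in smooth_bounded_domain g].

End spectrum.

End manifold.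

Arguments borel : clear implicits.

(* Main.v *)
(* Near a boundary point g_+ is, up to bounded factors, the hyperbolic metric of
   the half-space y_0 > 0: |df|^2 is y_0^2 times a quadratic form in the partial
   derivatives whose (0, 0) coefficient tends to kappa^2, and the volume density
   lies between two multiples of y_0^-(n+1). The function y_0^(n/p) has
   |df| <= (n kappa / p + o(1)) f, and |f|^p dv is comparable to dy_0/y_0 times
   Lebesgue measure in the other coordinates. It is cut off to a box
   a <= y_0 <= b, |y_i - p_i| <= L, between this box and the enlarged one
   a/2 <= y_0 < 2b, |y_i - p_i| <= L + dl; there |df| is still at most a constant
   times y_0^(n/p), uniformly in the boxes as long as 2b <= dl. It remains to make
   the mass of the shell negligible. Along a chain of M + 1 such nested boxes, of
   between M and 3M dyadic slabs each, the masses lie within a constant factor of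
   each other, so by the pigeonhole principle some shell has relative mass
   O(1/M). *)

Require Import Defs.
From HB Require Import structures.
From mathcomp Require Import all_boot all_order all_algebra.
From mathcomp Require Import all_classical all_reals all_analysis.
From mathcomp Require Import ring lra measurable_realfun perm.
Import Order.TTheory GRing.Theory Num.Theory.
Import numFieldNormedType.Exports.
Local Open Scope classical_set_scope.
Local Open Scope ring_scope.
Set Implicit Arguments.
Unset Strict Implicit.
Unset Printing Implicit Defensive.

(** * Differential calculus on R^(n+1) *)

(** The exponent n/p is the borderline one: mass neither grows nor decays with height, so that
    cutting off in y_0 costs two slabs out of at least M. Sideways, a cut-off of slope 1/dl is tamed
    by the factor y_0 of the gradient norm only below height dl; hence flat boxes, of height O(l/M)
    against sides of about l. The volume density is known only up to the factor m2/m1, so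
    subtracting two volume estimates cannot show that a shell is small. Differences of the masses
    themselves telescope, and m2/m1 then enters as a mere constant. This fixes the order of choices:
    eta from the error allowed in kappa, then the coordinate cube with m1, m2 and the bound on the
    quadratic form, and M last. A box has corners and is not an admissible domain. Any smooth
    bounded domain containing the support serves equally well, so the box is placed inside a
    sublevel set of an explicit convex function; convexity yields connectedness, segments joining
    any two points, and a regular boundary. *)

Lemma continuous_at_sum {R : realType} (X : topologicalType) (I : finType)
    (F : I -> X -> R) (x : X) :
  (forall i, {for x, continuous (F i)}) ->
  {for x, continuous (fun z => \sum_i F i z)}.
Proof.
move=> cF; rewrite /prop_for /continuous_at.
exact: (@cvg_big _ _ _ _ _ (@add_continuous R) X (nbhs x) _ F (F^~ x)
  (nbhs_filter x) (fun i _ => cF i)).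
Qed.

Section calculus.
Context {R : realType} {n : nat}.
Local Notation E := 'rV[R]_n.+1.
Implicit Types (U V W : set E) (f g : E -> R) (i j k : 'I_n.+1).

Lemma coord_le_norm (y : E) i : `|y 0 i| <= `|y|.
Proof.
rewrite [leRHS]/Num.Def.normr/= mx_normrE.
exact: (le_bigmax _ (fun ij => `|y ij.1 ij.2|) (0, i)).
Qed.

Lemma norm_rV_le (y : E) (c : R) : (forall i, `|y 0 i| <= c) -> `|y| <= c.
Proof.
move=> yc; rewrite [leLHS]/Num.Def.normr/= mx_normrE.
apply: bigmax_le => [|[a b] _] /=; first exact: le_trans (yc ord0).
by rewrite (ord1 a).
Qed.

Lemma derive_line f (z : E) (v : E) (t : R) :
  derivable f (z + t *: v) v ->
  is_derive t 1 (fun s : R => f (z + s *: v)) ('D_v f (z + t *: v)).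
Proof.
move=> df.
have eqg : (fun h : R => h^-1 *: (((fun s : R => f (z + s *: v)) \o shift t) (h *: 1)
    - f (z + t *: v))) =
  (fun h : R => h^-1 *: ((f \o shift (z + t *: v)) (h *: v) - f (z + t *: v))).
  apply/funext => h /=; congr (_ *: (f _ - _)).
  by rewrite [h%:A]mulr1 scalerDl addrCA.
by split; rewrite /derivable /derive eqg.
Qed.

(** Phrased with absolute values so that the increment [s] may have either sign. *)
Lemma MVT_sym (phi dphi : R -> R) (s : R) :
  (forall t : R, `|t| <= `|s| -> is_derive t 1 phi (dphi t)) ->
  exists2 c, `|c| <= `|s| & phi s - phi 0 = dphi c * s.
Proof.
move=> dphiP.
have cont a b : (forall t, a <= t <= b -> `|t| <= `|s|) ->
    {within `[a, b], continuous phi}.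
  move=> ab; apply: derivable_within_continuous => t; rewrite in_itv/= => /ab.
  by move=> /dphiP d; exact: ex_derive.
have [s0|s0] := leP 0 s.
  have [||c] := @MVT_segment R phi dphi 0 s s0.
  - move=> t; rewrite in_itv/= => /andP[t0 ts]; apply: dphiP.
    by rewrite (ger0_norm (ltW t0)) (ger0_norm s0) ltW.
  - by apply: cont => t /andP[t0 ts]; rewrite (ger0_norm t0) (ger0_norm s0).
  rewrite in_itv/= => /andP[c0 cs]; rewrite subr0 => e; exists c => //.
  by rewrite (ger0_norm c0) (ger0_norm s0).
have [||c] := @MVT_segment R phi dphi s 0 (ltW s0).
- move=> t; rewrite in_itv/= => /andP[t0 ts]; apply: dphiP.
  by rewrite (ler0_norm (ltW ts)) (ler0_norm (ltW s0)) lerN2 ltW.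
- by apply: cont => t /andP[t0 ts]; rewrite (ler0_norm ts) (ler0_norm (ltW s0)) lerN2.
rewrite in_itv/= => /andP[c0 cs]; rewrite sub0r => e; exists c => //.
  by rewrite (ler0_norm cs) (ler0_norm (ltW s0)) lerN2.
by rewrite -opprB e mulrN opprK.
Qed.

(** The vertices of a path from 0 ([k = 0]) to [h] ([k = n + 1]) whose edges are parallel to the
    axes. *)
Definition trunc_vec (k : nat) (h : E) : E :=
  \row_i (if (i < k)%N then h 0 i else 0).

Lemma trunc_vecS i (h : E) :
  trunc_vec i.+1 h = trunc_vec i h + h 0 i *: basis_vec i.
Proof.
apply/rowP => j; rewrite !mxE ltnS eqxx /= eq_sym.
have [->|ij] := eqVneq i j; first by rewrite leqnn ltnn mulr1 add0r.
by rewrite mulr0 addr0 leq_eqVlt (inj_eq val_inj) eq_sym (negbTE ij).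
Qed.

Lemma row_sum_basis (h : E) : h = \sum_i h 0 i *: basis_vec i.
Proof.
by rewrite [LHS]row_sum_delta; apply: eq_bigr => i _; rewrite /basis_vec.
Qed.

(* The increment is split into n + 1 increments, each in one coordinate. *)
Lemma C1_increment f (y : E) (e : R) : 0 < e ->
  (forall i, \forall z \near y, derivable f z (basis_vec i)) ->
  (forall i, {for y, continuous (fun z => 'D_(basis_vec i) f z)}) ->
  \forall h \near (0 : E),
    `|f (y + h) - f y - \sum_i h 0 i * 'D_(basis_vec i) f y| <= e * `|h|.
Proof.
move=> e0 df cf.
pose e' := e / n.+1%:R.
have e'0 : 0 < e' by rewrite divr_gt0.
have near_i i : \forall z \near y, derivable f z (basis_vec i) /\
    `|'D_(basis_vec i) f z - 'D_(basis_vec i) f y| <= e'.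
  apply: filterI; first exact: df.
  have /cvgrPdist_le/(_ _ e'0) := cf i.
  by apply: filterS => z; rewrite distrC.
have /nbhs_ballP[r /= r0 rP] : nbhs y [set z | forall i,
    derivable f z (basis_vec i) /\
    `|'D_(basis_vec i) f z - 'D_(basis_vec i) f y| <= e'].
  exact: filter_forall near_i.
near=> h.
have hr : `|h| < r.
  near: h; apply/nbhs_ballP; exists r => //= z.
  by rewrite -ball_normE /ball_/= sub0r normrN.
have step i : `|f (y + trunc_vec i.+1 h) - f (y + trunc_vec i h) -
    h 0 i * 'D_(basis_vec i) f y| <= e' * `|h|.
  pose z := y + trunc_vec i h.
  have ballz t : `|t| <= `|h 0 i| -> ball y r (z + t *: basis_vec i).
    move=> th; rewrite -ball_normE /ball_/= /z opprD opprD addrA addrA subrr.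
    rewrite sub0r -opprD normrN (le_lt_trans _ hr)//.
    apply: norm_rV_le => j; rewrite !mxE/=.
    have [<-|ij] := eqVneq i j; last first.
      rewrite mulr0 addr0; case: ifPn => _; first exact: coord_le_norm.
      by rewrite normr0.
    by rewrite ltnn add0r mulr1 (le_trans th)// coord_le_norm.
  have [c ch E1] := @MVT_sym (fun t => f (z + t *: basis_vec i))
    (fun t => 'D_(basis_vec i) f (z + t *: basis_vec i)) (h 0 i)
    (fun t th => derive_line (rP _ (ballz t th) i).1).
  rewrite trunc_vecS addrA -/z; move: E1; rewrite scale0r addr0 => ->.
  rewrite [_ * h 0 i]mulrC -mulrBr normrM mulrC.
  apply: ler_pM => //; last exact: coord_le_norm.
  exact: (rP _ (ballz c ch) i).2.
have t0 : trunc_vec 0 h = 0 by apply/rowP => j; rewrite !mxE.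
have tn : trunc_vec n.+1 h = h by apply/rowP => j; rewrite !mxE ltn_ord.
have -> : f (y + h) - f y - \sum_i h 0 i * 'D_(basis_vec i) f y =
  \sum_(i < n.+1) (f (y + trunc_vec i.+1 h) - f (y + trunc_vec i h) -
    h 0 i * 'D_(basis_vec i) f y).
  rewrite big_split/= sumrN; congr (_ - _).
  rewrite -(big_mkord xpredT
    (fun i : nat => f (y + trunc_vec i.+1 h) - f (y + trunc_vec i h))).
  by rewrite (telescope_sumr (fun i : nat => f (y + trunc_vec i h)))// tn t0 addr0.
rewrite (le_trans (ler_norm_sum _ _ _))//.
apply: (le_trans (ler_sum _ (fun i _ => step i))).
rewrite sumr_const card_ord -mulr_natr mulrAC /e' divfK//.
Unshelve. all: by end_near. Qed.

(** The candidate for the differential, declared linear below so that uniqueness of the differential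
    applies to it. *)
Definition grad_lin f (y : E) (h : E) : R := \sum_i h 0 i * 'D_(basis_vec i) f y.

Lemma grad_lin_is_linear f y : linear (grad_lin f y : E -> R).
Proof.
move=> a u v; rewrite /grad_lin scaler_sumr -big_split/=; apply: eq_bigr => i _.
by rewrite !mxE mulrDl scalerAl.
Qed.
HB.instance Definition _ f y :=
  GRing.isLinear.Build R E R _ (grad_lin f y) (@grad_lin_is_linear f y).

Lemma grad_lin_continuous f y : continuous (grad_lin f y).
Proof.
move=> h; apply: continuous_at_sum => i.
exact: (cvgM (@coord_continuous R 1 n.+1 0 i h) (cvg_cst _)).
Qed.

Section C1.
Variables (f : E -> R) (y : E).
Hypothesis df : forall i, \forall z \near y, derivable f z (basis_vec i).
Hypothesis cf : forall i, {for y, continuous (fun z => 'D_(basis_vec i) f z)}.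

(** [C1_increment] is the little-o estimate that both parts ask for: it identifies the differential
    with [grad_lin f y], and this identification then gives differentiability. *)
Lemma C1_diff_subproof :
  differentiable f y /\ 'd f y = grad_lin f y :> (E -> R).
Proof.
have cL := @grad_lin_continuous f y.
have dE : 'd f y = grad_lin f y :> (E -> R).
  apply: (@diff_unique R E R f (grad_lin f y) y cL).
  apply/eqaddoP => e e0; near=> h.
  rewrite -![(_ + _ : _ -> _) _]/(_ + _) -![(- _ : _ -> _) _]/(- _) /= /cst/=.
  rewrite opprD addrA (addrC h); near: h; exact: C1_increment.
split=> //; apply/diff_locallyP; split; first by rewrite dE.
rewrite dE; apply/eqaddoP => e e0; near=> h.
rewrite -![(_ + _ : _ -> _) _]/(_ + _) -![(- _ : _ -> _) _]/(- _) /= /cst/=.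
rewrite opprD addrA (addrC h); near: h; exact: C1_increment.
Unshelve. all: by end_near. Qed.

Lemma C1_differentiable : differentiable f y.
Proof. by case: C1_diff_subproof. Qed.

Lemma C1_diff : 'd f y = grad_lin f y :> (E -> R).
Proof. by case: C1_diff_subproof. Qed.

Lemma C1_deriveE v : 'D_v f y = \sum_i v 0 i * 'D_(basis_vec i) f y.
Proof. by rewrite deriveE ?C1_diff//; exact: C1_differentiable. Qed.
End C1.
End calculus.

(** * Functions of class C^k: closure under sums, products and composition *)

Section smooth.
Context {R : realType} {n : nat}.
Local Notation E := 'rV[R]_n.+1.
Local Notation C k := (class_C (@continuous_on R n) k).
Implicit Types (U V W : set E) (f g : E -> R) (i j : 'I_n.+1).

Lemma is_derive_ex (V1 V2 : normedModType R) (f : V1 -> V2) y v df :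
  is_derive y v f df -> derivable f y v.
Proof. by case. Qed.

Lemma is_derive_val (V1 V2 : normedModType R) (f : V1 -> V2) y v df :
  is_derive y v f df -> 'D_v f y = df.
Proof. by case. Qed.

Lemma near_open (X : topologicalType) (U : set X) (P : X -> Prop) (y : X) :
  open U -> U y -> (forall z, U z -> P z) -> \forall z \near y, P z.
Proof.
by move=> oU Uy UP; apply: filterS UP _; apply: open_nbhs_nbhs; split.
Qed.

Lemma continuous_at_eq (X Y : topologicalType) (f g : X -> Y) (y : X) :
  (\forall z \near y, f z = g z) -> {for y, continuous f} ->
  {for y, continuous g}.
Proof.
move=> fg; rewrite /prop_for /continuous_at (nbhs_singleton fg).
exact: cvg_trans (near_eq_cvg fg).
Qed.

Lemma class_C_continuous k U f : C k U f -> continuous_on U f.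
Proof. by case: k => [|k] // []. Qed.

Lemma class_C_sub k U V f : V `<=` U -> C k U f -> C k V f.
Proof.
move=> VU; elim: k f => [f cf y Vy|k IH f [cf df]]; first exact/cf/VU.
split=> [y Vy|i]; first exact/cf/VU.
by have [d c] := df i; split=> [y Vy|]; [exact/d/VU|exact: IH].
Qed.

Lemma class_C_eq k U f g : open U -> (forall y, U y -> f y = g y) ->
  C k U f -> C k U g.
Proof.
move=> oU; elim: k f g => [|k IH] f g fg.
  move=> cf y Uy; apply: continuous_at_eq (cf _ Uy); exact: near_open Uy fg.
case=> cf df; split=> [y Uy|i].
  apply: continuous_at_eq (cf _ Uy); exact: near_open Uy fg.
have [d c] := df i; split=> [y Uy|].
  by apply: near_eq_derivable (d _ Uy); exact: near_open Uy fg.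
apply: IH c => y Uy; apply: near_eq_derive; exact: near_open Uy fg.
Qed.

Lemma class_CW k U f : C k.+1 U f -> C k U f.
Proof.
elim: k f => [f []//|k IH f [cf df]]; split=> // i.
by have [d c] := df i; split=> //; exact: IH.
Qed.

Lemma class_C_differentiable k U f y : open U -> C k.+1 U f -> U y ->
  differentiable f y.
Proof.
move=> oU [_ df] Uy; apply: C1_differentiable => i; have [d c] := df i.
  exact: near_open Uy d.
exact: (class_C_continuous c).
Qed.

Lemma class_C_deriveE k U f y v : open U -> C k.+1 U f -> U y ->
  'D_v f y = \sum_i v 0 i * 'D_(basis_vec i) f y.
Proof.
move=> oU [_ df] Uy; apply: C1_deriveE => i; have [d c] := df i.
  exact: near_open Uy d.
exact: (class_C_continuous c).
Qed.

Lemma class_C_cst k U (a : R) : C k U (fun=> a).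
Proof.
elim: k a => [a y _|k IH a]; first exact: cst_continuous.
split=> [y _|i]; first exact: cst_continuous.
split=> [y _|]; first exact: derivable_cst.
suff -> : (fun y : E => 'D_(basis_vec i) (fun=> a) y) = fun=> 0 by exact: IH.
by apply/funext => y; rewrite derive_cst.
Qed.

Lemma derive_coord i y v : is_derive y v (fun z : E => z 0 i) (v 0 i).
Proof.
have eqg : (fun h : R => h^-1 *: (((fun z : E => z 0 i) \o shift y) (h *: v) - y 0 i))
    @ 0^' --> (v 0 i).
  apply: (@cvg_trans _ ((fun=> v 0 i) @ (0:R)^')); last exact: cvg_cst.
  apply: near_eq_cvg; near=> h.
  rewrite /= !mxE addrK; apply/esym; rewrite -[_ *: _]/(_ * _) mulKf//.
  by near: h; exact: nbhs_dnbhs_neq.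
by split; [apply/cvg_ex; exists (v 0 i)|exact: cvg_lim].
Unshelve. all: by end_near. Qed.

Lemma class_C_coord k U i : C k U (fun z => z 0 i).
Proof.
case: k => [y _|k]; first exact: coord_continuous.
split=> [y _|j]; first exact: coord_continuous.
split=> [y _|]; first exact: is_derive_ex (derive_coord _ _ _).
suff -> : (fun y : E => 'D_(basis_vec j) (fun z : E => z 0 i) y) =
  fun=> (basis_vec j : E) 0 i by exact: class_C_cst.
by apply/funext => y; rewrite (is_derive_val (derive_coord _ _ _)).
Qed.

Lemma class_C_D k U f g : open U -> C k U f -> C k U g ->
  C k U (fun y => f y + g y).
Proof.
move=> oU; elim: k f g => [f g cf cg y Uy|k IH f g [cf df] [cg dg]].
  exact: (cvgD (cf _ Uy) (cg _ Uy)).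
split=> [y Uy|i]; first exact: (cvgD (cf _ Uy) (cg _ Uy)).
have [d1 c1] := df i; have [d2 c2] := dg i; split=> [y Uy|].
  exact: (derivableD (d1 _ Uy) (d2 _ Uy)).
apply: class_C_eq (IH _ _ c1 c2) => // y Uy.
by rewrite -(deriveD (d1 _ Uy) (d2 _ Uy)).
Qed.

Lemma class_C_M k U f g : open U -> C k U f -> C k U g ->
  C k U (fun y => f y * g y).
Proof.
move=> oU; elim: k f g => [f g cf cg y Uy|k IH f g Cf Cg].
  exact: (cvgM (cf _ Uy) (cg _ Uy)).
have [cf df] := Cf; have [cg dg] := Cg.
split=> [y Uy|i]; first exact: (cvgM (cf _ Uy) (cg _ Uy)).
have [d1 c1] := df i; have [d2 c2] := dg i; split=> [y Uy|].
  exact: (derivableM (d1 _ Uy) (d2 _ Uy)).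
have := class_C_D oU (IH _ _ (class_CW Cf) c2) (IH _ _ (class_CW Cg) c1).
by apply: class_C_eq => // y Uy; rewrite -(deriveM (d1 _ Uy) (d2 _ Uy)).
Qed.

Lemma class_C_sum k U (I : finType) (F : I -> E -> R) : open U ->
  (forall a, C k U (F a)) -> C k U (fun y => \sum_a F a y).
Proof.
move=> oU CF; apply: (@class_C_eq _ _ (\sum_a F a)) => //.
  by move=> y _; rewrite fct_sumE.
apply: (big_ind (fun f => C k U f)) => //; first exact: class_C_cst.
by move=> f g; exact: class_C_D.
Qed.

Lemma class_C_prod k U (I : finType) (F : I -> E -> R) : open U ->
  (forall a, C k U (F a)) -> C k U (fun y => \prod_a F a y).
Proof.
move=> oU CF; elim: (index_enum I) => [|a s IH].
  apply: class_C_eq (class_C_cst k U 1) => // y _; by rewrite big_nil.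
by apply: class_C_eq (class_C_M oU (CF a) IH) => // y _; rewrite big_cons.
Qed.

(** A function together with all its derivatives: on [O], [phi m] is the m-th derivative of
    [phi 0]. *)
Definition tower (O : set R) (phi : nat -> R -> R) : Prop :=
  forall m t, O t -> is_derive t 1 (phi m) (phi m.+1 t).

(** Induction on [k] for all [m] at once, because differentiating [phi m \o h] produces
    [phi m.+1 \o h] times a derivative of [h]. *)
Lemma tower_comp O phi k U h : tower O phi -> open U ->
  (forall y, U y -> O (h y)) -> C k U h -> forall m, C k U (phi m \o h).
Proof.
move=> tphi oU hO; have cphi m y : U y -> {for h y, continuous (phi m)}.
  move=> /hO/tphi d; apply: differentiable_continuous; apply/derivable1_diffP.
  exact: is_derive_ex (d m).
elim: k => [ch m y Uy|k IH Ch m].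
  exact: continuous_comp (ch _ Uy) (cphi _ _ Uy).
have [ch dh] := Ch.
have dphi y : U y -> differentiable (phi m) (h y).
  by move=> /hO/tphi d; apply/derivable1_diffP; exact: is_derive_ex (d m).
have dfh y : U y -> differentiable h y by exact: class_C_differentiable Ch.
have dcomp y : U y -> differentiable (phi m \o h) y.
  by move=> Uy; apply: differentiable_comp; [exact: dfh|exact: dphi].
split=> [y Uy|i]; first exact: continuous_comp (ch _ Uy) (cphi _ _ Uy).
split=> [y Uy|]; first exact/diff_derivable/dcomp.
apply: class_C_eq (class_C_M oU (IH (class_CW Ch) m.+1) (dh i).2) => // y Uy.
rewrite [RHS](deriveE _ (dcomp _ Uy)) (diff_comp (dfh _ Uy) (dphi _ Uy)).
rewrite /= -(deriveE _ (dfh _ Uy)).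
have lin1 (a : R) : 'd (phi m) (h y) a = a * 'd (phi m) (h y) 1.
  by rewrite -[a in LHS]mulr1 [LHS]linearZ.
rewrite lin1 -(deriveE _ (dphi _ Uy)).
by rewrite (is_derive_val (tphi m _ (hO _ Uy))) mulrC.
Qed.

Lemma row_differentiable (h : 'I_n.+1 -> E -> R) y :
  (forall j, differentiable (h j) y) ->
  differentiable (fun z => \row_j h j z : E) y.
Proof.
move=> dh; have -> : (fun z => \row_j h j z : E) =
    \sum_j (fun z => h j z *: (basis_vec j : E)).
  apply/funext => z; rewrite fct_sumE [LHS]row_sum_basis.
  by apply: eq_bigr => j _; rewrite mxE.
by apply: differentiable_sum => j; exact: differentiableZl.
Qed.

Lemma row_continuous (X : topologicalType) m (h : 'I_m -> X -> R) y :
  (forall l, {for y, continuous (h l)}) ->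
  {for y, continuous (fun z => \row_l h l z : 'rV[R]_m)}.
Proof.
move=> ch; apply/cvgrPdist_le => e e0.
suff : \forall z \near y, forall l, `|h l y - h l z| <= e.
  apply: filterS => z zy; rewrite [leLHS]/Num.Def.normr/= mx_normrE.
  by apply: bigmax_le => [|[a b] _]; [exact: ltW|rewrite !mxE].
have near_l l : \forall z \near y, `|h l y - h l z| <= e.
  by have /cvgrPdist_le/(_ _ e0) := ch l.
exact: filter_forall near_l.
Qed.

Lemma derive_comp_row (F : E -> R) (h : 'I_n.+1 -> E -> R) y v :
  differentiable F (\row_j h j y) -> (forall j, differentiable (h j) y) ->
  differentiable (fun z => F (\row_j h j z)) y /\
  'D_v (fun z => F (\row_j h j z)) y =
    'D_(\row_j 'D_v (h j) y) F (\row_j h j y).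
Proof.
move=> dF dh; have dH := row_differentiable dh.
have dFH := differentiable_comp dH dF.
split=> //; rewrite (deriveE _ dFH) (diff_comp dH dF) /= -(deriveE _ dH).
rewrite (deriveE _ dF); congr ('d F _ _).
rewrite derive_mx; last exact: diff_derivable.
apply/matrixP => a b; rewrite !mxE; congr ('D_v _ y).
by apply/funext => z; rewrite mxE.
Qed.

(** Induction on [k] for all [F] with [h] fixed: the chain rule writes a partial derivative of the
    composite as a sum of derivatives of [h] times composites of the partials of [F] with the same
    [h]. *)
Lemma class_C_comp k O U (F : E -> R) (h : 'I_n.+1 -> E -> R) : open O -> open U ->
  (forall y, U y -> O (\row_j h j y)) -> C k O F ->
  (forall j, C k U (h j)) -> C k U (fun z => F (\row_j h j z)).
Proof.
move=> oO oU hO; have cc F' : (forall j, continuous_on U (h j)) ->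
    continuous_on O F' -> continuous_on U (fun z => F' (\row_j h j z)).
  move=> ch cF y Uy.
  apply: (continuous_comp (f := fun z => \row_j h j z)).
    by apply: row_continuous => j; exact: ch.
  exact/cF/hO.
elim: k F => [F CF Ch|k IH F CF Ch]; first exact: cc.
have ch j := class_C_continuous (Ch j).
have dF y (Uy : U y) := class_C_differentiable oO CF (hO _ Uy).
have dh j y (Uy : U y) := class_C_differentiable oU (Ch j) Uy.
split=> [|i]; first exact: cc ch (class_C_continuous CF).
split=> [y Uy|].
  apply: diff_derivable.
  exact: (derive_comp_row 0 (dF _ Uy) (fun j => dh j _ Uy)).1.
have : C k U (fun y => \sum_j 'D_(basis_vec i) (h j) y *
    'D_(basis_vec j) F (\row_j h j y)).
  apply: class_C_sum => // j; apply: class_C_M => //; first exact: ((Ch j).2 i).2.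
  apply: (IH (fun z => 'D_(basis_vec j) F z)); first exact: (CF.2 j).2.
  by move=> l; exact: class_CW.
apply: class_C_eq => // y Uy.
rewrite (derive_comp_row _ (dF _ Uy) (fun j => dh j _ Uy)).2.
rewrite (class_C_deriveE _ oO CF (hO _ Uy)).
by apply: eq_bigr => j _; rewrite mxE.
Qed.

End smooth.

(** * A smooth cut-off *)

Section one_variable.
Context {R : realType}.
Implicit Types (t u a : R) (P Q : {poly R}).

(** In the Horner step Q X + c, half of the exponential absorbs the new factor, since u exp (- a u /
    2) <= 2 / a, and the other half is left for Q; hence the induction runs over all [a]. *)
Lemma poly_expR_bounded Q a : 0 < a ->
  exists2 K, 0 <= K & forall u, 0 <= u -> `|Q.[u]| * expR (- (a * u)) <= K.
Proof.
elim/poly_ind: Q a => [a a0|Q c IH a a0].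
  by exists 0 => // u u0; rewrite horner0 normr0 mul0r.
have a20 : 0 < a / 2 by rewrite divr_gt0.
have [K K0 KP] := IH _ a20.
exists (K * (a / 2)^-1 + `|c|) => [|u u0].
  by rewrite addr_ge0// mulr_ge0// invr_ge0 ltW.
have e1 : u * expR (- (a / 2 * u)) <= (a / 2)^-1.
  rewrite expRN ler_pdivrMr ?expR_gt0// -ler_pdivrMl ?invr_gt0// invrK.
  by rewrite (le_trans _ (expR_ge1Dx _))// lerDr.
have e2 : expR (- (a * u)) <= 1.
  by rewrite -expR0 ler_expR oppr_le0 mulr_ge0// ltW.
have e3 : expR (- (a * u)) = expR (- (a / 2 * u)) * expR (- (a / 2 * u)).
  by rewrite -expRD; congr expR; field.
rewrite hornerD hornerM hornerX hornerC.
apply: (le_trans (ler_wpM2r (expR_ge0 _) (ler_normD _ _))).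
rewrite mulrDl lerD//; last by rewrite ler_piMr.
rewrite normrM (ger0_norm u0) e3 mulrACA ler_pM// ?mulr_ge0 ?expR_ge0//.
exact: KP.
Qed.

(* The m-th derivative of exp (- 1 / t) is P_m (1 / t) exp (- 1 / t), with
   P_(m+1) = X^2 (P_m - P_m'). *)
Fixpoint flat_poly m : {poly R} :=
  match m with
  | 0%N => 1
  | m'.+1 => 'X * ('X * (flat_poly m' - (flat_poly m')^`()))
  end.

Definition flat m t : R :=
  if 0 < t then (flat_poly m).[t^-1] * expR (- t^-1) else 0.

Lemma flat_le0 m t : t <= 0 -> flat m t = 0.
Proof. by move=> t0; rewrite /flat ltNge t0. Qed.

Lemma flatE m t : 0 < t -> flat m t = (flat_poly m).[t^-1] * expR (- t^-1).
Proof. by rewrite /flat => ->. Qed.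

Lemma flat0E t : 0 < t -> flat 0 t = expR (- t^-1).
Proof. by move=> t0; rewrite flatE// hornerC mul1r. Qed.

Lemma flat_tower : tower setT flat.
Proof.
move=> m t _; have [t0|t0|->] := ltgtP t 0.
- rewrite (flat_le0 _ (ltW t0)).
  apply: (near_eq_is_derive _ (@is_derive_cst R R R 0 t 1)).
  near=> s; rewrite flat_le0//; near: s; apply: filterS (lt_nbhsl t0) => s.
  exact: ltW.
- have dP := is_derive_poly (flat_poly m) t^-1.
  have dV : is_derive t 1 (fun s : R => s^-1) (- t ^- 2).
    have t_neq0 : id t != 0 by rewrite gt_eqF.
    have d := derivableV t_neq0 (@derivable_id R R t 1).
    split=> //; have := deriveV t_neq0 (@derivable_id R R t 1).
    by rewrite derive_id /= => ->; rewrite /GRing.scale/= mulr1.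
  have d1 : is_derive t 1 (fun s : R => (flat_poly m).[s^-1])
      ((flat_poly m)^`().[t^-1] * (- t ^- 2)).
    exact: (@is_derive1_comp R (horner (flat_poly m)) (fun s => s^-1) t _ _ dP dV).
  have d2 : is_derive t 1 (fun s : R => expR (- s^-1)) (expR (- t^-1) * (t ^- 2)).
    have dN : is_derive t 1 (fun s : R => - s^-1) (t ^- 2).
      by have := is_deriveN dV; rewrite opprK.
    exact: (@is_derive1_comp R expR (fun s => - s^-1) t _ _ (is_derive_expR _) dN).
  apply: (@near_eq_is_derive _ _ _
    ((fun s : R => (flat_poly m).[s^-1]) * (fun s : R => expR (- s^-1)))).
    near=> s; rewrite flatE//; near: s; exact: lt_nbhsr.
  apply: is_derive_eq; rewrite flatE//= !hornerM hornerX hornerD hornerN.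
  rewrite /GRing.scale/= -exprVn expr2; ring.
- rewrite flat_le0//.
  (* For h > 0 the difference quotient P_m (1 / h) exp (- 1 / h) / h is h times the value at 1 / h
     of u^2 P_m (u) exp (- u), which is bounded; so it tends to 0. *)
  have [K K0 KP] := poly_expR_bounded ('X * ('X * flat_poly m)) ltr01.
  suff cv : (fun h : R => h^-1 *: ((flat m \o shift 0) (h *: 1) - flat m 0))
      @ 0^' --> (0 : R).
    by split; [apply/cvg_ex; exists 0|exact: cvg_lim].
  apply/cvgrPdist_le => e e0; near=> h.
  rewrite sub0r normrN /= addr0 (flat_le0 m (lexx 0)) subr0 [h%:A]mulr1.
  have [h0|h0] := leP h 0; first by rewrite flat_le0// scaler0 normr0 ltW.
  have := KP h^-1; rewrite invr_ge0 (ltW h0) mul1r => /(_ isT).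
  rewrite !hornerM hornerX flatE// !normrM (ger0_norm (expR_ge0 _)) => KPh.
  have hK : `|h| * (K + 1) <= e.
    rewrite -ler_pdivlMr ?ltr_wpDl//; near: h.
    by apply: dnbhs0_le; rewrite divr_gt0// ltr_wpDl.
  apply: le_trans hK; rewrite -ler_pdivrMl ?normr_gt0 ?gt_eqF// -normfV.
  rewrite (le_trans _ (_ : K <= K + 1)) ?lerDl// (le_trans _ KPh)//.
  by rewrite !mulrA.
Unshelve. all: by end_near. Qed.

Lemma flat_ge0 t : 0 <= flat 0 t.
Proof.
by have [t0|t0] := leP t 0; [rewrite flat_le0|rewrite flat0E// expR_ge0].
Qed.

Lemma flat_le1 t : flat 0 t <= 1.
Proof.
have [t0|t0] := leP t 0; first by rewrite flat_le0.
by rewrite flat0E// -expR0 ler_expR oppr_le0 invr_ge0 ltW.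
Qed.

Lemma flat1_bounded : exists2 K, 0 <= K & forall t, `|flat 1 t| <= K.
Proof.
have [K K0 KP] := poly_expR_bounded (flat_poly 1) ltr01; exists K => // t.
have [t0|t0] := leP t 0; first by rewrite flat_le0// normr0.
rewrite flatE// normrM (ger0_norm (expR_ge0 _)).
by have := KP t^-1; rewrite mul1r invr_ge0 (ltW t0) => /(_ isT).
Qed.

(** One of the two arguments is always at least 1/2, where [flat 0] is at least exp (- 2). A
    positive lower bound that is uniform in [t] is what makes the derivative of the quotient [step]
    bounded. *)
Lemma flat_sum_ge t : expR (- 2) <= flat 0 (3 * t - 1) + flat 0 (2 - 3 * t).
Proof.
have ge2 u : 2^-1 <= u -> expR (- 2) <= flat 0 u.
  move=> u2; have u0 : 0 < u by rewrite (lt_le_trans _ u2)// invr_gt0.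
  by rewrite flat0E// ler_expR lerN2 -[2]invrK lef_pV2// posrE invr_gt0.
have [t2|t2] := leP (2^-1) t.
  by rewrite (le_trans (ge2 (3 * t - 1) _)) ?lerDl ?flat_ge0//; lra.
by rewrite (le_trans (ge2 (2 - 3 * t) _)) ?lerDr ?flat_ge0//; lra.
Qed.

(* The quotient is written as a power so that its smoothness follows from
   powR_tower. *)
Definition step t : R :=
  flat 0 (3 * t - 1) * (flat 0 (3 * t - 1) + flat 0 (2 - 3 * t)) `^ (-1).

Let den_gt0 t : 0 < flat 0 (3 * t - 1) + flat 0 (2 - 3 * t).
Proof. exact: lt_le_trans (expR_gt0 _) (flat_sum_ge t). Qed.

Lemma stepE t :
  step t = flat 0 (3 * t - 1) / (flat 0 (3 * t - 1) + flat 0 (2 - 3 * t)).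
Proof. by rewrite /step powR_inv1// ltW. Qed.

Lemma step_ge0 t : 0 <= step t.
Proof. by rewrite stepE divr_ge0 ?flat_ge0// ltW. Qed.

Lemma step_le1 t : step t <= 1.
Proof. by rewrite stepE ler_pdivrMr// mul1r lerDl flat_ge0. Qed.

(** The plateaus reach to 1/3 and from 2/3, so that [step] is constant in a whole neighbourhood of
    every t <= 0 and of every t >= 1; its derivative vanishes there, endpoints included. *)
Lemma step_eq0 t : t <= 3^-1 -> step t = 0.
Proof. by move=> t3; rewrite stepE flat_le0 ?mul0r//; lra. Qed.

Lemma step_eq1 t : 2 / 3 <= t -> step t = 1.
Proof.
move=> t3; rewrite stepE [flat 0 (2 - _)]flat_le0 ?addr0 ?divff//; last by lra.
have := den_gt0 t; rewrite [flat 0 (2 - _)]flat_le0 ?addr0; last by lra.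
by move/gt_eqF ->.
Qed.

Lemma powR_tower (al : R) :
  tower [set t | 0 < t] (fun m t => (\prod_(i < m) (al - i%:R)) * t `^ (al - m%:R)).
Proof.
move=> m t /= t0; have := is_derive1_powR (al - m%:R) t0 => d.
apply: is_derive_eq; rewrite big_ord_recr/= /GRing.scale/= mulrA; congr (_ * _ `^ _).
by rewrite -[m.+1]addn1 natrD opprD addrA.
Qed.

Lemma step_derive : exists2 K, 0 <= K &
  forall t, exists2 d, is_derive t 1 step d &
    [/\ `|d| <= K, t <= 0 -> d = 0 & 1 <= t -> d = 0].
Proof.
have [K K0 KP] := flat1_bounded.
have K'0 : 0 <= 9 * K * (expR (- 2)) ^- 2.
  by rewrite !mulr_ge0// invr_ge0 sqr_ge0.
exists (9 * K * (expR (- 2)) ^- 2) => // t.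
pose f := fun s : R => flat 0 (3 * s - 1).
pose h := fun s : R => flat 0 (2 - 3 * s).
have df : is_derive t 1 f (3 * flat 1 (3 * t - 1)).
  have d1 : is_derive t 1 (fun s : R => 3 * s - 1) 3.
    by apply: is_derive_eq; rewrite /GRing.scale/=; ring.
  have := @is_derive1_comp R (flat 0) (fun s : R => 3 * s - 1) t _ _
    (flat_tower 0 I) d1.
  by rewrite mulrC.
have dh : is_derive t 1 h (- 3 * flat 1 (2 - 3 * t)).
  have d1 : is_derive t 1 (fun s : R => 2 - 3 * s) (- 3).
    by apply: is_derive_eq; rewrite /GRing.scale/=; ring.
  have := @is_derive1_comp R (flat 0) (fun s : R => 2 - 3 * s) t _ _
    (flat_tower 0 I) d1.
  by rewrite mulrC.
have den0 : (f + h) t != 0 by rewrite gt_eqF//; exact: den_gt0.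
have dV : is_derive t 1 (fun s => ((f + h) s)^-1)
    (- ((f + h) t) ^- 2 * (3 * flat 1 (3 * t - 1) + - 3 * flat 1 (2 - 3 * t))).
  have d := is_deriveD df dh; split; first exact: derivableV den0 (is_derive_ex d).
  by have := deriveV den0 (is_derive_ex d); rewrite (is_derive_val d).
have dstep : is_derive t 1 step (f t * (- ((f + h) t) ^- 2 *
    (3 * flat 1 (3 * t - 1) + - 3 * flat 1 (2 - 3 * t))) +
    ((f + h) t)^-1 * (3 * flat 1 (3 * t - 1))).
  have -> : step = f * (fun s => ((f + h) s)^-1) by apply/funext => s; rewrite stepE.
  exact: is_deriveM.
exists (f t * (- ((f + h) t) ^- 2 *
    (3 * flat 1 (3 * t - 1) + - 3 * flat 1 (2 - 3 * t))) +
    ((f + h) t)^-1 * (3 * flat 1 (3 * t - 1))) => //.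
have near_cst (c : R) : (\near t, step t = c) -> 'D_1 step t = 0.
  by move=> sc; rewrite (near_eq_derive _ (g := cst c)) ?derive_cst.
split.
- have D0 : 0 < (f + h) t by exact: den_gt0.
  have -> : f t * (- ((f + h) t) ^- 2 *
    (3 * flat 1 (3 * t - 1) + - 3 * flat 1 (2 - 3 * t))) +
    ((f + h) t)^-1 * (3 * flat 1 (3 * t - 1)) =
    3 * (h t * flat 1 (3 * t - 1) + f t * flat 1 (2 - 3 * t)) * ((f + h) t) ^- 2.
    have : (f + h) t = f t + h t by [].
    by move: den0 => /[swap] -> ?; field.
  have f1 := flat_le1 (3 * t - 1); have f0 := flat_ge0 (3 * t - 1).
  have h1 := flat_le1 (2 - 3 * t); have h0 := flat_ge0 (2 - 3 * t).
  rewrite normrM; apply: ler_pM => //.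
    rewrite normrM (ger0_norm (_ : 0 <= 3))// (_ : 9 = 3 * 3) -?natrM//.
    rewrite natrM -mulrA ler_pM2l//.
    apply: (le_trans (ler_normD _ _)); rewrite !normrM.
    have A1 : `|h t| * `|flat 1 (3 * t - 1)| <= 1 * K.
      by apply: ler_pM => //; rewrite ger0_norm.
    have A2 : `|f t| * `|flat 1 (2 - 3 * t)| <= 1 * K.
      by apply: ler_pM => //; rewrite ger0_norm.
    by lra.
  rewrite ger0_norm ?invr_ge0 ?sqr_ge0// lef_pV2 ?posrE ?exprn_gt0 ?expR_gt0//.
  by rewrite lerXn2r ?nnegrE ?expR_ge0 ?(ltW D0)//; exact: flat_sum_ge.
- move=> t0; rewrite -(is_derive_val dstep); apply: (near_cst 0).
  near=> s; apply: step_eq0; near: s.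
  by apply: filterS (lt_nbhsl (_ : t < 3^-1)); [move=> s /ltW|lra].
- move=> t1; rewrite -(is_derive_val dstep); apply: (near_cst 1).
  near=> s; apply: step_eq1; near: s.
  by apply: filterS (lt_nbhsr (_ : 2 / 3 < t)); [move=> s /ltW|lra].
Unshelve. all: by end_near. Qed.

Lemma class_C_step {n} k (U : set 'rV[R]_n.+1) h : open U ->
  class_C (@continuous_on R n) k U h ->
  class_C (@continuous_on R n) k U (step \o h).
Proof.
move=> oU Ch.
have Caff a b : class_C (@continuous_on R n) k U (fun y => a * h y + b).
  by apply: class_C_D => //; [apply: class_C_M => //|]; exact: class_C_cst.
have C1 : class_C (@continuous_on R n) k U (fun y => flat 0 (3 * h y - 1)).
  exact: (tower_comp (h := fun y => 3 * h y - 1) flat_tower oU _ (Caff _ _) 0).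
have C2 : class_C (@continuous_on R n) k U (fun y => flat 0 (2 - 3 * h y)).
  have := tower_comp (h := fun y => - 3 * h y + 2) flat_tower oU _ (Caff _ _) 0.
  move=> /(_ (fun _ _ => I)); apply: class_C_eq => // y _ /=; congr flat.
  by rewrite addrC mulNr.
apply: class_C_M => //.
have := tower_comp (powR_tower (-1)) oU _ (class_C_D oU C1 C2) 0.
move=> /(_ (fun y _ => den_gt0 _)); apply: class_C_eq => // y _ /=.
by rewrite big_ord0 mul1r subr0.
Qed.

Lemma class_C_powR {n} k (U : set 'rV[R]_n.+1) h (al : R) : open U ->
  (forall y, U y -> 0 < h y) ->
  class_C (@continuous_on R n) k U h ->
  class_C (@continuous_on R n) k U (fun y => h y `^ al).
Proof.
move=> oU h0 Ch; have := tower_comp (powR_tower al) oU h0 Ch 0.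
by apply: class_C_eq => // y _ /=; rewrite big_ord0 mul1r subr0.
Qed.

End one_variable.

Opaque step.

(** * The cut-off of y_0^al to a box *)

(** The Leibniz rule for t^al times two cut-offs [u], [v], with P = t^al and Q = t^(al - 1). The
    hypotheses on [d1 * t] and [d2 * t] say that the cut-offs vary on a scale comparable with
    [t]. *)
Lemma derivative_bound {R : realType} (al t P Q u v d1 d2 K : R) :
  0 <= al -> 0 <= t -> 0 <= P -> 0 <= Q -> Q * t = P ->
  0 <= u <= 1 -> 0 <= v <= 1 -> `|d1| * t <= K -> `|d2| * t <= K ->
  `|P * (u * d2 + v * d1) + u * v * (al * Q)| * t <= (al + 2 * K) * P.
Proof.
move=> al0 t0 P0 Q0 QtP /andP[u0 u1] /andP[v0 v1] d1K d2K.
have le w d : 0 <= w -> w <= 1 -> `|d| * t <= K -> `|w * d| * t <= K.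
  move=> w0 w1 dK; rewrite normrM ger0_norm// -mulrA (le_trans _ dK)//.
  by rewrite ler_piMl// mulr_ge0.
apply: (le_trans (ler_wpM2r t0 (ler_normD _ _))).
rewrite mulrDl [leRHS]mulrDl [leRHS]addrC; apply: lerD.
  rewrite normrM (ger0_norm P0) -mulrA [leRHS]mulrC ler_wpM2l//.
  apply: (le_trans (ler_wpM2r t0 (ler_normD _ _))); rewrite mulrDl.
  have -> : 2 * K = K + K by ring.
  by apply: lerD; exact: le.
rewrite ger0_norm; last by rewrite !mulr_ge0.
by rewrite -!mulrA QtP mulrA ler_piMl ?mulr_ge0// mulr_ile1.
Qed.

Lemma convex_bound {R : realType} (u v d1 d2 K : R) :
  0 <= u <= 1 -> 0 <= v <= 1 -> `|d1| <= K -> `|d2| <= K ->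
  `|u * d2 + v * d1| <= 2 * K.
Proof.
move=> /andP[u0 u1] /andP[v0 v1] d1K d2K.
apply: (le_trans (ler_normD _ _)); rewrite !normrM (ger0_norm u0) (ger0_norm v0).
have -> : 2 * K = K + K by ring.
by apply: lerD; [apply: le_trans d2K|apply: le_trans d1K]; rewrite ler_piMl.
Qed.

Lemma scale_bound {R : realType} (x K dl : R) :
  0 < dl -> x <= 2 * (K * dl^-1) -> x * dl <= 2 * K.
Proof. by move=> dl0; rewrite mulrA ler_pdivlMr. Qed.

(** The lower cut-off has slope at most 2 K / a and varies only below [a]; in the next lemma the
    upper one has slope at most K / b and varies only below 2 b. Both give the scale-free bound 2
    K. *)
Lemma lower_cut_bound {R : realType} (x K a t : R) :
  0 < a -> 0 <= K -> 0 <= t -> t < a -> x <= K * `|2 / a| -> x * t <= 2 * K.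
Proof.
move=> a0 K0 t0 ta xK; apply: (le_trans (ler_wpM2r t0 xK)).
rewrite gtr0_norm ?divr_gt0// -mulrA [2 * K]mulrC ler_wpM2l//.
by rewrite mulrAC ler_pdivrMr// ler_wpM2l// ltW.
Qed.

Lemma upper_cut_bound {R : realType} (x K b t : R) :
  0 < b -> 0 <= K -> 0 <= t -> t < 2 * b -> x <= K * `|- b^-1| -> x * t <= 2 * K.
Proof.
move=> b0 K0 t0 tb xK; apply: (le_trans (ler_wpM2r t0 xK)).
rewrite normrN gtr0_norm ?invr_gt0// -mulrA [2 * K]mulrC ler_wpM2l//.
by rewrite mulrC ler_pdivrMr// ltW.
Qed.

Lemma ge1_ge23 {R : realType} (x : R) : 1 <= x -> 2 / 3 <= x.
Proof. lra. Qed.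

Lemma le0_le3 {R : realType} (x : R) : x <= 0 -> x <= 3^-1.
Proof. lra. Qed.

Section profile.
Context {R : realType} {n : nat}.
Local Notation E := 'rV[R]_n.+1.
Variables (al a b L dl : R) (c : E).
Hypotheses (al0 : 0 <= al) (a0 : 0 < a) (ab : a < b) (dl0 : 0 < dl).
Hypothesis b_dl : 2 * b <= dl.
Implicit Types (i j k : 'I_n.+1) (t : R) (y : E).

Let b0 : 0 < b. Proof. exact: lt_trans ab. Qed.

(** The arguments of [step] are affine and run from 0 to 1 as [t] goes from a/2 to a, from 2 b to b,
    and as |t - c_i| goes from L + dl to L. A product of functions of one variable each keeps the
    partial derivatives elementary. *)
Definition factor i t : R :=
  if i == 0 then
    t `^ al * (step (2 * (t / a) - 1) * step (2 - t / b))
  else step ((L + dl - (t - c 0 i)) / dl) * step ((L + dl + (t - c 0 i)) / dl).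

Definition profile y : R := \prod_i factor i (y 0 i).

Definition core_box : set E :=
  [set y | a <= y 0 0 <= b /\ forall i, i != 0 -> `|y 0 i - c 0 i| <= L].

(** Half-open in y_0 to agree with the slabs whose volume is computed later, which are half-open in
    order to tile. *)
Definition support_box : set E :=
  [set y | a / 2 <= y 0 0 < 2 * b /\
           forall i, i != 0 -> `|y 0 i - c 0 i| <= L + dl].

Let lo_ge1 t : a <= t -> 1 <= 2 * (t / a) - 1.
Proof.
move=> at_; have : 1 <= t / a by rewrite ler_pdivlMr// mul1r.
lra.
Qed.

Let lo_le0 t : t < a / 2 -> 2 * (t / a) - 1 <= 0.
Proof.
move=> at_; have : t / a <= 2^-1 by rewrite ler_pdivrMr// mulrC ltW.
lra.
Qed.

Let hi_ge1 t : t <= b -> 1 <= 2 - t / b.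
Proof.
move=> tb; have : t / b <= 1 by rewrite ler_pdivrMr// mul1r.
lra.
Qed.

Let hi_le0 t : 2 * b <= t -> 2 - t / b <= 0.
Proof. by move=> tb; rewrite subr_le0 ler_pdivlMr. Qed.

Lemma step_01 t : 0 <= @step R t <= 1.
Proof. by rewrite step_ge0 step_le1. Qed.

Let arg0l t : 2 / a * t + - 1 = 2 * (t / a) - 1.
Proof. by rewrite mulrAC mulrA. Qed.

Let arg0r t : - b^-1 * t + 2 = 2 - t / b.
Proof. by rewrite addrC mulNr mulrC. Qed.

Let argl i t : - dl^-1 * t + (L + dl + c 0 i) / dl = (L + dl - (t - c 0 i)) / dl.
Proof. by ring. Qed.

Let argr i t : dl^-1 * t + (L + dl - c 0 i) / dl = (L + dl + (t - c 0 i)) / dl.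
Proof. by ring. Qed.

Lemma step_mul_ge0 s t : 0 <= step s * step t :> R.
Proof. by rewrite mulr_ge0 ?step_ge0. Qed.

Lemma step_mul_le1 s t : step s * step t <= 1 :> R.
Proof. by rewrite mulr_ile1 ?step_ge0 ?step_le1. Qed.

Lemma factor_ge0 i t : 0 <= factor i t.
Proof.
rewrite /factor; case: ifP => _; last exact: step_mul_ge0.
by rewrite mulr_ge0 ?powR_ge0 ?step_mul_ge0.
Qed.

Lemma factor0_le t : factor 0 t <= t `^ al.
Proof. by rewrite /factor eqxx ler_piMr ?powR_ge0 ?step_mul_le1. Qed.

Lemma factor_le1 i t : i != 0 -> factor i t <= 1.
Proof. by rewrite /factor => /negbTE ->; exact: step_mul_le1. Qed.

Lemma profile_ge0 y : 0 <= profile y.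
Proof. by apply: prodr_ge0 => i _; exact: factor_ge0. Qed.

Lemma prod_factor_le1 (P : pred 'I_n.+1) y : (forall i, P i -> i != 0) ->
  0 <= \prod_(i | P i) factor i (y 0 i) <= 1.
Proof.
move=> P0; rewrite prodr_ge0/=; last by move=> i _; exact: factor_ge0.
by apply: prodr_ile1 => i /P0 i0; rewrite factor_ge0 factor_le1.
Qed.

Lemma profileE i y :
  profile y = factor i (y 0 i) * \prod_(k | k != i) factor k (y 0 k).
Proof. by rewrite /profile (bigD1 i). Qed.

Lemma factor0_core t : a <= t <= b -> factor 0 t = t `^ al.
Proof.
move=> /andP[/lo_ge1 t1 /hi_ge1 t2].
by rewrite /factor eqxx (step_eq1 (ge1_ge23 t1)) (step_eq1 (ge1_ge23 t2)) !mulr1.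
Qed.

Lemma factor_core i t : i != 0 -> `|t - c 0 i| <= L -> factor i t = 1.
Proof.
rewrite /factor => /negbTE ->; rewrite ler_norml => /andP[t1 t2].
have ge23 u : dl <= u -> 2 / 3 <= u / dl.
  by move=> u0; rewrite ler_pdivlMr//; have := dl0; lra.
by rewrite !step_eq1 ?mulr1// ge23//; lra.
Qed.

Lemma profile_core y : core_box y -> profile y = y 0 0 `^ al.
Proof.
move=> [y0 yj]; rewrite (profileE 0) factor0_core// big1 ?mulr1// => i i0.
by rewrite factor_core// yj.
Qed.

Lemma factor0_out t : ~~ (a / 2 <= t < 2 * b) -> factor 0 t = 0.
Proof.
rewrite negb_and -ltNge -leNgt /factor eqxx => /orP[/lo_le0 t1|/hi_le0 t1].
  by rewrite (step_eq0 (le0_le3 t1)) mul0r mulr0.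
by rewrite (step_eq0 (le0_le3 t1)) !mulr0.
Qed.

Lemma factor_out i t : i != 0 -> ~~ (`|t - c 0 i| <= L + dl) -> factor i t = 0.
Proof.
have le3 u : u <= 0 -> u / dl <= 3^-1.
  by move=> u0; rewrite (@le_trans _ _ 0)// ?pmulr_lle0 ?invr_gt0// invr_ge0.
rewrite /factor => /negbTE ->; rewrite ler_norml negb_and -!ltNge => /orP[] t1.
  by rewrite (@step_eq0 _ ((L + dl + (t - c 0 i)) / dl)) ?mulr0// le3//; lra.
by rewrite (@step_eq0 _ ((L + dl - (t - c 0 i)) / dl)) ?mul0r// le3//; lra.
Qed.

Lemma not_support_box y : ~ support_box y ->
  ~~ (a / 2 <= y 0 0 < 2 * b) \/
  exists2 i, i != 0 & ~~ (`|y 0 i - c 0 i| <= L + dl).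
Proof.
move=> ny; have [y0|] := boolP (a / 2 <= y 0 0 < 2 * b); last by left.
right; apply: contrapT => H; apply: ny; split=> // i i0.
by apply: contrapT => /negP yi; apply: H; exists i.
Qed.

Lemma profile_out y : ~ support_box y -> profile y = 0.
Proof.
case/not_support_box => [y0|[i i0 yi]].
  by rewrite (profileE 0) factor0_out// mul0r.
by rewrite (profileE i) factor_out// mul0r.
Qed.

Lemma profile_le y : profile y <= y 0 0 `^ al.
Proof.
have /andP[p0 p1] := prod_factor_le1 (P := fun k => k != 0) y (fun i => id).
rewrite (profileE 0) (le_trans (ler_wpM2l (factor_ge0 _ _) p1))// mulr1.
exact: factor0_le.
Qed.

Section derivative.
Variable K : R.
Hypothesis K0 : 0 <= K.
Hypothesis stepK : forall t, exists2 d, is_derive t 1 (@step R) d &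
  [/\ `|d| <= K, t <= 0 -> d = 0 & 1 <= t -> d = 0].

Lemma step_affine_derive (p q t : R) : exists2 d,
  is_derive t 1 (fun s => step (p * s + q)) d &
  [/\ `|d| <= K * `|p|, p * t + q <= 0 -> d = 0 & 1 <= p * t + q -> d = 0].
Proof.
have [d dd [d1 d2 d3]] := stepK (p * t + q).
exists (d * p) => [|].
  have daff : is_derive t 1 (fun s : R => p * s + q) p.
    by apply: is_derive_eq; rewrite /GRing.scale/=; ring.
  exact: (@is_derive1_comp R step (fun s : R => p * s + q) t _ _ dd daff).
split; first by rewrite normrM ler_wpM2r.
- by move=> /d2 ->; rewrite mul0r.
- by move=> /d3 ->; rewrite mul0r.
Qed.

Lemma powR_pred t : 0 < t -> t `^ al = t `^ (al - 1) * t.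
Proof.
move=> t0; rewrite -[X in _ * X]powRr1 ?ltW// -powRD ?subrK//.
by apply/implyP => _; rewrite gt_eqF.
Qed.

(** Each cut-off varies only where its slope is O(1 / t), so after multiplication by [t] the bound
    involves neither [a] nor [b]; the two cut-offs contribute 2 K each. *)
Lemma factor0_derive t : 0 < t -> exists2 d, is_derive t 1 (factor 0) d &
  [/\ `|d| * t <= (al + 4 * K) * t `^ al,
      ~~ (a / 2 <= t < 2 * b) -> d = 0 &
      a <= t <= b -> d = al * t `^ (al - 1)].
Proof.
move=> t0.
have [d1 D1 [A1 B1 C1]] := step_affine_derive (2 / a) (- 1) t.
have [d2 D2 [A2 B2 C2]] := step_affine_derive (- b^-1) 2 t.
have D0 := is_derive1_powR al t0.
rewrite arg0l in B1 C1; rewrite arg0r in B2 C2.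
pose f0 := fun s : R => s `^ al.
pose f1 := fun s : R => step ((2 / a) * s + - 1).
pose f2 := fun s : R => step (- b^-1 * s + 2).
have fE : factor 0 = f0 * (f1 * f2).
  apply/funext => s; by rewrite /factor eqxx -arg0l -arg0r.
have D := is_deriveM (f := f0) (g := f1 * f2) D0 (is_deriveM D1 D2).
rewrite fE; eexists; first exact: D.
have e1 : f1 t = step (2 * (t / a) - 1) := congr1 step (arg0l t).
have e2 : f2 t = step (2 - t / b) := congr1 step (arg0r t).
have -> : f0 t *: (f1 t *: d2 + f2 t *: d1) + (f1 * f2) t *: (al * t `^ (al - 1)) =
   t `^ al * (step (2 * (t / a) - 1) * d2 + step (2 - t / b) * d1) +
   step (2 * (t / a) - 1) * step (2 - t / b) * (al * t `^ (al - 1)).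
  by rewrite -e1 -e2.
split.
- have -> : al + 4 * K = al + 2 * (2 * K) by ring.
  apply: (derivative_bound al0 (ltW t0) (powR_ge0 _ _) (powR_ge0 _ _)
    (esym (powR_pred t0)) (step_01 _) (step_01 _)).
    have [/lo_ge1 ta|ta] := leP a t.
      by rewrite (C1 ta) normr0 mul0r; exact: mulr_ge0.
    exact: lower_cut_bound a0 K0 (ltW t0) ta A1.
  have [/hi_le0 tb|tb] := leP (2 * b) t.
    by rewrite (B2 tb) normr0 mul0r; exact: mulr_ge0.
  exact: upper_cut_bound b0 K0 (ltW t0) tb A2.
- rewrite negb_and -ltNge -leNgt => /orP[/lo_le0 st0|/hi_le0 st0].
    by rewrite (step_eq0 (le0_le3 st0)) (B1 st0) !(mul0r, mulr0, addr0).
  by rewrite (step_eq0 (le0_le3 st0)) (B2 st0) !(mul0r, mulr0, addr0).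
- move=> /andP[/lo_ge1 st1 /hi_ge1 st2].
  by rewrite (C1 st1) (C2 st2) (step_eq1 (ge1_ge23 st1)) (step_eq1 (ge1_ge23 st2))
    !(mulr0, addr0, add0r, mul1r).
Qed.

Lemma factor_derive i t : i != 0 -> exists2 d, is_derive t 1 (factor i) d &
  [/\ `|d| * dl <= 2 * K,
      ~~ (`|t - c 0 i| <= L + dl) -> d = 0 &
      `|t - c 0 i| <= L -> d = 0].
Proof.
move=> i0.
have [d1 D1 [A1 B1 C1]] := step_affine_derive (- dl^-1) ((L + dl + c 0 i) / dl) t.
have [d2 D2 [A2 B2 C2]] := step_affine_derive (dl^-1) ((L + dl - c 0 i) / dl) t.
rewrite argl in B1 C1; rewrite argr in B2 C2.
pose f1 := fun s : R => step (- dl^-1 * s + (L + dl + c 0 i) / dl).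
pose f2 := fun s : R => step (dl^-1 * s + (L + dl - c 0 i) / dl).
have fE : factor i = f1 * f2.
  by apply/funext => s; rewrite /factor (negbTE i0) -argl -argr.
have D := is_deriveM (f := f1) (g := f2) D1 D2.
rewrite fE; eexists; first exact: D.
have -> : f1 t *: d2 + f2 t *: d1 = step ((L + dl - (t - c 0 i)) / dl) * d2 +
   step ((L + dl + (t - c 0 i)) / dl) * d1.
  by rewrite -argl -argr.
have neg_div u : u <= 0 -> u / dl <= 0.
  by move=> u0; rewrite pmulr_lle0 ?invr_gt0.
have neg_div3 u : u <= 0 -> u / dl <= 3^-1.
  by move=> /neg_div u0; rewrite (le_trans u0)// invr_ge0.
split.
- have dlV : `|dl^-1| = dl^-1 by rewrite gtr0_norm ?invr_gt0.
  rewrite normrN dlV in A1; rewrite dlV in A2.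
  apply: (scale_bound dl0).
  exact: (convex_bound (step_01 _) (step_01 _) A1 A2).
- rewrite ler_norml negb_and -!ltNge => /orP[] t1.
    have v0 : L + dl + (t - c 0 i) <= 0 by lra.
    by rewrite (B2 (neg_div _ v0)) (step_eq0 (neg_div3 _ v0)) mulr0 mul0r addr0.
  have u0 : L + dl - (t - c 0 i) <= 0 by lra.
  by rewrite (B1 (neg_div _ u0)) (step_eq0 (neg_div3 _ u0)) mulr0 mul0r addr0.
- rewrite ler_norml => /andP[t1 t2].
  have ge1 u : dl <= u -> 1 <= u / dl by move=> ?; rewrite ler_pdivlMr// mul1r.
  have u1 : dl <= L + dl - (t - c 0 i) by lra.
  have v1 : dl <= L + dl + (t - c 0 i) by lra.
  rewrite (C1 (ge1 _ u1)) (C2 (ge1 _ v1)).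
  by rewrite (mulr0 (step _)) (mulr0 (step _)) addr0.
Qed.

Lemma profile_derive i y d : is_derive (y 0 i) 1 (factor i) d ->
  is_derive y (basis_vec i) profile (d * \prod_(k | k != i) factor k (y 0 k)).
Proof.
move=> D; set Q := \prod_(k | k != i) factor k (y 0 k).
have DQ : is_derive (y 0 i) 1 (fun s => factor i s * Q) (d * Q).
  have := is_deriveM D (is_derive_cst Q (y 0 i) 1).
  by rewrite scaler0 add0r [X in is_derive _ _ _ X]mulrC.
have coordE h k : (h *: (basis_vec i : E) + y) 0 k = h * (k == i)%:R + y 0 k.
  by rewrite !mxE eqxx.
have lineE h : profile (h *: basis_vec i + y) = factor i (h + y 0 i) * Q.
  have fi : factor i ((h *: (basis_vec i : E) + y) 0 i) = factor i (h + y 0 i).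
    by apply: congr1; rewrite coordE eqxx mulr1.
  rewrite (profileE i) fi; apply: congr1; apply: eq_bigr => k ki.
  by apply: congr1; rewrite coordE (negbTE ki) mulr0 add0r.
have eqg : (fun h : R => h^-1 *: ((profile \o shift y) (h *: basis_vec i) - profile y)) =
  (fun h : R => h^-1 *: (((fun s => factor i s * Q) \o shift (y 0 i)) (h *: 1)
     - factor i (y 0 i) * Q)).
  apply/funext => h /=; rewrite lineE [h%:A]mulr1.
  by have := lineE 0; rewrite scale0r !add0r => ->.
by split; rewrite /derivable /derive eqg; [exact: is_derive_ex DQ|exact: is_derive_val DQ].
Qed.

(** For i = 0 this is [factor0_derive]. For the other directions the slope is at most 2 K / dl, and
    y_0 < 2 b <= dl wherever the profile does not vanish, so y_0 times the slope is bounded by a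
    constant that does not see the box. *)
Lemma profile_derive_bound i y : 0 < y 0 0 ->
  `|'D_(basis_vec i) profile y| * y 0 0 <= (al + 4 * K) * y 0 0 `^ al.
Proof.
move=> y0; have [->|i0] := eqVneq i 0.
  have [d D [d1 _ _]] := factor0_derive y0.
  rewrite (is_derive_val (profile_derive D)).
  have /andP[q0 q1] := prod_factor_le1 (P := fun k => k != 0) y (fun i => id).
  rewrite (le_trans _ d1)// ler_wpM2r ?(ltW y0)// normrM (ger0_norm q0).
  by rewrite ler_piMr.
have [d D [d1 d2 _]] := factor_derive (y 0 i) i0.
rewrite (is_derive_val (profile_derive D)).
rewrite (bigD1 0)/=; last by rewrite eq_sym.
have /andP[q0 q1] := prod_factor_le1 (P := fun k => (k != i) && (k != 0)) y
  (fun k H => proj2 (andP H)).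
have [yb|yb] := ltP (y 0 0) (2 * b); last first.
  rewrite factor0_out ?mul0r ?mulr0 ?normr0 ?mul0r.
    by rewrite mulr_ge0 ?powR_ge0// addr_ge0// mulr_ge0.
  by rewrite negb_and -leNgt yb orbT.
have dy : `|d| * y 0 0 <= al + 4 * K.
  apply: (le_trans (ler_wpM2l (normr_ge0 d) (le_trans (ltW yb) b_dl))).
  rewrite (le_trans d1)// (@le_trans _ _ (4 * K)) ?lerDr//.
  by apply: ler_wpM2r => //; rewrite ler_nat.
rewrite normrM normrM (ger0_norm q0) (ger0_norm (factor_ge0 _ _)).
rewrite mulrAC; apply: ler_pM dy _.
- exact: mulr_ge0 (normr_ge0 d) (ltW y0).
- exact: mulr_ge0 (factor_ge0 _ _) q0.
- by apply: (le_trans (ler_piMr (factor_ge0 _ _) q1)); exact: factor0_le.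
Qed.

(** The complement of the box is not open, so vanishing of the profile is not differentiated; the
    factors are. A vanishing factor other than the i-th survives in the product, and the i-th one
    vanishes together with its derivative. *)
Lemma profile_derive_out i y : 0 < y 0 0 -> ~ support_box y ->
  'D_(basis_vec i) profile y = 0.
Proof.
move=> y0 /not_support_box out.
have vanish j : i != j -> factor j (y 0 j) = 0 ->
    \prod_(k | k != i) factor k (y 0 k) = 0.
  by move=> ij fj; rewrite (bigD1 j) 1?eq_sym//= fj mul0r.
case: out => [y1|[j j0 yj]]; have [ij|ij] := eqVneq i 0.
- have [d D [_ d2 _]] := factor0_derive y0.
  by rewrite ij (is_derive_val (profile_derive D)) d2// mul0r.
- have [d D _] := factor_derive (y 0 i) ij.
  by rewrite (is_derive_val (profile_derive D)) (vanish 0) ?mulr0// factor0_out.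
- have [d D _] := factor0_derive y0.
  rewrite ij in vanish *.
  rewrite (is_derive_val (profile_derive D)) (vanish j) ?mulr0 1?eq_sym//.
  by rewrite factor_out.
- have [d D [_ d2 _]] := factor_derive (y 0 i) ij.
  rewrite (is_derive_val (profile_derive D)).
  have [e|e] := eqVneq i j; last by rewrite (vanish j) ?mulr0// factor_out.
  by rewrite d2 ?mul0r// e.
Qed.

Lemma profile_derive_core i y : 0 < y 0 0 -> core_box y ->
  'D_(basis_vec i) profile y = if i == 0 then al * y 0 0 `^ (al - 1) else 0.
Proof.
move=> y0 [y1 yj]; have [->|i0] := eqVneq i 0.
  have [d D [_ _ d3]] := factor0_derive y0.
  rewrite (is_derive_val (profile_derive D)) d3// big1 ?mulr1// => k k0.
  by rewrite factor_core// yj.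
have [d D [_ _ d3]] := factor_derive (y 0 i) i0.
by rewrite (is_derive_val (profile_derive D)) d3 ?mul0r// yj.
Qed.

End derivative.

Lemma profile_class_C (k : nat) : class_C (@continuous_on R n) k [set y | 0 < y 0 0] profile.
Proof.
have oH : open [set y : E | 0 < y 0 0].
  apply: (@open_comp _ _ (fun y : E => y 0 0) [set t | 0 < t]).
    by move=> y _; exact: coord_continuous.
  exact: open_gt.
apply: class_C_prod => // i.
have Caff (p q : R) : class_C (@continuous_on R n) k [set y | 0 < y 0 0]
    (fun y => p * y 0 i + q).
  apply: class_C_D => //; last exact: class_C_cst.
  by apply: class_C_M => //; [exact: class_C_cst|exact: class_C_coord].
have Cs (p q : R) := class_C_step oH (Caff p q).
have [i0|i0] := eqVneq i 0.
  have := class_C_M oH (class_C_powR al oH (fun y => id) (class_C_coord k _ 0))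
    (class_C_M oH (Cs (2 / a) (- 1)) (Cs (- b^-1) 2)).
  apply: class_C_eq => // y _; rewrite /factor i0 eqxx/=.
  by rewrite -arg0l -arg0r.
have := class_C_M oH (Cs (- dl^-1) ((L + dl + c 0 i) / dl))
  (Cs dl^-1 ((L + dl - c 0 i) / dl)).
apply: class_C_eq => // y _; rewrite /factor (negbTE i0)/=.
by rewrite -argl -argr.
Qed.

End profile.

(** * Iterated integrals of boxes *)

Section lebesgue_int.
Context {R : realType}.
Local Open Scope ereal_scope.

(** The integral of a nonnegative function is a supremum over the simple functions below it, hence
    monotone for arbitrary nonnegative functions. Iterated integrals can thus be compared without
    looking at their inner integrals. *)
Lemma ge0_le_integralT d (X : measurableType d) (mu : {measure set X -> \bar R})
    (f g : X -> \bar R) :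
  (forall x, 0 <= f x) -> (forall x, f x <= g x) ->
  \int[mu]_x f x <= \int[mu]_x g x.
Proof.
move=> f0 fg; rewrite !ge0_integralTE//; last by move=> x; exact: le_trans (fg x).
apply: le_ereal_sup => _ [h /= hf <-]; exists h => // x.
exact: le_trans (fg x).
Qed.

Lemma lebesgue_int_ge0 m (f : 'rV[R]_m -> \bar R) :
  (forall y, 0 <= f y) -> 0 <= lebesgue_int f.
Proof.
elim: m f => [|m IH] f f0 //=; apply: integral_ge0 => t _.
by apply: IH => v; exact: f0.
Qed.

Lemma le_lebesgue_int m (f g : 'rV[R]_m -> \bar R) :
  (forall y, 0 <= f y) -> (forall y, f y <= g y) ->
  lebesgue_int f <= lebesgue_int g.
Proof.
elim: m f g => [|m IH] f g f0 fg //=; apply: ge0_le_integralT => t.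
  by apply: lebesgue_int_ge0 => v; exact: f0.
by apply: IH => v; [exact: f0|exact: fg].
Qed.

Lemma eq_lebesgue_int m (f g : 'rV[R]_m -> \bar R) :
  (forall y, f y = g y) -> lebesgue_int f = lebesgue_int g.
Proof. by move=> /funext ->. Qed.

Definition box m (J : 'I_m -> set R) : set 'rV[R]_m :=
  [set y | forall i, J i (y 0%R i)].

Lemma box_row_mx m (J : 'I_m.+1 -> set R) t (v : 'rV[R]_m) :
  box J (row_mx (t%:M : 'rV_1) v) <-> J ord0 t /\ box (fun i => J (lift ord0 i)) v.
Proof.
have e0 : row_mx (t%:M : 'rV_1) v 0%R ord0 = t.
  have -> : ord0 = lshift m (ord0 : 'I_1) by exact: val_inj.
  by rewrite row_mxEl !mxE.
have eS i : row_mx (t%:M : 'rV_1) v 0%R (lift ord0 i) = v 0%R i.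
  have -> : lift ord0 i = rshift 1 i by exact: val_inj.
  by rewrite row_mxEr.
split=> [H|[H0 HS] i].
  by split=> [|i]; [have := H ord0; rewrite e0|have := H (lift ord0 i); rewrite eS].
by case: (unliftP ord0 i) => [j ->|->]; rewrite ?e0 ?eS//; exact: HS.
Qed.

(** The factor [D] is general in the induction: the indicator of the first side is a constant for
    the inner integral and is absorbed into it. *)
Lemma lebesgue_int_box m (J : 'I_m -> set R) (l : 'I_m -> R) (D : R) :
  (0 <= D)%R -> (forall i, measurable (J i : set (measurableTypeR R))) ->
  (forall i, lebesgue_measure (J i) = (l i)%:E) ->
  lebesgue_int (fun y : 'rV[R]_m => (\1_(box J) y * D)%:E) =
    (D * \prod_i l i)%:E.
Proof.
elim: m J l D => [|m IH] J l D D0 mJ lJ /=.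
  by rewrite big_ord0 mulr1 indicE mem_set ?mul1r// => -[].
have inner t : lebesgue_int (fun v : 'rV[R]_m =>
    (\1_(box J) (row_mx (t%:M : 'rV_1) v) * D)%:E) =
    ((D * \prod_i l (lift ord0 i)) * \1_(J ord0) t)%:E.
  rewrite (_ : (_ * _)%R = ((\1_(J ord0) t * D) * \prod_i l (lift ord0 i))%R); last first.
    by rewrite mulrC mulrA.
  rewrite -(IH (fun i => J (lift ord0 i)))//; last by rewrite mulr_ge0.
  apply: eq_lebesgue_int => v; congr (_%:E); rewrite !indicE mulrA; congr (_ * _)%R.
  have bE := box_row_mx J t v.
  have [Jt|Jt] := boolP (t \in J ord0); rewrite (mulr1, mulr0).
    congr (_%:R); congr nat_of_bool; apply/idP/idP; rewrite !inE.
      by move=> /bE[].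
    by move=> H; apply/bE; split=> //; rewrite inE in Jt.
  rewrite memNset// => /bE[H _].
  by move: Jt; rewrite mem_set.
under eq_integral do rewrite inner.
rewrite big_ord_recl mulrA mulrAC.
under eq_integral do rewrite EFinM.
have l0 i : (0 <= l i)%R by rewrite -lee_fin -lJ measure_ge0.
rewrite ge0_integralZl_EFin//; last 2 first.
- apply/measurable_EFinP.
  exact: (@measurable_indic _ _ R setT (J ord0) (mJ ord0)).
- by rewrite mulr_ge0// prodr_ge0.
by rewrite integral_indic// setIT [X in _ * X](lJ ord0).
Qed.

End lebesgue_int.

(** * Charts *)

Section rpartial.
Context {R : realType} {n : nat}.
Local Notation E := 'rV[R]_n.+1.

Lemma half_space_basis (y : E) (h : R) (i : 'I_n.+1) : half_space y -> 0 <= h ->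
  half_space (y + h *: basis_vec i).
Proof.
by rewrite /half_space/= !mxE => y0 h0; rewrite addr_ge0// mulr_ge0.
Qed.

Lemma cvg_line (y v : E) : (y + h *: v) @[h --> (0 : R)] --> y.
Proof.
rewrite -[X in _ --> X](addr0 y) -(scale0r v).
by apply: cvgD; [exact: cvg_cst|apply: cvgZr_tmp; exact: cvg_id].
Qed.

(** From a point of the half-space, a step h > 0 along any basis vector stays in the half-space,
    where [f] and its extension [F] agree near [y]. All one-sided partial derivatives are computed
    in this way. *)
Lemma rpartialE (f F : E -> R) (i : 'I_n.+1) (y : E) : half_space y ->
  (\forall z \near y, half_space z -> F z = f z) ->
  derivable F y (basis_vec i) -> rpartial i f y = 'D_(basis_vec i) F y.
Proof.
move=> hy Ff dF; apply: cvg_lim => //.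
have D : (fun h : R => h^-1 *: (F (h *: basis_vec i + y) - F y)) @ 0^' -->
    'D_(basis_vec i) F y by exact: dF.
have Dr : (fun h : R => h^-1 *: (F (h *: basis_vec i + y) - F y)) @ 0^'+ -->
    'D_(basis_vec i) F y.
  move=> S /D /nbhs_ballP[e e0 eS]; exists e => //= h eh /gt_eqF/negbT/eS; exact.
have nF : \forall h \near (0 : R)^'+, half_space (y + h *: basis_vec i) ->
    F (y + h *: basis_vec i) = f (y + h *: basis_vec i).
  have H := @cvg_line y (basis_vec i) _ Ff.
  by move: H => /nbhs_ballP[e e0 eS]; exists e => //= h eh _; exact: eS.
apply: cvg_trans Dr; apply: near_eq_cvg; near=> h.
rewrite -(nbhs_singleton Ff hy) -[RHS]/(_ * _) (addrC _ y); congr (_ * (_ - _)).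
have h0 : 0 < h by near: h; exact: nbhs_right_gt.
have : half_space (y + h *: basis_vec i) by apply: half_space_basis => //; exact: ltW.
by near: h.
Unshelve. all: by end_near. Qed.

End rpartial.

(** * Change of chart: smoothness and differentials *)

Section charts.
Context {R : realType} {n : nat} {T : ptopologicalType}.
Variable A : atlas R n T.
Hypothesis hA : compact_manifold_with_boundary A.
Local Notation E := 'rV[R]_n.+1.
Implicit Types (c : idx A) (x : T) (U : set T).

Lemma chartP c : is_chart c. Proof. by case: hA => _ _ _ _ []. Qed.

Lemma transitionP c c' : smooth_transition c c'.
Proof. by case: hA => _ _ _ _ []. Qed.

Lemma dom_chart_at x : dom (chart_at A x) x. Proof. by case: hA. Qed.

Lemma dom_open c : open (dom c). Proof. by case: (chartP c). Qed.

Lemma psiK c x : dom c x -> psi c (phi c x) = x.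
Proof. by case: (chartP c) => _ _ _ _; exact. Qed.

Lemma phi_continuous c x : dom c x -> {for x, continuous (phi c)}.
Proof.
move=> cx; case: (chartP c) => _ _ /subspace_continuousP/(_ _ cx) + _ _.
by rewrite within_interior//; exact: open_nbhs_nbhs (conj (dom_open c) cx).
Qed.

Lemma chart_imageP c S y : chart_image c S y ->
  [/\ dom c (psi c y), S (psi c y), phi c (psi c y) = y & half_space y].
Proof.
move=> [x [cx Sx] <-]; rewrite psiK//; split=> //.
have [_ [W _ WE] _ _ _] := chartP c.
have : chart_image c setT (phi c x) by exists x.
by rewrite WE => -[].
Qed.

Lemma phi_half c x : dom c x -> half_space (phi c x).
Proof. by move=> cx; have [] := @chart_imageP c setT (phi c x); [exists x|]. Qed.

Lemma chart_image_near c U y : open U -> chart_image c U y ->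
  \forall z \near y, half_space z -> chart_image c U z.
Proof.
move=> oU Uy; have [_ [W oW WE] _ cpsi _] := chartP c.
have [d1 d2 d3 d4] := chart_imageP Uy.
have Ty : chart_image c setT y by exists (psi c y).
have Wy : W y by move: Ty; rewrite WE => -[].
have := (subspace_continuousP _ _).1 cpsi _ Ty.
have oDU : nbhs (psi c y) (dom c `&` U).
  by apply: open_nbhs_nbhs; split=> //; exact: openI (dom_open c) oU.
move=> /(_ _ oDU) /= H.
near=> z => hz; have Wz : W z by near: z; exact: open_nbhs_nbhs.
have Tz : chart_image c setT z by rewrite WE.
have DUz : (dom c `&` U) (psi c z) by move: Tz; near: z.
by exists (psi c z) => //; have [] := chart_imageP Tz.
Unshelve. all: by end_near. Qed.

(** Smoothness of a transition extends each component on a neighbourhood of its own. Intersecting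
    these finitely many neighbourhoods gives one smooth map on an open subset of R^(n+1), to which
    ordinary calculus applies even at the boundary. *)
Lemma transition_ext c c' x : dom c x -> dom c' x ->
  exists W (F : 'I_n.+1 -> E -> R),
    [/\ open W, W (phi c x), forall j, Cinfty W (F j) &
        forall z, W z -> half_space z -> chart_image c (dom c') z /\
          \row_j F j z = phi c' (psi c z)].
Proof.
move=> cx c'x; have Vy : chart_image c (dom c') (phi c x) by exists x.
have H j : exists WF : set E * (E -> R), [/\ open WF.1, WF.1 (phi c x),
    Cinfty WF.1 WF.2 & forall z, WF.1 z -> chart_image c (dom c') z ->
      WF.2 z = phi c' (psi c z) 0 j].
  by have [W [F [w1 w2 w3 w4]]] := @transitionP c c' j _ Vy; exists (W, F).
have [WF WFP] := choice H.
pose S := [set z | (forall j, (WF j).1 z) /\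
                   (half_space z -> chart_image c (dom c') z)].
exists S°, (fun j => (WF j).2); split.
- exact: open_interior.
- apply: filterI; last exact: chart_image_near (dom_open c') Vy.
  have nW j : nbhs (phi c x) (WF j).1.
    by have [w1 w2 _ _] := WFP j; exact: open_nbhs_nbhs.
  exact: filter_forall nW.
- move=> j k; have [_ _ w3 _] := WFP j; apply: class_C_sub (w3 k).
  by move=> z /interior_subset[].
- move=> z /interior_subset[Wz hV] hz; split; first exact: hV.
  apply/rowP => j; rewrite mxE; have [_ _ _ ->] := WFP j => //; exact: hV.
Qed.

Lemma jacobianE c c' x W (F : 'I_n.+1 -> E -> R) : dom c x ->
  open W -> W (phi c x) -> (forall j, Cinfty W (F j)) ->
  (forall z, W z -> half_space z -> chart_image c (dom c') z /\
          \row_j F j z = phi c' (psi c z)) ->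
  Defs.jacobian c c' x = \matrix_(i, j) 'D_(basis_vec i) (F j) (phi c x).
Proof.
move=> cx oW Wx CF FE; apply/matrixP => i j; rewrite !mxE.
apply: rpartialE; first exact: phi_half.
  apply: filterS (open_nbhs_nbhs (conj oW Wx)) => z Wz hz.
  by have [_ <-] := FE _ Wz hz; rewrite mxE.
exact: (((CF j 1%N).2 i).1 _ Wx).
Qed.

(** Smoothness is demanded in every chart but needs checking only in a chart containing [U]: in any
    other one, [f] is [G] composed with an extended transition. *)
Lemma smooth_transfer O (G : E -> R) c U (f : T -> R) :
  open U -> U `<=` dom c -> open O -> (forall x, U x -> O (phi c x)) ->
  Cinfty O G -> (forall x, U x -> f x = G (phi c x)) -> smooth_on A U f.
Proof.
move=> oU Uc oO UO CG fG c' y Uy.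
have [d1 Ux pK hy] := chart_imageP Uy.
have cx := Uc _ Ux.
have [W [F [oW Wy CF FE]]] := transition_ext d1 cx.
rewrite pK in Wy.
have cF j : {for y, continuous (F j)} by exact: (class_C_continuous (CF j 0%N)).
have Fy : \row_j F j y = phi c (psi c' y) by have [] := FE _ Wy hy.
pose S := [set z | W z /\ O (\row_j F j z)].
exists S°, (fun z => G (\row_j F j z)); split.
- exact: open_interior.
- apply: filterI; first exact: open_nbhs_nbhs.
  apply: (row_continuous cF); rewrite Fy.
  by apply: open_nbhs_nbhs; split=> //; exact: UO.
- move=> k; apply: class_C_comp oO (open_interior S) _ (CG k) _.
    by move=> z /interior_subset[].
  by move=> j; apply: class_C_sub (CF j k) => z /interior_subset[].
- move=> z /interior_subset[Wz Oz] Uz.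
  have [e1 e2 e3 e4] := chart_imageP Uz.
  by have [_ ->] := FE _ Wz e4; rewrite /= fG.
Qed.

(** One-sided partial derivatives satisfy the chain rule because [f] and the transition both have
    two-sided smooth extensions, whose composite extends [f] in the chart [c]. *)
Lemma differential_chain (f : T -> R) U c c' x : open U -> U x ->
  smooth_on A U f -> dom c x -> dom c' x ->
  differential f c x = differential f c' x *m (Defs.jacobian c c' x)^T.
Proof.
move=> oU Ux fU cx c'x.
have [W [F [oW Wx CF FE]]] := transition_ext cx c'x.
have Fx : \row_j F j (phi c x) = phi c' x.
  by have [_ ->] := FE _ Wx (phi_half cx); rewrite psiK.
have Uy' : chart_image c' U (phi c' x) by exists x.
have [W' [G [oW' W'x CG GE]]] := fU c' _ Uy'.
have Uy : chart_image c U (phi c x) by exists x.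
have dG : differentiable G (\row_j F j (phi c x)).
  by rewrite Fx; exact: class_C_differentiable oW' (CG 1%N) W'x.
have dF j : differentiable (F j) (phi c x).
  exact: class_C_differentiable oW (CF j 1%N) Wx.
have cF j : {for phi c x, continuous (F j)} by exact: differentiable_continuous.
have e1 i : differential f c x 0 i = 'D_(basis_vec i) (fun z => G (\row_j F j z)) (phi c x).
  rewrite mxE; apply: rpartialE; first exact: phi_half.
    have nW' : \forall z \near phi c x, W' (\row_j F j z).
      by apply: (row_continuous cF); rewrite Fx; exact: open_nbhs_nbhs.
    have nU := chart_image_near oU Uy.
    have nW : \forall z \near phi c x, W z by exact: open_nbhs_nbhs.
    near=> z => hz.
    have Wz : W z by near: z.
    have [[x1 [cx1 c'x1] x1z] Fz] := FE _ Wz hz.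
    have [_ Uz _ _] : [/\ dom c (psi c z), U (psi c z), phi c (psi c z) = z & half_space z].
      by apply: chart_imageP; move: hz; near: z.
    have zx1 : psi c z = x1 by rewrite -x1z psiK.
    have W'z : W' (\row_j F j z) by near: z.
    rewrite Fz zx1 in W'z *; rewrite GE//=; first by rewrite psiK// zx1.
    by exists x1 => //; split=> //; rewrite -zx1.
  exact: diff_derivable (derive_comp_row 0 dG dF).1.
have e2 j : differential f c' x 0 j = 'D_(basis_vec j) G (phi c' x).
  rewrite mxE; apply: rpartialE; first exact: phi_half.
    have nU := chart_image_near oU Uy'.
    near=> z => hz; apply: GE; last by move: hz; near: z.
    by near: z; exact: open_nbhs_nbhs.
  exact: (((CG 1%N).2 j).1 _ W'x).
apply/rowP => i; rewrite e1 (derive_comp_row _ dG dF).2 Fx.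
rewrite (class_C_deriveE _ oW' (CG 1%N) W'x) mxE; apply: eq_bigr => j _.
by rewrite (jacobianE cx oW Wx CF FE) !mxE mulrC -e2 mxE.
Unshelve. all: by end_near. Qed.

End charts.

(** * Metrics in charts *)

Section matrices.
Context {R : realType}.

Lemma cvg_det (X : Type) (F : set_system X) (FF : Filter F) m
    (M : X -> 'M[R]_m) (G : 'M[R]_m) :
  (forall i j, (fun x => M x i j) @ F --> G i j) ->
  (fun x => \det (M x)) @ F --> \det G.
Proof.
move=> MG; rewrite /determinant.
apply: (@cvg_big _ _ _ _ _ (@add_continuous R) X F _
  (fun (s : {perm 'I_m}) x => (-1) ^+ s * \prod_i M x i (s i))
  (fun s : {perm 'I_m} => (-1) ^+ s * \prod_i G i (s i))) => s _.
apply: cvgM; first exact: cvg_cst.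
exact: (@cvg_big _ _ _ _ _ (@mul_continuous R) X F _
  (fun i x => M x i (s i)) (fun i => G i (s i))).
Qed.

(** Continuity is read off from the cofactor formula, which [invmx] follows only on invertible
    matrices; hence the eventual invertibility of [M x]. *)
Lemma cvg_invmx (X : Type) (F : set_system X) (FF : Filter F) m
    (M : X -> 'M[R]_m) (G : 'M[R]_m) :
  (forall i j, (fun x => M x i j) @ F --> G i j) ->
  (\forall x \near F, M x \in unitmx) -> G \in unitmx ->
  forall i j, (fun x => invmx (M x) i j) @ F --> invmx G i j.
Proof.
move=> MG Mu Gu i j.
have -> : invmx G i j = (\det G)^-1 * ((-1) ^+ (j + i) * \det (row' j (col' i G))).
  by rewrite /invmx Gu !mxE.
have : (fun x => (\det (M x))^-1 * ((-1) ^+ (j + i) * \det (row' j (col' i (M x))))) @ F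
    --> (\det G)^-1 * ((-1) ^+ (j + i) * \det (row' j (col' i G))).
  apply: cvgM; first by apply: cvgV; [rewrite -unitfE|exact: cvg_det].
  apply: cvgM; first exact: cvg_cst.
  apply: cvg_det => k l; rewrite !mxE.
  rewrite (_ : (fun x => _) = (fun x => M x (lift j k) (lift i l))); first exact: MG.
  by apply/funext => x; rewrite !mxE.
apply: cvg_trans; apply: near_eq_cvg; apply: filterS Mu => x Mx.
by rewrite /invmx Mx !mxE.
Qed.

Definition posdef m (G : 'M[R]_m) := forall v : 'rV[R]_m, v != 0 ->
  0 < (v *m G *m v^T) 0 0.

Lemma posdef_unit m (G : 'M[R]_m) : posdef G -> G \in unitmx.
Proof.
move=> Gp; rewrite -row_free_unit -kermx_eq0; apply/eqP/row_matrixP => i.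
rewrite row0; apply/eqP/negPn/negP => ki.
have := Gp _ ki; have /sub_kermxP -> : (row i (kermx G) <= kermx G)%MS by exact: row_sub.
by rewrite mul0mx mxE ltxx.
Qed.

Lemma sqnorm_gt0 m (v : 'rV[R]_m) : v != 0 -> 0 < (v *m v^T) 0 0.
Proof.
move=> v0; rewrite mxE; have [i vi] : exists i, v 0 i != 0.
  by apply/existsP; apply: contraNT v0 => /existsPn H; apply/eqP/rowP => i;
    rewrite mxE; apply/eqP/negPn/H.
rewrite (bigD1 i)//= ltr_pwDl//; first by rewrite mxE -expr2 exprn_even_gt0.
by apply: sumr_ge0 => j _; rewrite mxE -expr2 sqr_ge0.
Qed.

(** The segment from the identity to [G] consists of positive definite, hence invertible, matrices.
    The determinant is 1 at its start and cannot change sign along it. *)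
Lemma posdef_det_gt0 m (G : 'M[R]_m) : posdef G -> 0 < \det G.
Proof.
move=> Gp; pose M (t : R) := (1 - t) *: 1%:M + t *: G.
have Mp t : 0 <= t <= 1 -> posdef (M t).
  move=> /andP[t0 t1] v v0.
  rewrite /M mulmxDr mulmxDl -!scalemxAr -!scalemxAl mulmx1 mxE [X in X + _]mxE.
  rewrite [X in _ + X]mxE.
  have p1 := sqnorm_gt0 v0; have p2 := Gp _ v0.
  have [->|t_neq0] := eqVneq t 0; first by rewrite subr0 mul1r mul0r addr0.
  by rewrite ltr_wpDl// ?mulr_ge0 ?subr_ge0 ?(ltW p1)// mulr_gt0// lt_neqAle eq_sym t_neq0.
have Mc : continuous (fun t => \det (M t)).
  move=> t; apply: cvg_det => i j.
  have -> : (fun x => M x i j) = (fun x => (1 - x) * (1%:M : 'M[R]_m) i j + x * G i j).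
    by apply/funext => x; rewrite !mxE.
  rewrite [M t i j]mxE [X in X + _]mxE [X in _ + X]mxE.
  apply: cvgD; apply: cvgM; [|exact: cvg_cst|exact: cvg_id|exact: cvg_cst].
  by apply: cvgB; [exact: cvg_cst|exact: cvg_id].
have M0 : \det (M 0) = 1 by rewrite /M subr0 scale1r scale0r addr0 det1.
have M1 : M 1 = G by rewrite /M subrr scale1r scale0r add0r.
rewrite -M1 ltNge; apply/negP => M1le.
have [||t] := @IVT R (fun t => \det (M t)) 0 1 0 ler01.
- by apply: continuous_subspaceT.
- by rewrite M0 min_r ?max_l ?M1le ?ler01// (le_trans M1le).
rewrite in_itv/= => t01 /eqP; apply/negP; rewrite -unitfE.
exact: posdef_unit (Mp _ t01).
Qed.

End matrices.

Section metrics.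
Context {R : realType} {n : nat} {T : ptopologicalType}.
Variable A : atlas R n T.
Hypothesis hA : compact_manifold_with_boundary A.
Local Notation E := 'rV[R]_n.+1.
Implicit Types (c : idx A) (x : T) (U S : set T) (g : tensor A) (w : cofield A).

Lemma metric_posdef theta S g c x : riemannian_metric theta S g -> dom c x -> S x ->
  posdef (g c x).
Proof. by move=> [_ H _ _] cx Sx v; exact: H. Qed.

Lemma metric_unit theta S g c x : riemannian_metric theta S g -> dom c x -> S x ->
  g c x \in unitmx.
Proof. by move=> gm cx Sx; exact: posdef_unit (metric_posdef gm cx Sx). Qed.

(** The transformation rule exhibits the Jacobian as a factor of the invertible matrix [g c x]; this
    avoids differentiating the inverse transition. *)
Lemma jacobian_unit theta S g c c' x : riemannian_metric theta S g ->
  dom c x -> dom c' x -> S x -> Defs.jacobian c c' x \in unitmx.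
Proof.
move=> gm cx c'x Sx; have := metric_unit gm cx Sx.
have [_ _ _ gE] := gm; rewrite (gE c c' x)// -mulmxA unitmx_mul.
by case/andP.
Qed.

(** [conorm] is evaluated in the chart [chart_at A x], which varies with [x]; this brings it back to
    one fixed chart. *)
Lemma conorm2_chart theta S g w c c' x : riemannian_metric theta S g ->
  dom c x -> dom c' x -> S x ->
  w c x = w c' x *m (Defs.jacobian c c' x)^T ->
  conorm2 g w c x = conorm2 g w c' x.
Proof.
move=> gm cx c'x Sx wE; have Ju := jacobian_unit gm cx c'x Sx.
have gu := metric_unit gm c'x Sx.
rewrite /conorm2 wE; have [_ _ _ gE] := gm; rewrite (gE c c' x)//.
set J := Defs.jacobian c c' x in Ju *; set G := g c' x in gu *.
have JT : J^T \in unitmx by rewrite unitmx_tr.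
have gcu : J *m G *m J^T \in unitmx by rewrite !unitmx_mul unitmx_tr Ju gu.
have -> : w c' x *m J^T *m invmx (J *m G *m J^T) = w c' x *m invmx G *m invmx J.
  apply: (canLR (mulmxK gcu)).
  by rewrite !mulmxA mulmxKV// mulmxKV.
by rewrite trmx_mul trmxK !mulmxA mulmxKV.
Qed.

Lemma metric_cvg theta S g c y i j : riemannian_metric theta S g -> open S ->
  chart_image c S y ->
  (fun z => g c (psi c z) i j) @ within half_space (nbhs y) --> g c (psi c y) i j.
Proof.
move=> [_ _ gC _] oS Sy; have [W [F [oW Wy CF FE]]] := gC c i j y Sy.
have [_ _ _ hy] := chart_imageP hA Sy.
have cF : {for y, continuous F} by case: CF => + _; exact.
rewrite -(FE y Wy Sy).
have : F @ within half_space (nbhs y) --> F y by exact: cvg_within_filter.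
apply: cvg_trans; apply: near_eq_cvg.
have nS := chart_image_near hA oS Sy.
have nW : nbhs y W by exact: open_nbhs_nbhs.
near=> z; apply: FE; first by near: z; exact: cvg_within nW.
by near: z; exact: nS.
Unshelve. all: by end_near. Qed.

End metrics.

(** * The metric near a boundary point *)

Section asymptotics.
Context {R : realType} {n : nat} {T : ptopologicalType}.
Variable A : atlas R n T.
Hypothesis hA : compact_manifold_with_boundary A.
Local Notation E := 'rV[R]_n.+1.
Variables (theta kappa : R) (g gbar : tensor A) (r : T -> R).
Hypothesis gC : compactification theta g r gbar.
Hypothesis gK : forall c x, dom c x -> mboundary A x ->
  conorm2 gbar (differential r) c x = kappa ^+ 2.
Variables (c : idx A) (x0 : T).
Hypotheses (cx0 : dom c x0) (bx0 : phi c x0 0 0 = 0).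

Let y0 : E := phi c x0.
Let V := chart_image c setT.
(** Approach to the boundary point from the interior, the only region where [gbar] is tied to the
    metric [g]. *)
Let P := within [set y : E | 0 < y 0 0] (nbhs y0).

Let Vy0 : V y0. Proof. by exists x0. Qed.

Let interior_cvg (f : E -> R) (l : R) : f @ within half_space (nbhs y0) --> l -> f @ P --> l.
Proof.
move=> fl S Sl.
have H : \forall y \near within half_space (nbhs y0), S (f y) := fl _ Sl.
rewrite near_withinE in H; change (\forall y \near P, S (f y)).
by rewrite near_withinE; apply: filterS H => z Hz z0; apply: Hz; exact: ltW.
Qed.

Let boundary_zero z : V z -> z 0 0 = 0 -> r (psi c z) = 0.
Proof.
move=> Vz z0; have [d _ pK _] := chart_imageP hA Vz.
by case: gC => -[_ _ + _] _ _; apply; exists c => //; rewrite pK.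
Qed.

(** As r vanishes on y_0 = 0, its differential there is a dy_0. Then a <> 0 because dr does not
    vanish, the second claim is |dr|^2 = kappa^2 written out, and r / y_0 tends to a by the mean
    value theorem. *)
Lemma boundary_slope : exists a, [/\ a != 0,
  a ^+ 2 * invmx (gbar c x0) 0 0 = kappa ^+ 2 &
  (fun y => r (psi c y) / y 0 0) @ P --> a].
Proof.
have mb : mboundary A x0 by exists c.
have [[rS r0 rb dr] gm gE] := gC.
have [W [F [oW Wy CF FE]]] := rS c _ Vy0.
pose a := 'D_(basis_vec 0) F y0; exists a.
have nW : nbhs y0 W by exact: open_nbhs_nbhs.
have nV := chart_image_near hA openT Vy0.
have hy0 : half_space y0 by exact: phi_half.
have dE i : differential r c x0 0 i = 'D_(basis_vec i) F y0.
  rewrite mxE; apply: rpartialE hy0 _ _; last exact: (((CF 1%N).2 i).1 _ Wy).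
  by apply: filterS2 nW nV => z Wz Vz hz; rewrite (FE z Wz (Vz hz)).
(* Directions other than the 0-th stay in the hyperplane y_0 = 0, where r is zero. *)
have dEi i : i != 0 -> 'D_(basis_vec i) F y0 = 0.
  move=> i0; have D := @derive_line _ _ F y0 (basis_vec i) 0.
  rewrite scale0r addr0 in D; rewrite -(is_derive_val (D (((CF 1%N).2 i).1 _ Wy))).
  rewrite (near_eq_derive _ (g := cst 0)) ?derive_cst//.
  have L : (y0 + h *: basis_vec i) @[h --> (0 : R)] --> y0 by exact: cvg_line.
  have nW' : \forall h \near (0 : R), W (y0 + h *: basis_vec i) by exact: L _ nW.
  have nV' : \forall h \near (0 : R), half_space (y0 + h *: basis_vec i) ->
    V (y0 + h *: basis_vec i) by exact: L _ nV.
  near=> h; have z0 : (y0 + h *: basis_vec i) 0 0 = 0.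
    by rewrite !mxE bx0 eqxx eq_sym (negbTE i0) mulr0 addr0.
  have Vh : V (y0 + h *: basis_vec i).
    have : half_space (y0 + h *: basis_vec i) by rewrite /half_space/= z0.
    by near: h.
  rewrite (FE _ _ Vh)/= ?boundary_zero//; near: h; exact: nW'.
have dr0 : differential r c x0 = a *: (basis_vec 0 : E).
  apply/rowP => i; rewrite dE !mxE eqxx/=.
  have [->|i0] := eqVneq i 0; first by rewrite mulr1.
  by rewrite mulr0 dEi.
split.
- by have := dr c x0 cx0 mb; rewrite dr0; apply: contraNneq => ->; rewrite scale0r.
- rewrite -(gK cx0 mb) /conorm2 dr0 linearZ/= -scalemxAr -!scalemxAl !mxE.
  rewrite (bigD1 0)//= [X in _ + X]big1 ?addr0; last first.
    by move=> i i0; rewrite !mxE (negbTE i0) andbF mulr0.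
  have b1 : (basis_vec 0 : E) 0 0 = 1 by rewrite mxE eqxx.
  rewrite [(basis_vec 0)^T 0 0]mxE b1 mulr1 mulrA -expr2; congr (_ * _).
  rewrite mxE (bigD1 0)//= [X in _ + X]big1 ?addr0 => [|i i0].
    by rewrite mxE eqxx mul1r.
  by rewrite !mxE (negbTE i0) andbF mul0r.
- apply/cvgrPdist_le => e e0.
  have cD : {for y0, continuous (fun z => 'D_(basis_vec 0) F z)}.
    exact: ((CF 1%N).2 0).2 _ Wy.
  have nD : \forall z \near y0, `|a - 'D_(basis_vec 0) F z| <= e.
    by have /cvgrPdist_le/(_ _ e0) := cD.
  have nDWV : nbhs y0 ([set z | `|a - 'D_(basis_vec 0) F z| <= e] `&`
    (W `&` [set z | half_space z -> V z])) by do !apply: filterI.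
  have /nbhs_ballP[rho /= rho0 rhoP] := nDWV.
  have : nbhs y0 (ball y0 rho) by exact: nbhsx_ballx.
  rewrite /P near_withinE; apply: filterS => y; rewrite -ball_normE /ball_/= => yr yp.
  (* The foot of [y] on the boundary. Since r vanishes at [z], the quotient r (y) / y_0 is a value
     of the 0-th derivative of [F] on the vertical segment from [z] to [y]. *)
  pose z := y - y 0 0 *: basis_vec 0.
  have zt t : `|t| <= `|y 0 0| -> ball y0 rho (z + t *: basis_vec 0).
    move=> ty; rewrite -ball_normE /ball_/= (le_lt_trans _ yr)//.
    apply: norm_rV_le => i; rewrite !mxE eqxx/=.
    have [->|i0] := eqVneq i 0; last first.
      by rewrite !mulr0 subr0 addr0; have := coord_le_norm (y0 - y) i; rewrite !mxE.
    rewrite !mulr1 subrr add0r bx0 sub0r normrN (le_trans ty)//.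
    by have := coord_le_norm (y0 - y) 0; rewrite !mxE bx0 sub0r normrN.
  have dline (t : R) : `|t| <= `|y 0 0| ->
      is_derive t 1 (fun s : R => F (z + s *: basis_vec 0))
        ('D_(basis_vec 0) F (z + t *: basis_vec 0)).
    move=> /zt/rhoP[_ [Wz _]]; apply: derive_line.
    exact: (((CF 1%N).2 0).1 _ Wz).
  have [s sy] := MVT_sym dline.
  rewrite scale0r addr0 /z subrK => FD.
  have zz : z = z + 0 *: basis_vec 0 by rewrite scale0r addr0.
  have z0_ball : `|0 : R| <= `|y 0 0| by rewrite normr0.
  have [_ [Wz Vz]] := rhoP _ (zt 0 z0_ball).
  rewrite -zz in Wz Vz.
  have z00 : z 0 0 = 0 by rewrite !mxE eqxx mulr1 subrr.
  have {}Vz : V z by apply: Vz; rewrite /half_space/= z00.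
  have yy : z + y 0 0 *: basis_vec 0 = y by rewrite /z subrK.
  have [_ [Wy' Vy']] := rhoP _ (zt (y 0 0) (lexx _)); rewrite yy in Wy' Vy'.
  have {}Vy' : V y by apply: Vy'; exact: ltW.
  rewrite -[y - _]/z (FE _ Wz Vz) /= (boundary_zero Vz z00) subr0 (FE _ Wy' Vy') /= in FD.
  rewrite FD mulfK ?gt_eqF//.
  by have [] := rhoP _ (zt s sy).
Unshelve. all: by end_near. Qed.

Lemma cvg_between (F : set_system E) (FF : Filter F) (f : E -> R) (l a b : R) :
  f @ F --> l -> a < l -> l < b -> \forall y \near F, a <= f y <= b.
Proof.
move=> fl al lb; near=> y; apply/andP; split; near: y.
  by apply: (cvgr_ge _ fl).
by apply: (cvgr_le _ fl).
Unshelve. all: by end_near. Qed.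

(** With q = r / y_0, which tends to a, both g^-1 / y_0^2 and y_0^(n+1) sqrt (det g) become
    expressions in q and gbar that converge at the boundary point. The limit of the (0, 0) entry of
    the former is a^2 gbar^00 = kappa^2; all bounds then hold on a small cube. *)
Lemma local_asymptotics eta : 0 < eta -> exists e m1 m2 K : R,
  [/\ 0 < e, 0 < m1, 0 <= m2, 0 <= K &
  forall y : E, (forall i, `|y 0 i - y0 0 i| < e) -> 0 < y 0 0 ->
  [/\ V y, m1 <= y 0 0 ^+ n.+1 * Num.sqrt (\det (g c (psi c y))) <= m2 &
   exists H : 'M[R]_n.+1, [/\ H 0 0 <= kappa ^+ 2 + eta,
     forall i j, `|H i j| <= K &
     forall w : cofield A, conorm2 g w c (psi c y) =
       y 0 0 ^+ 2 * (w c (psi c y) *m H *m (w c (psi c y))^T) 0 0]]].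
Proof.
move=> eta0; have [a [a0 aK slope]] := boundary_slope.
have [[rS r0 rb dr] gm gE] := gC.
have FP : Filter P by exact: within_filter.
pose G := gbar c x0.
have Gp : posdef G by exact: metric_posdef gm cx0 I.
have Gu := posdef_unit Gp; have Gdet := posdef_det_gt0 Gp.
have psiy0 : psi c y0 = x0 by rewrite (psiK hA).
have gcv i j : (fun y => gbar c (psi c y) i j) @ P --> G i j.
  by apply: interior_cvg; have := metric_cvg hA gm openT Vy0 (i := i) (j := j);
    rewrite psiy0.
have PV : \forall y \near P, V y.
  have nV := chart_image_near hA openT Vy0.
  by rewrite /P near_withinE; apply: filterS nV => y Vy yp; apply: Vy; exact: ltW.
have Pp : \forall y \near P, 0 < (y : E) 0 0 by exact: withinT.
have Pu : \forall y \near P, gbar c (psi c y) \in unitmx.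
  by apply: filterS PV => y /(chart_imageP hA)[d _ _ _]; exact: metric_unit gm d I.
have icv i j : (fun y => invmx (gbar c (psi c y)) i j) @ P --> invmx G i j.
  exact: cvg_invmx.
pose q (y : E) := r (psi c y) / y 0 0.
(* g^-1 = r^2 gbar^-1 = y_0^2 H with r = q y_0. *)
pose H y := q y ^+ 2 *: invmx (gbar c (psi c y)).
have Hcv i j : (fun y => H y i j) @ P --> a ^+ 2 * invmx G i j.
  have -> : (fun y => H y i j) = (fun y => q y ^+ 2 * invmx (gbar c (psi c y)) i j).
    by apply/funext => y; rewrite mxE.
  by apply: cvgM => //; exact: (cvgM slope slope).
(* The limit of y_0^(n+1) times the volume density. The absolute value is there because only a <> 0
   is recorded about the sign of [a]. *)
pose m := `|a| ^- n.+1 * Num.sqrt (\det G).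
have m0 : 0 < m by rewrite mulr_gt0 ?sqrtr_gt0// invr_gt0 exprn_gt0// normr_gt0.
have mcv : (fun y => `|q y| ^- n.+1 * Num.sqrt (\det (gbar c (psi c y)))) @ P --> m.
  apply: cvgM.
    apply: cvgV; first by rewrite expf_neq0// normr_eq0.
    have cX : {for `|a|, continuous (fun x : R => x ^+ n.+1)} by exact: exprn_continuous.
    apply: (@cvg_comp _ _ _ (fun y => `|q y|) (fun x : R => x ^+ n.+1) _ _ _ _ cX).
    exact: cvg_norm slope.
  apply: (@cvg_comp _ _ _ (fun y => \det (gbar c (psi c y))) Num.sqrt _ _ _ _
    (@sqrt_continuous R _)).
  exact: cvg_det.
(* Strictly larger than the absolute value of every entry of the limit of [H], so it bounds the
   entries eventually. *)
pose K := 1 + \sum_i \sum_j `|a ^+ 2 * invmx G i j|.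
have K0 : 0 <= K by rewrite addr_ge0// sumr_ge0// => i _; exact: sumr_ge0.
have HK : \forall y \near P, forall ij : 'I_n.+1 * 'I_n.+1, `|H y ij.1 ij.2| <= K.
  have HKij (ij : 'I_n.+1 * 'I_n.+1) : \forall y \near P, `|H y ij.1 ij.2| <= K.
    case: ij => i j /=.
    have Kij : `|a ^+ 2 * invmx G i j| < K.
      rewrite /K ltr_pwDl// (bigD1 i)//= (bigD1 j)//= -addrA lerDl addr_ge0//.
        by rewrite sumr_ge0.
      by rewrite sumr_ge0// => k _; exact: sumr_ge0.
    exact: (cvgr_le _ (cvg_norm (Hcv i j))).
  exact: filter_forall HKij.
have H00 : \forall y \near P, H y 0 0 <= kappa ^+ 2 + eta.
  by apply: (cvgr_le _ (Hcv 0 0)); rewrite aK ltrDl.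
have mb := cvg_between FP mcv (_ : m / 2 < m) (_ : m < 2 * m).
have {}mb : \forall y \near P, m / 2 <= `|q y| ^- n.+1 * Num.sqrt (\det (gbar c (psi c y)))
    <= 2 * m.
  by apply: mb; [rewrite ltr_pdivrMr// ltr_pMr// ltr1n|rewrite ltr_pMl// ltr1n].
have : \forall y \near P, [/\ V y, H y 0 0 <= kappa ^+ 2 + eta,
   forall ij : 'I_n.+1 * 'I_n.+1, `|H y ij.1 ij.2| <= K &
   m / 2 <= `|q y| ^- n.+1 * Num.sqrt (\det (gbar c (psi c y))) <= 2 * m].
  by near=> y; split; near: y.
rewrite /P near_withinE => /nbhs_ballP[e /= e0 eP].
exists e, (m / 2), (2 * m), K; split=> //; rewrite ?divr_gt0 ?mulr_ge0 ?(ltW m0)//.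
move=> y ye yp.
have [Vy yH yK ym] : [/\ V y, H y 0 0 <= kappa ^+ 2 + eta,
   forall ij : 'I_n.+1 * 'I_n.+1, `|H y ij.1 ij.2| <= K &
   m / 2 <= `|q y| ^- n.+1 * Num.sqrt (\det (gbar c (psi c y))) <= 2 * m].
  apply: eP => //; split=> // i j; rewrite ord1 /ball/= distrC; exact: ye.
have [d _ pK _] := chart_imageP hA Vy.
have mi : minterior A (psi c y) by exists c => //; rewrite pK.
have rp := r0 _ mi; have ry := gE c _ d mi.
have gry : g c (psi c y) = (r (psi c y) ^+ 2)^-1 *: gbar c (psi c y).
  by rewrite ry scalerA mulVf ?scale1r// expf_neq0// gt_eqF.
have qp : 0 < q y by rewrite divr_gt0.
have gu : gbar c (psi c y) \in unitmx by exact: metric_unit gm d I.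
split=> //.
- suff -> : y 0 0 ^+ n.+1 * Num.sqrt (\det (g c (psi c y))) =
    `|q y| ^- n.+1 * Num.sqrt (\det (gbar c (psi c y))) by [].
  rewrite gry detZ sqrtrM; last by rewrite exprn_ge0// invr_ge0 sqr_ge0.
  rewrite mulrA; congr (_ * _).
  rewrite -exprVn -exprM mulnC exprM sqrtr_sqr -exprVn ger0_norm; last first.
    by rewrite exprn_ge0// invr_ge0 ltW.
  rewrite (gtr0_norm qp) -?exprVn -exprMn; congr (_ ^+ _).
  by rewrite /q invf_div.
- exists (H y); split=> // [i j|w]; first exact: (yK (i, j)).
  rewrite /conorm2 gry invmxZ; last first.
    by rewrite unitmxZ// unitfE invr_eq0 expf_neq0// gt_eqF.
  rewrite invrK /H -!scalemxAr -!scalemxAl !mxE [in RHS]mulrA; congr (_ * _).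
  by rewrite /q -exprMn mulrC divfK ?gt_eqF.
Unshelve. all: by end_near. Qed.

End asymptotics.

(** * A smooth convex domain in the half-space *)

Lemma coord_box_compact {R : realType} {n : nat} (a b r : R) (p : 'rV[R]_n.+1) :
  compact [set y : 'rV[R]_n.+1 | a <= y 0 0 <= b /\
    forall i, i != 0 -> `|y 0 i - p 0 i| <= r].
Proof.
pose J (i : 'I_n.+1) : set R := if i == 0 then `[a, b]%classic
  else `[p 0 i - r, p 0 i + r]%classic.
set B := (X in compact X); have -> : B = [set y | forall i, J i (y ord0 i)].
  apply/seteqP; split=> [y [y0 yi] i|y yJ].
    rewrite /J; have [->|i0] := eqVneq i 0; first by rewrite /= in_itv.
    rewrite /= in_itv/= -ler_distl; exact: yi.
  split=> [|i i0]; first by have := yJ 0; rewrite /J eqxx /= in_itv.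
  by have := yJ i; rewrite /J (negbTE i0) /= in_itv/= -ler_distl.
apply: rV_compact => i; rewrite /J; case: ifP => _; exact: segment_compact.
Qed.

Section domain.
Context {R : realType} {n : nat}.
Local Notation E := 'rV[R]_n.+1.
Variables (lo hi e1 : R) (p : E).
Hypotheses (lo0 : 0 < lo) (lohi : lo < hi) (e10 : 0 < e1).
Hypotheses (p0 : p 0 0 = 0).
Implicit Types (y z : E) (t : R).

Let hi0 : 0 < hi. Proof. exact: lt_trans lohi. Qed.

(* [rho] is convex for y_0 > 0, with its only critical point where rho < 0, and
   1 / y_0 keeps the sublevel set away from the boundary y_0 = 0. *)
Definition rho y : R := \sum_(i < n.+1 | i != 0) ((y 0 i - p 0 i) / e1) ^+ 2 +
  (lo / 4 * (y 0 0)^-1 + y 0 0 / (4 * hi)) - 1.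

Definition sublevel : set E := [set y : E | 0 < y 0 0 /\ rho y < 0].

Lemma segment_coord y z t i : (y + t *: (z - y)) 0 i = y 0 i + t * (z 0 i - y 0 i).
Proof. by rewrite !mxE. Qed.

Lemma segment_pos y z t : 0 <= t <= 1 -> 0 < y 0 0 -> 0 < z 0 0 ->
  0 < (y + t *: (z - y)) 0 0.
Proof.
move=> /andP[t0 t1] y0 z0; rewrite segment_coord.
have -> : y 0 0 + t * (z 0 0 - y 0 0) = (1 - t) * y 0 0 + t * z 0 0 by ring.
have [->|t_neq0] := eqVneq t 0; first by rewrite subr0 mul1r mul0r addr0.
by rewrite ltr_wpDl ?mulr_ge0 ?subr_ge0 ?(ltW y0)// mulr_gt0// lt_neqAle eq_sym t_neq0.
Qed.

Lemma inv_convex (u w t : R) : 0 < u -> 0 < w -> 0 <= t <= 1 ->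
  0 < u + t * (w - u) -> (u + t * (w - u))^-1 <= u^-1 + t * (w^-1 - u^-1).
Proof.
move=> u0 w0 /andP[t0 t1] m0.
rewrite -[leLHS]mul1r ler_pdivrMr// -subr_ge0.
have -> : (u^-1 + t * (w^-1 - u^-1)) * (u + t * (w - u)) - 1 =
    t * (1 - t) * (u - w) ^+ 2 * (u^-1 * w^-1).
  by field; rewrite !gt_eqF.
apply: mulr_ge0; last by rewrite mulr_ge0 ?invr_ge0 ?(ltW u0) ?(ltW w0).
by apply: mulr_ge0; [rewrite mulr_ge0 ?subr_ge0|exact: sqr_ge0].
Qed.

Lemma sqr_convex (u w t : R) : 0 <= t <= 1 ->
  (u + t * (w - u)) ^+ 2 <= u ^+ 2 + t * (w ^+ 2 - u ^+ 2).
Proof.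
move=> /andP[t0 t1]; rewrite -subr_ge0.
have -> : u ^+ 2 + t * (w ^+ 2 - u ^+ 2) - (u + t * (w - u)) ^+ 2 =
  t * (1 - t) * (u - w) ^+ 2 by ring.
by apply: mulr_ge0; [rewrite mulr_ge0 ?subr_ge0|exact: sqr_ge0].
Qed.

Lemma rho_convex y z t : 0 < y 0 0 -> 0 < z 0 0 -> 0 <= t <= 1 ->
  rho (y + t *: (z - y)) <= rho y + t * (rho z - rho y).
Proof.
move=> y0 z0 t01; have m0 := segment_pos t01 y0 z0; rewrite segment_coord in m0.
have A1 : \sum_(i < n.+1 | i != 0) (((y + t *: (z - y)) 0 i - p 0 i) / e1) ^+ 2 <=
    \sum_(i < n.+1 | i != 0) (((y 0 i - p 0 i) / e1) ^+ 2 +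
     t * (((z 0 i - p 0 i) / e1) ^+ 2 - ((y 0 i - p 0 i) / e1) ^+ 2)).
  apply: ler_sum => i _.
  have -> : ((y + t *: (z - y)) 0 i - p 0 i) / e1 = (y 0 i - p 0 i) / e1 +
     t * ((z 0 i - p 0 i) / e1 - (y 0 i - p 0 i) / e1).
    by rewrite segment_coord; ring.
  exact: sqr_convex.
rewrite big_split/= -mulr_sumr sumrB in A1.
have A2 := inv_convex y0 z0 t01 m0.
rewrite /rho [X in _ * X^-1]segment_coord [X in X / (4 * hi)]segment_coord.
have A3 : lo / 4 * (y 0 0 + t * (z 0 0 - y 0 0))^-1 <=
    lo / 4 * ((y 0 0)^-1 + t * ((z 0 0)^-1 - (y 0 0)^-1)).
  by rewrite ler_wpM2l// divr_ge0// ltW.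
move: A1 A3; set S1 := \sum_(_ | _) _; set S2 := \sum_(_ | _) _; set S3 := \sum_(_ | _) _.
set u := (y 0 0)^-1; set w := (z 0 0)^-1; set v := (_ + _)^-1.
move=> A1 A3.
have -> : S2 + (lo / 4 * u + y 0 0 / (4 * hi)) - 1 + t *
  (S3 + (lo / 4 * w + z 0 0 / (4 * hi)) - 1 - (S2 + (lo / 4 * u + y 0 0 / (4 * hi)) - 1)) =
  (S2 + t * (S3 - S2)) + (lo / 4 * (u + t * (w - u)) +
    (y 0 0 + t * (z 0 0 - y 0 0)) / (4 * hi)) - 1 by ring.
by rewrite lerD2r lerD// lerD2r.
Qed.

Lemma sublevel_convex y z t : sublevel y -> sublevel z -> 0 <= t <= 1 ->
  sublevel (y + t *: (z - y)).
Proof.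
move=> [y0 ry] [z0 rz] t01; split; first exact: segment_pos.
apply: (le_lt_trans (rho_convex y0 z0 t01)).
have -> : rho y + t * (rho z - rho y) = (1 - t) * rho y + t * rho z by ring.
move/andP: t01 => [t0 t1].
have [->|t_neq0] := eqVneq t 0; first by rewrite subr0 mul1r mul0r addr0.
rewrite ltr_wnDl//; first by rewrite mulr_ge0_le0 ?subr_ge0// ltW.
by rewrite pmulr_rlt0// lt_neqAle eq_sym t_neq0.
Qed.

(** All terms of rho + 1 are nonnegative, so rho <= 0 bounds each of them by 1; the two terms in y_0
    give lo / 4 and 4 hi. *)
Lemma sublevel_bounds y : 0 < y 0 0 -> rho y <= 0 ->
  lo / 4 <= y 0 0 <= 4 * hi /\ forall i, i != 0 -> `|y 0 i - p 0 i| <= e1.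
Proof.
move=> y0; rewrite /rho => ry.
have S0 : 0 <= \sum_(i < n.+1 | i != 0) ((y 0 i - p 0 i) / e1) ^+ 2.
  by apply: sumr_ge0 => i _; exact: sqr_ge0.
have a0 : 0 <= lo / 4 * (y 0 0)^-1 by rewrite mulr_ge0 ?divr_ge0 ?invr_ge0 ?ltW.
have b0 : 0 <= y 0 0 / (4 * hi) by rewrite divr_ge0 ?mulr_ge0 ?ltW.
split.
  have a1 : lo / 4 / y 0 0 <= 1 by lra.
  have b1 : y 0 0 / (4 * hi) <= 1 by lra.
  by rewrite ler_pdivrMr// mul1r in a1; rewrite a1/=;
    rewrite ler_pdivrMr ?mulr_gt0// mul1r in b1.
move=> i i0; move: S0 ry; rewrite (bigD1 i)//=; set S := \sum_(_ | _) _ => S0 ry.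
have S'0 : 0 <= S by apply: sumr_ge0 => j _; exact: sqr_ge0.
have : ((y 0 i - p 0 i) / e1) ^+ 2 <= 1 by lra.
rewrite -[leLHS]real_normK ?num_real// expr_le1// normrM.
rewrite [X in _ * X]ger0_norm ?invr_ge0 ?(ltW e10)//.
by rewrite ler_pdivrMr// mul1r.
Qed.

Lemma upper_half_open : open [set y : E | 0 < y 0 0].
Proof.
apply: (@open_comp _ _ (fun y : E => y 0 0) [set t | 0 < t]); last exact: open_gt.
by move=> y _; exact: coord_continuous.
Qed.

Lemma rho_Cinfty : Cinfty [set y : E | 0 < y 0 0] rho.
Proof.
move=> k; have oH := upper_half_open.
have Cc i : class_C (@continuous_on R n) k [set y | 0 < y 0 0] (fun y => y 0 i).
  exact: class_C_coord.
have Ck (a : R) : class_C (@continuous_on R n) k [set y | 0 < y 0 0] (fun=> a).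
  exact: class_C_cst.
have CS : class_C (@continuous_on R n) k [set y | 0 < y 0 0]
    (fun y => \sum_(i < n.+1) (i != 0)%:R * (((y 0 i - p 0 i) / e1) ^+ 2)).
  apply: class_C_sum => // i; apply: class_C_M => //.
  have C1 : class_C (@continuous_on R n) k [set y | 0 < y 0 0]
      (fun y => (y 0 i - p 0 i) / e1).
    by apply: class_C_M => //; apply: class_C_D => //; exact: class_C_cst.
  exact: (class_C_M oH C1 C1).
have CV : class_C (@continuous_on R n) k [set y | 0 < y 0 0] (fun y => (y 0 0)^-1).
  have := class_C_powR (-1) oH (fun y => id) (Cc 0).
  by apply: class_C_eq => // y y0; rewrite powR_inv1// ltW.
have := class_C_D oH (class_C_D oH CS (class_C_D oH (class_C_M oH (Ck (lo / 4)) CV)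
  (class_C_M oH (Cc 0) (Ck (4 * hi)^-1)))) (Ck (-1)).
apply: class_C_eq => // y _; rewrite /rho; congr (_ + _ - 1).
rewrite [RHS]big_mkcond/=; apply: eq_bigr => i _.
by case: ifPn => _; rewrite ?mul1r ?mul0r.
Qed.

Lemma rho_continuous y : 0 < y 0 0 -> {for y, continuous rho}.
Proof. by move=> y0; exact: (rho_Cinfty 0%N). Qed.

Lemma sublevel_open : open sublevel.
Proof.
rewrite openE => y [y0 ry].
have n1 : \forall z \near y, 0 < (z : E) 0 0 by exact: open_nbhs_nbhs (conj upper_half_open _).
have n2 : \forall z \near y, rho z < 0.
  by apply: (cvgr_lt _ (rho_continuous y0)).
by apply: filterS2 n1 n2 => z.
Qed.

(** A point with rho < 0: the sublevel set is star-shaped about it, and moving towards it from the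
    zero level decreases rho. *)
Definition base_point : E := p + lo *: basis_vec 0.

Lemma base_point0 : base_point 0 0 = lo.
Proof. by rewrite !mxE p0 add0r mulr1. Qed.

Lemma base_point_sublevel : sublevel base_point.
Proof.
split; first by rewrite base_point0.
rewrite /rho base_point0 big1 ?add0r => [|i i0]; last first.
  by rewrite !mxE eqxx/= (negbTE i0) mulr0 addr0 subrr mul0r expr0n.
have h1 : lo / (4 * hi) <= 4^-1.
  by rewrite ler_pdivrMr ?mulr_gt0// mulrA mulVf// mul1r ltW.
have -> : lo / 4 / lo = 4^-1 by field; rewrite gt_eqF.
lra.
Qed.

(** Each of the three groups of terms is at most 1/4, so rho <= 3/4 - 1. For the squares, the radius
    e1 / (2 (n + 1)) makes each of them at most 1 / (4 (n + 1)). *)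
Lemma support_sublevel y : lo <= y 0 0 <= hi ->
  (forall i, i != 0 -> `|y 0 i - p 0 i| <= e1 / (2 * n.+1%:R)) -> sublevel y.
Proof.
move=> /andP[y1 y2] yi; have y0 : 0 < y 0 0 by exact: lt_le_trans y1.
split=> //; rewrite /rho.
have N0 : 0 < n.+1%:R :> R by rewrite ltr0n.
have S : \sum_(i < n.+1 | i != 0) ((y 0 i - p 0 i) / e1) ^+ 2 <= 4^-1.
  have -> : 4^-1 = \sum_(i < n.+1) (4 * n.+1%:R)^-1 :> R.
    by rewrite sumr_const card_ord -[RHS]mulr_natr invfM -mulrA mulVf ?mulr1// gt_eqF.
  rewrite [leRHS](bigID (fun i => i != 0))/= -[leLHS]addr0; apply: lerD.
    apply: ler_sum => i i0; rewrite -[leLHS]real_normK ?num_real//.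
    have ti : `|(y 0 i - p 0 i) / e1| <= (2 * n.+1%:R)^-1.
      rewrite normrM [X in _ * X]ger0_norm ?invr_ge0 ?(ltW e10)//.
      by rewrite ler_pdivrMr// mulrC yi.
    apply: (@le_trans _ _ ((2 * n.+1%:R)^-1 ^+ 2)).
      by rewrite lerXn2r ?nnegrE// invr_ge0 mulr_ge0.
    rewrite exprVn lef_pV2 ?posrE ?exprn_gt0 ?mulr_gt0//.
    have -> : (2 * n.+1%:R) ^+ 2 = 4 * n.+1%:R * n.+1%:R :> R by ring.
    by rewrite ler_peMr ?mulr_ge0// ler1n.
  by apply: sumr_ge0 => i _; rewrite invr_ge0 mulr_ge0.
have h1 : lo / 4 / y 0 0 <= 4^-1.
  by rewrite ler_pdivrMr// mulrC ler_wpM2l// invr_ge0.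
have h2 : y 0 0 / (4 * hi) <= 4^-1.
  by rewrite ler_pdivrMr ?mulr_gt0// mulrA mulVf// mul1r.
lra.
Qed.

(** A critical point of a convex function is a minimum, but rho is negative at [base_point]: along
    the segment towards it the difference quotients from [y] stay below that negative value. *)
Lemma rho_regular y : 0 < y 0 0 -> rho y = 0 ->
  exists i, 'D_(basis_vec i) rho y != 0.
Proof.
move=> y0 ry; apply: contrapT => H.
have D0 i : 'D_(basis_vec i) rho y = 0.
  by apply/eqP/negPn/negP => Di; apply: H; exists i.
have [b0 rb] := base_point_sublevel.
pose v := base_point - y.
have dv : derivable rho y v.
  exact: diff_derivable (class_C_differentiable upper_half_open (rho_Cinfty 1%N) y0).
have Dv : 'D_v rho y = 0.
  rewrite (class_C_deriveE _ upper_half_open (rho_Cinfty 1%N) y0).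
  by rewrite big1// => i _; rewrite D0 mulr0.
have D : (fun h : R => h^-1 *: (rho (h *: v + y) - rho y)) @ 0^' --> 'D_v rho y.
  exact: dv.
have Dr : (fun h : R => h^-1 *: (rho (h *: v + y) - rho y)) @ 0^'+ --> 'D_v rho y.
  move=> S /D /nbhs_ballP[e e0 eS]; exists e => //= h eh /gt_eqF/negbT/eS; exact.
suff : 'D_v rho y <= rho base_point by rewrite Dv leNgt rb.
rewrite -(cvg_lim _ Dr)//; apply: limr_le; first by apply/cvg_ex; exists ('D_v rho y).
near=> h.
have h0 : 0 < h by near: h; exact: nbhs_right_gt.
have h1 : h <= 1 by near: h; exact: nbhs_right_le.
have h01 : 0 <= h <= 1 by rewrite (ltW h0).
have := rho_convex y0 b0 h01; rewrite ry add0r !subr0 addrC => Hc.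
by rewrite -[leLHS]/(_ * _) mulrC ler_pdivrMr// [leRHS]mulrC.
Unshelve. all: by end_near. Qed.

Lemma segment_continuous y z : continuous (fun t : R => y + t *: (z - y)).
Proof.
move=> t; apply: cvgD; first exact: cvg_cst.
by apply: cvgZr_tmp; exact: cvg_id.
Qed.

Lemma sublevel_connected : connected sublevel.
Proof.
pose seg z := (fun t : R => base_point + t *: (z - base_point)) @` `[0, 1].
have -> : sublevel = \bigcup_(z in sublevel) seg z.
  apply/seteqP; split=> [z Oz|y [z Oz [t]]].
    exists z => //; exists 1; first by rewrite /= in_itv/= lexx ler01.
    by rewrite scale1r addrC subrK.
  rewrite /= in_itv/= => t01 <-.
  exact: sublevel_convex base_point_sublevel Oz t01.
apply: bigcup_connected.
  exists base_point => z _; exists 0; first by rewrite /= in_itv/= lexx ler01.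
  by rewrite scale0r addr0.
move=> z _; apply: connected_continuous_connected; first exact: segment_connected.
exact/continuous_subspaceT/segment_continuous.
Qed.

Definition closed_box : set E := [set y : E | lo / 4 <= y 0 0 <= 4 * hi /\
  forall i, i != 0 -> `|y 0 i - p 0 i| <= e1].

Lemma closed_box_compact : compact closed_box.
Proof. exact: coord_box_compact. Qed.

Lemma sublevel_closed_box : sublevel `<=` closed_box.
Proof. by move=> y [y0 ry]; apply: sublevel_bounds => //; exact: ltW. Qed.

End domain.

(** * The corresponding domain of the manifold *)

Lemma ge0_le_integral_on d (X : measurableType d) (R : realType)
    (mu : {measure set X -> \bar R}) (D : set X) (f g : X -> \bar R) :
  (forall x, D x -> (0 <= f x)%E) -> (forall x, D x -> (f x <= g x)%E) ->
  (\int[mu]_(x in D) f x <= \int[mu]_(x in D) g x)%E.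
Proof.
move=> f0 fg; rewrite integral_mkcond [leRHS]integral_mkcond.
by apply: ge0_le_integralT; [exact: erestrict_ge0|exact: lee_restrict].
Qed.

Section omega.
Context {R : realType} {n : nat} {T : ptopologicalType}.
Variable A : atlas R n T.
Hypothesis hA : compact_manifold_with_boundary A.
Local Notation E := 'rV[R]_n.+1.
Implicit Types (c : idx A) (x : T) (U S : set T).

Lemma minterior_open : open (minterior A).
Proof.
rewrite openE => x [c cx x0].
have oD := dom_open hA c.
have n1 : \forall z \near x, dom c z by exact: open_nbhs_nbhs (conj oD cx).
have cphi := phi_continuous hA cx.
have n2 : \forall z \near x, 0 < phi c z 0 0.
  exact: cphi _ (open_nbhs_nbhs (conj upper_half_open x0)).
by apply: filterS2 n1 n2 => z cz z0; exists c.
Qed.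

Lemma differential_pullback (G : E -> R) (f : T -> R) c U O x :
  open U -> U x -> U `<=` dom c -> open O -> O (phi c x) -> Cinfty O G ->
  (forall z, U z -> f z = G (phi c z)) ->
  differential f c x = \row_i 'D_(basis_vec i) G (phi c x).
Proof.
move=> oU Ux Uc oO Ox CG fG; apply/rowP => i; rewrite !mxE.
have cx := Uc _ Ux; apply: rpartialE (phi_half hA cx) _ _.
  have Uy : chart_image c U (phi c x) by exists x.
  apply: filterS (chart_image_near hA oU Uy) => z Uz hz.
  by have [_ Uz' pK _] := chart_imageP hA (Uz hz); rewrite /= fG// pK.
exact: (((CG 1%N).2 i).1 _ Ox).
Qed.

Variables (c : idx A) (lo hi e1 : R) (p : E).
Hypotheses (lo0 : 0 < lo) (lohi : lo < hi) (e10 : 0 < e1) (hie : 4 * hi <= e1).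
Hypothesis p0 : p 0 0 = 0.
Hypothesis hV : forall y : E, (forall i, `|y 0 i - p 0 i| <= e1) -> 0 < y 0 0 ->
  chart_image c setT y.

Local Notation O := (sublevel lo hi e1 p).
Local Notation K := (closed_box lo hi e1 p).
Local Notation rho := (rho lo hi e1 p).

Definition Omega : set T := [set x | dom c x /\ O (phi c x)].

Lemma closed_box_pos y : K y -> 0 < y 0 0.
Proof. by move=> [/andP[+ _] _]; apply: lt_le_trans; rewrite divr_gt0. Qed.

Lemma closed_box_chart y : K y -> chart_image c setT y.
Proof.
move=> Ky; have y0 := closed_box_pos Ky; apply: hV => // i.
have [/andP[_ y1] yi] := Ky; have [->|i0] := eqVneq i 0; last exact: yi.
by rewrite p0 subr0 gtr0_norm// (le_trans y1).
Qed.

Lemma chart_psi y : chart_image c setT y -> dom c (psi c y) /\ phi c (psi c y) = y.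
Proof. by move=> /(chart_imageP hA)[]. Qed.

Lemma sublevel_chart y : O y -> chart_image c setT y.
Proof. by move=> /(sublevel_closed_box lo0 lohi e10)/closed_box_chart. Qed.

Lemma Omega_psi y : O y -> Omega (psi c y).
Proof. by move=> Oy; have [d pK] := chart_psi (sublevel_chart Oy); rewrite /Omega/= pK. Qed.

Lemma OmegaE : Omega = psi c @` O.
Proof.
apply/seteqP; split=> [x [cx Ox]|_ [y Oy <-]]; last exact: Omega_psi.
by exists (phi c x) => //; exact: psiK.
Qed.

Lemma Omega_minterior : Omega `<=` minterior A.
Proof. by move=> x [cx [x0 _]]; exists c. Qed.

Lemma psi_continuous_within : {within chart_image c setT, continuous (psi c)}.
Proof. by have [] := chartP hA c. Qed.

Lemma psi_continuous y : O y -> {for y, continuous (psi c)}.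
Proof.
move=> Oy; have := (subspace_continuousP _ _).1 psi_continuous_within _ (sublevel_chart Oy).
rewrite within_interior//; apply: filterS (open_nbhs_nbhs (conj _ Oy)).
  by move=> z; exact: sublevel_chart.
exact: sublevel_open.
Qed.

Lemma Omega_open : open Omega.
Proof.
rewrite openE => x [cx Ox].
have n1 : \forall z \near x, dom c z by exact: open_nbhs_nbhs (conj (dom_open hA c) cx).
have n2 : \forall z \near x, O (phi c z).
  by apply: (phi_continuous hA cx); apply: open_nbhs_nbhs; split=> //; exact: sublevel_open.
by apply: filterS2 n1 n2.
Qed.

Lemma Omega_nonempty : Omega !=set0.
Proof.
by exists (psi c (base_point lo p)); apply: Omega_psi; exact: base_point_sublevel.
Qed.

Lemma Omega_connected : connected Omega.
Proof.
rewrite OmegaE; apply: connected_continuous_connected.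
  exact: sublevel_connected.
apply: continuous_subspaceW psi_continuous_within => y; exact: sublevel_chart.
Qed.

(** The image of the compact box is closed because the manifold is Hausdorff. So limit points of
    Omega neither leave the chart nor reach the boundary of the manifold. *)
Lemma Omega_closure : closure Omega `<=` psi c @` K.
Proof.
have clK : closed (psi c @` K).
  apply: compact_closed; first by case: hA.
  apply: continuous_compact; last exact: closed_box_compact.
  apply: continuous_subspaceW psi_continuous_within => y; exact: closed_box_chart.
rewrite [X in _ `<=` X]((closure_id _).1 clK); apply: closureS.
rewrite OmegaE; apply: image_subset; exact: sublevel_closed_box.
Qed.

Lemma Omega_boundary x : closure Omega x -> ~ Omega x ->
  [/\ dom c x, 0 < phi c x 0 0 & rho (phi c x) = 0].
Proof.
move=> clx nOx; have [y Ky yx] := Omega_closure clx.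
have [d pK] := chart_psi (closed_box_chart Ky); rewrite yx in d pK.
have y0 := closed_box_pos Ky; rewrite -pK in y0.
split=> //; apply/eqP; rewrite eq_le; apply/andP; split; last first.
  by rewrite leNgt; apply/negP => r0; apply: nOx.
rewrite leNgt; apply/negP => r0.
have n1 : \forall z \near x, dom c z by exact: open_nbhs_nbhs (conj (dom_open hA c) d).
have n2 : \forall z \near x, 0 < rho (phi c z).
  have nr : nbhs (phi c x) [set w : E | 0 < rho w].
    have cr : {for phi c x, continuous rho} by exact: rho_continuous.
    have nt : nbhs (rho (phi c x)) [set t | 0 < t].
      by apply: open_nbhs_nbhs; split=> //; exact: open_gt.
    exact: cr _ nt.
  have cphi : {for x, continuous (phi c)} by exact: phi_continuous.
  exact: cphi _ nr.
have [z [[cz [_ rz]] [_ rz']]] := clx _ (filterI n1 n2).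
by move: rz'; rewrite /= ltNge (ltW rz).
Qed.

(** [rho_regular] gives a nonzero differential in the chart [c]; if it vanished in another chart,
    the chain rule would make it vanish in [c]. *)
Lemma Omega_smooth_boundary x : closure Omega x -> ~ Omega x ->
  exists (U : set T) (f : T -> R),
    [/\ open U, U x, U `<=` minterior A, smooth_on A U f &
        (forall c', dom c' x -> differential f c' x != 0) /\
        (forall y, U y -> (Omega y <-> f y < 0))].
Proof.
move=> clx nOx; have [cx x0 rx] := Omega_boundary clx nOx.
pose U := [set z | dom c z /\ 0 < phi c z 0 0].
have oU : open U.
  rewrite openE => z [cz z0].
  have n1 : \forall z \near z, dom c z by exact: open_nbhs_nbhs (conj (dom_open hA c) cz).
  have n2 : \forall z \near z, 0 < phi c z 0 0.
    exact: (phi_continuous hA cz) _ (open_nbhs_nbhs (conj upper_half_open z0)).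
  by apply: filterS2 n1 n2.
have Uc : U `<=` dom c by move=> z [].
have Ux : U x by [].
have fS : smooth_on A U (fun z => rho (phi c z)).
  apply: (smooth_transfer hA oU Uc upper_half_open _ (rho_Cinfty lo hi e1 p)) => //.
  by move=> z [].
exists U, (fun z => rho (phi c z)); split=> //.
  by move=> z [cz z0]; exists c.
split=> [c' c'x|z [cz z0]]; last by split=> [[_ []]|].
apply/negP => /eqP d0.
have [i] := rho_regular lo0 lohi p0 x0 rx; apply/negP/negPn/eqP.
have dc := differential_pullback oU Ux Uc upper_half_open x0 (rho_Cinfty lo hi e1 p)
  (fun z _ => erefl).
have := differential_chain hA oU Ux fS cx c'x; rewrite d0 mul0mx dc.
by move/rowP => /(_ i); rewrite !mxE.
Qed.

(** * Boundedness of the domain for the distance of the metric *)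

Section bounded.
Variables (theta : R) (g : tensor A).
Hypothesis gm : riemannian_metric theta (minterior A) g.

Lemma minterior_psi y : K y -> chart_image c (minterior A) y.
Proof.
move=> Ky; have [d pK] := chart_psi (closed_box_chart Ky).
exists (psi c y) => //; split=> //; exists c => //.
by rewrite pK; exact: closed_box_pos.
Qed.

Lemma metric_bounded : exists2 M, 0 <= M &
  forall y, O y -> \sum_i \sum_j `|g c (psi c y) i j| <= M.
Proof.
have K0 : K !=set0.
  exists (base_point lo p); apply: sublevel_closed_box => //.
  exact: base_point_sublevel.
have cf : {within K, continuous (fun y => \sum_i \sum_j `|g c (psi c y) i j|)}.
  apply/subspace_continuousP => y Ky.
  have sub (f : E -> R) l : f @ within half_space (nbhs y) --> l ->
      f @ within K (nbhs y) --> l.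
    move=> fl S Sl.
    have H : \forall y \near within half_space (nbhs y), S (f y) := fl _ Sl.
    rewrite near_withinE in H; change (\forall z \near within K (nbhs y), S (f z)).
    rewrite near_withinE; apply: filterS H => z Hz Kz; apply: Hz.
    exact: ltW (closed_box_pos Kz).
  have FK : Filter (within K (nbhs y)) by exact: within_filter.
  apply: (@cvg_big _ _ _ _ _ (@add_continuous R) E (within K (nbhs y)) _
    (fun i z => \sum_j `|g c (psi c z) i j|) (fun i => \sum_j `|g c (psi c y) i j|)) => i _.
  apply: (@cvg_big _ _ _ _ _ (@add_continuous R) E (within K (nbhs y)) _
    (fun j z => `|g c (psi c z) i j|) (fun j => `|g c (psi c y) i j|)) => j _.
  apply: cvg_norm; apply: sub.
  exact: (metric_cvg hA gm minterior_open (minterior_psi Ky) (i := i) (j := j)).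
have [y _ yM] := EVT_max_rV K0 (@closed_box_compact _ _ lo hi e1 p) cf.
exists (\sum_i \sum_j `|g c (psi c y) i j|).
  by apply: sumr_ge0 => i _; exact: sumr_ge0.
move=> z Oz; apply: yM; rewrite inE; exact: sublevel_closed_box.
Qed.

(** [C1_curve] tests a curve in every chart and [speed] uses a chart that varies along it, so a
    straight line of the chart [c] has to be read in an arbitrary chart [c']. *)
Lemma chart_line_derive c' (y v : E) (t : R) : O (y + t *: v) ->
  dom c' (psi c (y + t *: v)) ->
  let gamma s := psi c (y + s *: v) in
  [/\ \forall s \near t, derivable (phi c' \o gamma) s 1,
      {for t, continuous (derive1 (phi c' \o gamma))} &
      derive1 (phi c' \o gamma) t = v *m Defs.jacobian c c' (gamma t)].
Proof.
move=> Ot c't gamma; have [d pK] := chart_psi (sublevel_chart Ot).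
have [W [F [oW Wy CF FE]]] := transition_ext hA d c't.
have cl : (y + s *: v) @[s --> t] --> y + t *: v.
  by apply: cvgD; [exact: cvg_cst|apply: cvgZr_tmp; exact: cvg_id].
rewrite pK in Wy.
have nWO : \forall s \near t, W (y + s *: v) /\ 0 < (y + s *: v) 0 0.
  have nE : nbhs (y + t *: v) (W `&` [set z : E | 0 < z 0 0]).
    apply: filterI; first exact: open_nbhs_nbhs.
    by apply: open_nbhs_nbhs; split; [exact: upper_half_open|case: Ot].
  exact: cl _ nE.
have FL s : W (y + s *: v) /\ 0 < (y + s *: v) 0 0 ->
    phi c' (gamma s) = \row_j F j (y + s *: v).
  by move=> [Ws hs]; have [_ ->] := FE _ Ws (ltW hs).
have nFL : \forall s \near t, \row_j F j (y + s *: v) = (phi c' \o gamma) s.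
  by apply: filterS nWO => s /FL.
have dl s : W (y + s *: v) -> derivable (fun s : R => \row_j F j (y + s *: v) : E) s 1.
  move=> Ws; apply/derivable_mxP => i j.
  have := @derive_line _ _ (F j) y v s.
  have -> : (fun x : R => (\row_j F j (y + x *: v) : E) i j) =
    (fun x : R => F j (y + x *: v)) by apply/funext => x; rewrite mxE.
  move=> D; apply: is_derive_ex (D _); apply: diff_derivable.
  exact: class_C_differentiable oW (CF j 1%N) Ws.
have dv s : W (y + s *: v) -> 'D_1 (fun s : R => \row_j F j (y + s *: v) : E) s =
    \row_j \sum_i v 0 i * 'D_(basis_vec i) (F j) (y + s *: v).
  move=> Ws; rewrite derive_mx; last exact: dl.
  apply/matrixP => i j; rewrite !mxE.
  have -> : (fun x : R => (\row_j F j (y + x *: v) : E) i j) =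
    (fun x : R => F j (y + x *: v)) by apply/funext => x; rewrite mxE.
  have dF : derivable (F j) (y + s *: v) v.
    by apply: diff_derivable; exact: class_C_differentiable oW (CF j 1%N) Ws.
  rewrite (is_derive_val (derive_line dF)).
  by rewrite (class_C_deriveE _ oW (CF j 1%N) Ws).
have nn : \forall s \near t, \forall u \near s, \row_j F j (y + u *: v) = (phi c' \o gamma) u.
  exact: nbhs_interior nFL.
have nd : \forall s \near t, \row_j (\sum_i v 0 i * 'D_(basis_vec i) (F j) (y + s *: v)) =
    derive1 (phi c' \o gamma) s.
  apply: filterS2 nn nWO => s ns [Ws _].
  by rewrite derive1E -(near_eq_derive _ ns) dv.
split.
- apply: filterS2 nn nWO => s ns [Ws _].
  exact: near_eq_derivable ns (dl _ Ws).
- apply: continuous_at_eq nd _; apply: row_continuous => j.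
  apply: continuous_at_sum => i.
  have cD : {for y + t *: v, continuous (fun z => 'D_(basis_vec i) (F j) z)}.
    exact: ((CF j 1%N).2 i).2 _ Wy.
  apply: cvgM; first exact: cvg_cst.
  exact: (@cvg_comp _ _ _ (fun s : R => y + s *: v)
    (fun z => 'D_(basis_vec i) (F j) z) _ _ _ cl cD).
- rewrite -(nbhs_singleton nd).
  have Wp : W (phi c (psi c (y + t *: v))) by rewrite pK.
  rewrite (jacobianE hA d oW Wp CF FE) pK; apply/rowP => j; rewrite !mxE.
  by apply: eq_bigr => i _; rewrite !mxE.
Qed.

(** Two points are joined by the image of a coordinate segment, which stays in the domain by
    convexity; its speed is bounded because the metric coefficients are. *)
Lemma Omega_bounded : exists D : R, forall x y, Omega x -> Omega y ->
  (rdist g x y <= D%:E)%E.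
Proof.
have [M M0 MP] := metric_bounded.
(* The coordinates of [v] are at most 2 e1, and [M] bounds the sum of the absolute values of the
   metric coefficients. *)
pose D := Num.sqrt (4 * e1 ^+ 2 * M); exists D => x z.
rewrite OmegaE => -[y Oy <-] [q Oq <-].
pose v := q - y; pose gamma t := psi c (y + t *: v).
have Ot t : 0 <= t <= 1 -> O (y + t *: v) by exact: sublevel_convex.
have vi i : `|v 0 i| <= 2 * e1.
  have le w : O w -> `|w 0 i - p 0 i| <= e1.
    move=> Ow; have Kw := sublevel_closed_box lo0 lohi e10 Ow.
    have [/andP[_ w1] wi] := Kw; have [->|i0] := eqVneq i 0; last exact: wi.
    by rewrite p0 subr0 gtr0_norm ?(closed_box_pos Kw)// (le_trans w1).
  have -> : v 0 i = (q 0 i - p 0 i) - (y 0 i - p 0 i) by rewrite !mxE; ring.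
  apply: (le_trans (ler_normB _ _)); have := le _ Oq; have := le _ Oy; lra.
have sp t : 0 <= t <= 1 -> speed g gamma t <= D.
  move=> t01; have Oyt := Ot _ t01.
  have [d pK] := chart_psi (sublevel_chart Oyt).
  have mi : minterior A (gamma t) by apply: Omega_minterior; exact: Omega_psi.
  have cc := dom_chart_at hA (gamma t).
  have [_ _ E1] := chart_line_derive Oyt cc.
  rewrite /speed E1 ler_wsqrtr//.
  have [_ _ _ gE] := gm.
  have -> : v *m Defs.jacobian c (chart_at A (gamma t)) (gamma t) *m
      g (chart_at A (gamma t)) (gamma t) *m
      (v *m Defs.jacobian c (chart_at A (gamma t)) (gamma t))^T =
      v *m g c (gamma t) *m v^T.
    by rewrite (gE c (chart_at A (gamma t)) (gamma t))// trmx_mul !mulmxA.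
  rewrite mxE; apply: (@le_trans _ _ (\sum_j \sum_i (2 * e1) ^+ 2 * `|g c (gamma t) i j|)).
    apply: ler_sum => j _; rewrite !mxE mulr_suml; apply: ler_sum => i _.
    apply: (le_trans (ler_norm _)); rewrite !normrM mulrAC expr2.
    have vii := vi i; apply: ler_wpM2r => //; apply: ler_pM => //.
    by have := vi j; rewrite !mxE.
  rewrite exchange_big/=; under eq_bigr do rewrite -mulr_sumr.
  rewrite -mulr_sumr exprMn -natrX; apply: ler_wpM2l; last exact: MP.
  by rewrite mulr_ge0// sqr_ge0.
apply: (@le_trans _ _ (curve_length g gamma)).
  apply: ereal_inf_lbound; exists gamma; split=> //.
  - move=> t t01; have Oyt := Ot _ t01; split.
    + by apply: Omega_minterior; exact: Omega_psi.
    + apply: (continuous_comp (f := fun t : R => y + t *: v) (g := psi c)).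
        exact: segment_continuous.
      exact: psi_continuous.
    + by move=> c' c'x; have [d1 d2 _] := chart_line_derive Oyt c'x.
  - by rewrite /gamma scale0r addr0.
  - by rewrite /gamma scale1r /v addrC subrK.
rewrite /curve_length.
apply: (@le_trans _ _ (\int[@lebesgue_measure R]_(t in `[0%R, 1%R]) (cst D%:E t))%E).
  apply: ge0_le_integral_on => t; rewrite /= in_itv/= => t01.
    by rewrite lee_fin sqrtr_ge0.
  by rewrite lee_fin sp.
rewrite integral_cst//= lebesgue_measure_itv/= lte_fin ltr01.
by rewrite -EFinD subr0 mule1.
Qed.

Lemma Omega_smooth_bounded_domain : smooth_bounded_domain g Omega.
Proof.
split; [split|exact: Omega_minterior|exact: Omega_bounded|].
- exact: Omega_nonempty.
- exact: Omega_open.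
- exact: Omega_connected.
- by move=> x _; exact: Omega_smooth_boundary.
Qed.

End bounded.
End omega.

(** * Volume of slabs *)

Section borel.
Context {R : realType} {T : ptopologicalType}.

Lemma borel_open (U : set T) : open U -> measurable (U : set (borel T)).
Proof. by move=> oU; exact: sub_sigma_algebra. Qed.

Lemma continuous_on_measurable (D : set T) (f : T -> R) : open D ->
  (forall x, D x -> {for x, continuous f}) ->
  measurable_fun (D : set (borel T)) (f : borel T -> R).
Proof.
move=> oD cf; apply: (measurability _ (RGenOpens.measurableE R)).
move=> _ [_ [a [b ->] <-]].
suff oDf : open (D `&` f @^-1` `]a, b[) by exact: borel_open oDf.
rewrite openE => x [Dx fx]; apply: filterI; first exact: open_nbhs_nbhs.
apply: cf => //; apply: open_nbhs_nbhs; split=> //; exact: interval_open.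
Qed.

End borel.

Section volume.
Context {R : realType} {n : nat} {T : ptopologicalType}.
Variable A : atlas R n T.
Hypothesis hA : compact_manifold_with_boundary A.
Local Notation E := 'rV[R]_n.+1.
Variables (g : tensor A) (vol : {measure set (borel T) -> \bar R}).
Hypothesis gvol : riemannian_volume g vol.
Variable c : idx A.

Definition chart_box (J : 'I_n.+1 -> set R) : set T :=
  [set x | dom c x /\ forall i, J i (phi c x 0 i)].

Lemma coord_measurable i :
  measurable_fun (dom c : set (borel T)) (fun x : borel T => phi c x 0 i).
Proof.
apply: (continuous_on_measurable (dom_open hA c)) => x cx.
apply: (continuous_comp (f := phi c) (g := fun y : E => y 0 i)).
  exact: phi_continuous.
exact: coord_continuous.
Qed.

Lemma chart_box_measurable (J : 'I_n.+1 -> set R) :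
  (forall i, measurable (J i : set (measurableTypeR R))) ->
  measurable (chart_box J : set (borel T)).
Proof.
move=> mJ.
have -> : chart_box J = \bigcap_(i in [set: 'I_n.+1])
    (dom c `&` (fun x => phi c x 0 i) @^-1` J i).
  apply/seteqP; split=> [x [cx xJ] i _|x xJ]; first by split.
  by split=> [|i]; [have [] := xJ 0 I|have [] := xJ i I].
apply: fin_bigcap_measurable => // i _.
by apply: coord_measurable; [exact: borel_open (dom_open hA c)|exact: mJ].
Qed.

(** The volume density is squeezed between two constants, the only integrands over a box that have
    to be integrated exactly. *)
Lemma vol_chart_box (J : 'I_n.+1 -> set R) (l : 'I_n.+1 -> R) (D1 D2 : R) :
  (forall i, measurable (J i : set (measurableTypeR R))) ->
  (forall i, lebesgue_measure (J i) = (l i)%:E) ->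
  (forall t, J 0 t -> 0 < t) ->
  0 <= D1 -> 0 <= D2 ->
  (forall y, box J y -> chart_image c setT y /\
     D1 <= Num.sqrt (\det (g c (psi c y))) <= D2) ->
  ((D1 * \prod_i l i)%:E <= vol (chart_box J) <= (D2 * \prod_i l i)%:E)%E.
Proof.
move=> mJ lJ J0 D10 D20 HJ.
have sub : chart_box J `<=` dom c `&` minterior A.
  by move=> x [cx xJ]; split=> //; exists c => //; exact: J0 (xJ 0).
rewrite (gvol (chart_box_measurable mJ) sub).
have -> : phi c @` chart_box J = box J.
  apply/seteqP; split=> [_ [x [cx xJ] <-] //|y yJ].
  have [/(chart_imageP hA)[d _ pK _] _] := HJ y yJ.
  by exists (psi c y) => //; split=> //; rewrite pK.
rewrite -(lebesgue_int_box D10 mJ lJ) -(lebesgue_int_box D20 mJ lJ).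
apply/andP; split; apply: le_lebesgue_int => y.
- by rewrite lee_fin mulr_ge0.
- rewrite lee_fin indicE; case: (boolP (y \in box J)); rewrite ?mul0r// inE => yJ.
  by rewrite !mul1r; have [_ /andP[]] := HJ y yJ.
- by rewrite lee_fin mulr_ge0// sqrtr_ge0.
- rewrite lee_fin indicE; case: (boolP (y \in box J)); rewrite ?mul0r// inE => yJ.
  by rewrite !mul1r; have [_ /andP[]] := HJ y yJ.
Qed.

Variables (p : E) (e m1 m2 : R).
Hypotheses (m10 : 0 < m1) (m20 : 0 <= m2).
Hypothesis hE : forall y : E, (forall i, `|y 0 i - p 0 i| < e) -> 0 < y 0 0 ->
  chart_image c setT y /\
  m1 <= y 0 0 ^+ n.+1 * Num.sqrt (\det (g c (psi c y))) <= m2.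
Hypothesis p0 : p 0 0 = 0.

(** Half-open in y_0, so that consecutive dyadic slabs are disjoint and their union is again a
    slab. *)
Definition slab_side (s t L : R) (i : 'I_n.+1) : set R :=
  if i == 0 then `[s, t[%classic else `[p 0 i - L, p 0 i + L]%classic.

Definition slab (s t L : R) : set T := chart_box (slab_side s t L).

(* On a slab, y_0^n dv is comparable to dy_0 / y_0 times Lebesgue measure. *)
Definition weight (x : T) : \bar R := (phi c x 0 0 ^+ n)%:E.

Definition nu (B : set T) : \bar R :=
  (\int[vol]_(x in (B : set (borel T))) weight x)%E.

Lemma slabP s t L x : slab s t L x <-> [/\ dom c x, s <= phi c x 0 0 < t &
  forall i, i != 0 -> `|phi c x 0 i - p 0 i| <= L].
Proof.
rewrite /slab /chart_box; split=> [[cx H]|[cx H0 HL]].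
  split=> //; first by have := H 0; rewrite /slab_side eqxx /= in_itv.
  by move=> i i0; have := H i; rewrite /slab_side (negbTE i0)/= in_itv/= -ler_distl.
split=> // i; rewrite /slab_side; case: eqVneq => [->|i0]; rewrite /= in_itv//= -ler_distl.
exact: HL.
Qed.

Lemma slab_side_measurable s t L i :
  measurable (slab_side s t L i : set (measurableTypeR R)).
Proof. by rewrite /slab_side; case: ifP => _; exact: measurable_itv. Qed.

Lemma slab_measurable s t L : measurable (slab s t L : set (borel T)).
Proof. by apply: chart_box_measurable => i; exact: slab_side_measurable. Qed.

Lemma slab_dom s t L : slab s t L `<=` dom c.
Proof. by move=> x /slabP[]. Qed.

Lemma weight_measurable (B : set T) : measurable (B : set (borel T)) ->
  B `<=` dom c ->
  measurable_fun (B : set (borel T)) (weight : borel T -> \bar R).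
Proof.
move=> mB Bc; apply/measurable_EFinP.
apply: (measurable_funS (E := (dom c : set (borel T)))) => //.
  exact: borel_open (dom_open hA c).
by apply: measurable_funX; exact: coord_measurable.
Qed.

Lemma weight_ge0 x : dom c x -> (0 <= weight x)%E.
Proof. by move=> cx; rewrite lee_fin exprn_ge0//; exact: phi_half. Qed.

(** The powers of [s] cancel: the weight lies between s^n and (2 s)^n, the density between m1 / (2
    s)^(n+1) and m2 / s^(n+1), and the coordinate volume is s (2 L)^n. Thus the mass does not depend
    on the height of the slab. *)
Lemma nu_dyadic (s L : R) : 0 < s -> 0 <= L -> 2 * s <= e -> L < e ->
  ((m1 * L ^+ n / 2)%:E <= nu (slab s (2 * s) L) <= (m2 * 4 ^+ n * L ^+ n)%:E)%E.
Proof.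
move=> s0 L0 se Le.
pose J := slab_side s (2 * s) L.
pose l (i : 'I_n.+1) := if i == 0 then s else 2 * L.
have lJ i : lebesgue_measure (J i) = (l i)%:E.
  rewrite /J /slab_side /l; case: ifP => _; rewrite lebesgue_measure_itv/= lte_fin.
    rewrite ltr_pMl// ltr1n; congr (_%:E); ring.
  (* The second case is a degenerate side: it forces L = 0, and the length 0 is still 2 L. *)
  case: ltP => H; first by congr (_%:E); ring.
  by congr (_%:E); move: H; lra.
have J0 t : J 0 t -> 0 < t.
  by rewrite /J /slab_side eqxx /= in_itv/= => /andP[+ _]; exact: lt_le_trans.
have s1 : 0 < s ^+ n.+1 by rewrite exprn_gt0.
have s2 : 0 < (2 * s) ^+ n.+1 by rewrite exprn_gt0// mulr_gt0.
have bJ y : box J y -> chart_image c setT y /\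
    m1 / (2 * s) ^+ n.+1 <= Num.sqrt (\det (g c (psi c y))) <= m2 / s ^+ n.+1.
  move=> yJ; have := yJ 0; rewrite /J /slab_side eqxx /= in_itv/= => /andP[y1 y2].
  have y0 : 0 < y 0 0 by exact: lt_le_trans y1.
  have [|//|Vy /andP[h1 h2]] := hE (y := y).
    move=> i; have [->|i0] := eqVneq i 0.
      by rewrite p0 subr0 gtr0_norm// (lt_le_trans y2).
    have := yJ i; rewrite /J /slab_side (negbTE i0) /= in_itv/= -ler_distl => yi.
    exact: le_lt_trans Le.
  split=> //; set d := Num.sqrt _ in h1 h2 *.
  have d0 : 0 <= d by exact: sqrtr_ge0.
  rewrite ler_pdivrMr// ler_pdivlMr//; apply/andP; split.
    apply: (le_trans h1); rewrite mulrC ler_wpM2l// lerXn2r ?nnegrE ?(ltW y0) ?(ltW y2)//.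
    by rewrite mulr_ge0// ltW.
  apply: le_trans h2; rewrite mulrC ler_wpM2r// lerXn2r ?nnegrE ?(ltW y0)//.
  exact: ltW.
have prodl : \prod_i l i = s * (2 * L) ^+ n.
  rewrite big_ord_recl /l eqxx; congr (_ * _).
  by rewrite (eq_bigr (fun=> 2 * L))// prodr_const card_ord.
have D1p : 0 <= m1 / (2 * s) ^+ n.+1 by rewrite divr_ge0 ?(ltW m10) ?(ltW s2).
have D2p : 0 <= m2 / s ^+ n.+1 by rewrite divr_ge0 ?(ltW s1).
have := vol_chart_box (slab_side_measurable s (2 * s) L) lJ J0 D1p D2p bJ.
rewrite prodl => /andP[v1 v2].
have msl := slab_measurable s (2 * s) L.
have w1 : (\int[vol]_(x in (slab s (2 * s) L : set (borel T))) (cst (s ^+ n)%:E x)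
    <= nu (slab s (2 * s) L))%E.
  apply: ge0_le_integral_on => x /slabP[cx /andP[x1 x2] _].
    by rewrite lee_fin exprn_ge0// ltW.
  by rewrite lee_fin lerXn2r ?nnegrE ?(ltW s0)// (le_trans (ltW s0)).
have w2 : (nu (slab s (2 * s) L) <=
    \int[vol]_(x in (slab s (2 * s) L : set (borel T))) (cst ((2 * s) ^+ n)%:E x))%E.
  apply: ge0_le_integral_on => x /slabP[cx /andP[x1 x2] _].
    exact: weight_ge0.
  rewrite lee_fin lerXn2r ?nnegrE//; [exact: phi_half|by rewrite mulr_ge0 ?ltW|exact: ltW].
rewrite integral_cst// in w1; rewrite integral_cst// in w2.
have sn0 : 0 < s ^+ n by rewrite exprn_gt0.
have en (x : R) : x ^+ n.+1 = x * x ^+ n by rewrite exprS.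
apply/andP; split.
  apply: le_trans w1; apply: le_trans (lee_wpmul2l _ v1); last by rewrite lee_fin ltW.
  rewrite -EFinM lee_fin le_eqVlt; apply/orP; left; apply/eqP.
  rewrite !exprMn !en; field; rewrite ?gt_eqF ?exprn_gt0//.
apply: (le_trans w2); apply: (le_trans (lee_wpmul2l _ v2)).
  by rewrite lee_fin exprn_ge0// mulr_ge0// ltW.
rewrite -EFinM lee_fin le_eqVlt; apply/orP; left; apply/eqP.
have -> : (4 : R) = 2 * 2 by ring.
rewrite !exprMn !en; field; rewrite ?gt_eqF//.
Qed.

(** Each step of the induction adds one dyadic slab at the bottom. *)
Lemma nu_slabs (N : nat) (t L : R) : 0 < t -> 0 <= L -> t <= e -> L < e ->
  ((N%:R * (m1 * L ^+ n / 2))%:E <= nu (slab (t / 2 ^+ N) t L) <=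
   (N%:R * (m2 * 4 ^+ n * L ^+ n))%:E)%E.
Proof.
move=> t0 L0 te Le; elim: N => [|N /andP[IH1 IH2]].
  rewrite expr0 divr1 !mul0r.
  have -> : slab t t L = set0.
    apply/seteqP; split=> x // /slabP[_ /andP[x1 x2] _].
    by have := le_lt_trans x1 x2; rewrite ltxx.
  by rewrite /nu integral_set0 lexx.
pose s := t / 2 ^+ N.+1.
have s0 : 0 < s by rewrite divr_gt0// exprn_gt0.
have s2 : 2 * s = t / 2 ^+ N by rewrite /s exprS; field; rewrite gt_eqF// exprn_gt0.
have st : t / 2 ^+ N <= t.
  by rewrite ler_pdivrMr ?exprn_gt0// ler_peMr ?(ltW t0)// exprn_ege1// ler1n.
have sle : s <= t / 2 ^+ N by rewrite -s2 ler_peMl ?(ltW s0)// ler1n.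
have -> : slab (t / 2 ^+ N.+1) t L = slab s (2 * s) L `|` slab (t / 2 ^+ N) t L.
  apply/seteqP; split=> [x /slabP[cx /andP[x1 x2] xL]|x [] /slabP[cx /andP[x1 x2] xL]].
  - have [xs|xs] := ltP (phi c x 0 0) (t / 2 ^+ N).
      by left; apply/slabP; split=> //; rewrite x1 s2.
    by right; apply/slabP; split=> //; rewrite xs.
  - apply/slabP; split=> //; rewrite x1/= (lt_le_trans x2)// s2//.
  - by apply/slabP; split=> //; rewrite x2 andbT (le_trans sle).
have disj : [disjoint (slab s (2 * s) L : set (borel T)) & slab (t / 2 ^+ N) t L].
  apply/disj_setPS => x [/slabP[_ /andP[_ x1] _] /slabP[_ /andP[x2 _] _]].
  by rewrite s2 in x1; have := lt_le_trans x1 x2; rewrite ltxx.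
have s2e : 2 * s <= e by rewrite s2 (le_trans st).
have /andP[D1 D2] := nu_dyadic s0 L0 s2e Le.
rewrite {1 2}/nu ge0_integral_setU//; last 4 first.
- exact: slab_measurable.
- exact: slab_measurable.
- apply: weight_measurable; first by apply: measurableU; exact: slab_measurable.
  by move=> x [] /slab_dom.
- by move=> x [] /slab_dom; exact: weight_ge0.
have e1 (a : R) : N.+1%:R * a = a + N%:R * a by rewrite -[N.+1]add1n natrD mulrDl mul1r.
by rewrite !e1 !EFinD !leeD.
Qed.

End volume.

Lemma pigeonhole_increment {R : realType} (x : nat -> R) (M : nat) (a : R) :
  (0 < M)%N -> x M - x 0%N <= a -> exists2 i, (i < M)%N & x i.+1 - x i <= a / M%:R.
Proof.
move=> M0 xa; apply: contrapT => H.
have M0' : 0 < M%:R :> R by rewrite ltr0n.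
suff : a < x M - x 0%N by rewrite ltNge xa.
rewrite -(telescope_sumr x)//.
have -> : a = \sum_(0 <= i < M) a / M%:R.
  by rewrite big_const_nat subn0 iter_addr_0 -[RHS]mulr_natr divfK ?gt_eqF.
apply: ltr_sum_nat => // i /andP[_ iM].
by rewrite ltNge; apply/negP => xi; apply: H; exists i.
Qed.

(** * The test function *)

Section measure_lemmas.
Local Open Scope ereal_scope.
Context {R : realType}.

(** [F] is dominated by the measurable function equal to K q on [B] and to C q on the rest of [S].
    In the applications [B] is the core and [S] the support; for the energy, [K] is the sharp
    constant and [C] a crude one paid only on the shell. *)
Lemma split_integral_le d (X : measurableType d) (mu : {measure set X -> \bar R})
    (D B S : set X) (F q : X -> \bar R) (K C : R) :
  measurable B -> measurable S -> B `<=` S -> measurable_fun S q ->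
  (forall x, S x -> 0 <= q x) -> (0 <= K)%R -> (0 <= C)%R ->
  (forall x, D x -> 0 <= F x) ->
  (forall x, D x -> B x -> F x <= K%:E * q x) ->
  (forall x, D x -> S x -> F x <= C%:E * q x) ->
  (forall x, D x -> ~ S x -> F x = 0) ->
  \int[mu]_(x in D) F x <=
    K%:E * \int[mu]_(x in B) q x + C%:E * \int[mu]_(x in S `\` B) q x.
Proof.
move=> mB mS BS mq q0 K0 C0 F0 FB FS Fout.
pose h x := if x \in B then K%:E * q x else C%:E * q x.
have mSB : measurable (S `\` B) by exact: measurableD.
have BE : {in B, h =1 (fun x => K%:E * q x)} by move=> x xB; rewrite /h xB.
have SBE : {in S `\` B, h =1 (fun x => C%:E * q x)}.
  by move=> x; rewrite inE => -[_ nB]; rewrite /h memNset.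
have qB : measurable_fun B q by exact: measurable_funS mq.
have qSB : measurable_fun (S `\` B) q by apply: measurable_funS mq => // x [].
have hB : measurable_fun B h.
  by apply: eq_measurable_fun (measurable_funeM K%:E qB) => x xB; rewrite BE.
have hSB : measurable_fun (S `\` B) h.
  by apply: eq_measurable_fun (measurable_funeM C%:E qSB) => x xB; rewrite SBE.
have h0 x : S x -> 0 <= h x.
  by move=> Sx; rewrite /h; case: ifP => _; apply: mule_ge0; rewrite ?lee_fin ?q0.
apply: (@le_trans _ _ (\int[mu]_(x in S) h x)).
  rewrite integral_mkcond [leRHS]integral_mkcond; apply: ge0_le_integralT.
    exact: erestrict_ge0.
  move=> x; rewrite /patch; case: ifPn => xD; last first.
    by case: ifPn => // /set_mem; exact: h0.
  move/set_mem: xD => Dx; case: ifPn => xS; last first.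
    by rewrite Fout// => Sx; move: xS; rewrite mem_set.
  rewrite /h; case: ifPn => [/set_mem xB|_]; first exact: FB.
  by apply: FS => //; exact: set_mem xS.
have US : B `|` (S `\` B) = S by rewrite setDUK.
rewrite -{1}US ge0_integral_setU//; last 3 first.
- by apply/measurable_funU.
- by move=> x; rewrite US; exact: h0.
- by rewrite disj_set2E setDIK.
rewrite (eq_integral _ _ BE) (eq_integral _ _ SBE) leeD//.
  by rewrite ge0_integralZl_EFin// => x Bx; exact/q0/BS.
by rewrite ge0_integralZl_EFin// => x [Sx _]; exact: q0.
Qed.

Lemma quotient_le (N D : \bar R) (u r : R) :
  (0 <= u)%R -> (0 < r)%R -> N <= u%:E -> r%:E <= D -> D < +oo ->
  N / D <= (u / r)%:E.
Proof.
move=> u0 r0 Nu rD Doo.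
case: D rD Doo => [s| |]//; rewrite lee_fin => rs _.
have s0 : (0 < s)%R by exact: lt_le_trans rs.
rewrite inver gt_eqF// lee_pdivrMr// (le_trans Nu)// -EFinM lee_fin.
by rewrite -[leLHS](divfK (lt0r_neq0 r0)) ler_wpM2l// divr_ge0// ltW.
Qed.

End measure_lemmas.

Section smooth_functions.
Context {R : realType} {n : nat} {T : ptopologicalType}.
Variable A : atlas R n T.
Hypothesis hA : compact_manifold_with_boundary A.
Local Notation E := 'rV[R]_n.+1.

Lemma smooth_on_continuous U (f : T -> R) : open U -> smooth_on A U f ->
  forall x, U x -> {for x, continuous f}.
Proof.
move=> oU fS x Ux; pose c := chart_at A x; have cx : dom c x by exact: dom_chart_at.
have Uy : chart_image c U (phi c x) by exists x.
have [W [G [oW Wx CG GE]]] := fS c _ Uy.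
have cG : {for phi c x, continuous G} by exact: (CG 0%N).
have cphi : {for x, continuous (phi c)} by exact: phi_continuous.
apply: continuous_at_eq (continuous_comp cphi cG).
have n1 : \forall z \near x, dom c z by exact: open_nbhs_nbhs (conj (dom_open hA c) cx).
have n2 : \forall z \near x, U z by exact: open_nbhs_nbhs.
have n3 : \forall z \near x, W (phi c z) by exact: cphi _ (open_nbhs_nbhs (conj oW Wx)).
near=> z; have cz : dom c z by near: z.
rewrite /= GE/= ?psiK//; first by near: z.
by exists z => //; split=> //; near: z.
Unshelve. all: by end_near. Qed.

Lemma smooth_measurable_cofield U (f : T -> R) : open U -> smooth_on A U f ->
  measurable_cofield U (differential f : cofield A).
Proof.
move=> oU fS; split=> [c j|c c' x cx c'x Ux]; last exact: differential_chain oU Ux fS cx c'x.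
apply: continuous_on_measurable; first exact: openI (dom_open hA c) oU.
move=> x [cx Ux].
have Uy : chart_image c U (phi c x) by exists x.
have [W [G [oW Wx CG GE]]] := fS c _ Uy.
have cD : {for phi c x, continuous (fun z => 'D_(basis_vec j) G z)}.
  exact: ((CG 1%N).2 j).2 _ Wx.
have cphi : {for x, continuous (phi c)} by exact: phi_continuous.
apply: continuous_at_eq (continuous_comp cphi cD).
have n1 : \forall z \near x, dom c z by exact: open_nbhs_nbhs (conj (dom_open hA c) cx).
have n2 : \forall z \near x, U z by exact: open_nbhs_nbhs.
have n3 : \forall z \near x, W (phi c z) by exact: cphi _ (open_nbhs_nbhs (conj oW Wx)).
near=> z; have cz : dom c z by near: z.
have Uz : U z by near: z.
have Wz : W (phi c z) by near: z.
rewrite /= mxE; apply/esym/rpartialE; first exact: phi_half.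
  have Uyz : chart_image c U (phi c z) by exists z.
  apply: filterS2 (chart_image_near hA oU Uyz) (open_nbhs_nbhs (conj oW Wz)).
  by move=> w Uw Ww hw; apply: GE => //; exact: Uw.
exact: (((CG 1%N).2 j).1 _ Wz).
Unshelve. all: by end_near. Qed.

End smooth_functions.

Lemma quadratic_form_scale {R : realType} m (t : R) (d : 'I_m -> R) (H : 'M[R]_m) :
  t ^+ 2 * (\sum_j (\sum_i d i * H i j) * d j) =
  \sum_j \sum_i (d i * t) * (d j * t) * H i j.
Proof.
rewrite mulr_sumr; apply: eq_bigr => j _; rewrite mulr_suml mulr_sumr.
by apply: eq_bigr => i _; ring.
Qed.

Lemma triple_product_le {R : realType} (x y h B K : R) :
  `|x| <= B -> `|y| <= B -> `|h| <= K -> x * y * h <= B * B * K.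
Proof.
move=> xB yB hK; apply: (le_trans (ler_norm _)); rewrite !normrM.
by apply: ler_pM => //; exact: ler_pM.
Qed.

Lemma sum_const_square {R : realType} m (s P Kb : R) : 0 <= Kb ->
  (m%:R * s * Num.sqrt Kb * P) ^+ 2 = \sum_(j < m) \sum_(i < m) s * P * (s * P) * Kb.
Proof.
move=> Kb0; rewrite !sumr_const card_ord -[RHS]mulr_natl -[X in _ = _ * X]mulr_natl.
by rewrite -[X in _ = _ * (_ * (_ * X))](sqr_sqrtr Kb0); ring.
Qed.

Section test_function.
Context {R : realType} {n : nat} {T : ptopologicalType}.
Variable A : atlas R n T.
Hypothesis hA : compact_manifold_with_boundary A.
Local Notation E := 'rV[R]_n.+1.
Variables (theta : R) (g : tensor A) (vol : {measure set (borel T) -> \bar R}).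
Hypothesis gm : riemannian_metric theta (minterior A) g.
Variable c : idx A.
Variables (a b L dl e1 q : R) (p : E).
Hypotheses (a0 : 0 < a) (ab : a < b) (dl0 : 0 < dl) (e10 : 0 < e1) (q1 : 1 < q).
(** The first condition is that of [profile_derive_bound]. The second is 4 hi <= e1 for hi = 2 b and
    keeps the domain in the coordinate cube; the bound on L + dl is that of [support_sublevel] and
    keeps the support in the domain. *)
Hypotheses (b_dl : 2 * b <= dl) (b_e1 : 8 * b <= e1).
Hypothesis L_e1 : L + dl <= e1 / (2 * n.+1%:R).
Hypothesis p0 : p 0 0 = 0.
Hypothesis hV : forall y : E, (forall i, `|y 0 i - p 0 i| <= e1) -> 0 < y 0 0 ->
  chart_image c setT y.
Variables (k2 Kb : R).
Hypotheses (k20 : 0 <= k2) (Kb0 : 0 <= Kb).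
Hypothesis hH : forall y : E, (forall i, `|y 0 i - p 0 i| <= e1) -> 0 < y 0 0 ->
  exists H : 'M[R]_n.+1, [/\ H 0 0 <= k2, forall i j, `|H i j| <= Kb &
     forall w : cofield A, conorm2 g w c (psi c y) =
       y 0 0 ^+ 2 * (w c (psi c y) *m H *m (w c (psi c y))^T) 0 0].
Variable Ks : R.
Hypothesis Ks0 : 0 <= Ks.
Hypothesis stepK : forall t : R, exists2 d, is_derive t 1 (@step R) d &
  [/\ `|d| <= Ks, t <= 0 -> d = 0 & 1 <= t -> d = 0].

Let al : R := n%:R / q.
Let lo : R := a / 2.
Let hi : R := 2 * b.
Let b0 : 0 < b. Proof. exact: lt_trans ab. Qed.
Let q0 : 0 < q. Proof. exact: lt_trans q1. Qed.
Let al0 : 0 <= al. Proof. by rewrite divr_ge0// ltW. Qed.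
Let lo0 : 0 < lo. Proof. by rewrite divr_gt0. Qed.
Let lohi : lo < hi.
Proof. by rewrite /lo /hi; move: a0 ab; lra. Qed.
Let hie : 4 * hi <= e1. Proof. by rewrite /hi mulrA -natrM. Qed.

Local Notation Om := (Omega c lo hi e1 p).
Local Notation prof := (profile al a b L dl p).
Local Notation core := (slab c p a b L).
Local Notation supp := (slab c p lo hi (L + dl)).

(** Set to 0 off the domain by hand, because the values of [phi c] outside [dom c] carry no
    meaning. *)
Definition test_fun (x : T) : R := if x \in Om then prof (phi c x) else 0.

(** The support box with its upper face added: its image is the compact set that [test_function]
    asks for. *)
Let hull : set E := [set y | lo <= y 0 0 <= hi /\
  forall i, i != 0 -> `|y 0 i - p 0 i| <= L + dl].

Lemma hull_sublevel y : hull y -> sublevel lo hi e1 p y.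
Proof.
move=> [y0 yi]; apply: support_sublevel => // i i0.
by rewrite (le_trans (yi i i0)).
Qed.

Lemma hull_compact : compact hull.
Proof. exact: coord_box_compact. Qed.

Lemma support_hull y : support_box a b L dl p y -> hull y.
Proof. by move=> [/andP[y1 y2] yi]; split=> //; rewrite y1 ltW. Qed.

Let OmO : open Om. Proof. exact: Omega_open. Qed.

Lemma test_funE x : Om x -> test_fun x = prof (phi c x).
Proof. by move=> Ox; rewrite /test_fun mem_set. Qed.

Lemma prof_Cinfty : Cinfty [set y : E | 0 < y 0 0] prof.
Proof. by move=> k; exact: profile_class_C. Qed.

Lemma test_fun_smooth : smooth_on A Om test_fun.
Proof.
have Oc : Om `<=` dom c by move=> x [].
have Op x : Om x -> 0 < phi c x 0 0 by move=> [_ []].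
exact: (smooth_transfer hA OmO Oc upper_half_open Op prof_Cinfty test_funE).
Qed.

Lemma test_fun_test : test_function A Om test_fun.
Proof.
split; first exact: test_fun_smooth.
exists (psi c @` hull); split.
- apply: continuous_compact; last exact: hull_compact.
  have hc : hull `<=` chart_image c setT.
    by move=> y /hull_sublevel Oy; exact: (sublevel_chart lo0 lohi e10 hie p0 hV).
  have := @psi_continuous_within _ _ _ _ hA c.
  exact: continuous_subspaceW hc.
- by move=> _ [y /hull_sublevel Oy <-]; apply: Omega_psi.
- move=> x Kx; rewrite /test_fun; case: ifPn => // /set_mem Ox.
  apply: profile_out => // /support_hull hx; apply: Kx.
  by exists (phi c x) => //; case: Ox => cx _; exact: psiK.
Qed.

Lemma test_fun_differential x : Om x ->
  differential test_fun c x = \row_i 'D_(basis_vec i) prof (phi c x).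
Proof.
move=> Ox; have [cx [x0 _]] := Ox.
have Oc : Om `<=` dom c by move=> z [].
exact: (differential_pullback hA OmO Ox Oc upper_half_open x0 prof_Cinfty test_funE).
Qed.

Lemma Omega_near x : Om x -> forall i, `|phi c x 0 i - p 0 i| <= e1.
Proof.
move=> [cx Ox] i; have Kx := sublevel_closed_box lo0 lohi e10 Ox.
have [/andP[_ x1] xi] := Kx; have [->|i0] := eqVneq i 0; last exact: xi.
by rewrite p0 subr0 gtr0_norm ?(le_trans x1)//; case: Ox.
Qed.

Lemma test_fun_conorm2 x : Om x -> exists H : 'M[R]_n.+1,
  [/\ H 0 0 <= k2, forall i j, `|H i j| <= Kb &
   conorm2 g (differential test_fun) (chart_at A x) x = phi c x 0 0 ^+ 2 *
   \sum_j (\sum_i 'D_(basis_vec i) prof (phi c x) * H i j) * 'D_(basis_vec j) prof (phi c x)].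
Proof.
move=> Ox; have [cx [x0 _]] := Ox.
have [H [H1 H2 H3]] := hH (Omega_near Ox) x0; exists H; split=> //.
have mi : minterior A x by exists c.
rewrite (conorm2_chart gm _ cx mi); [|exact: dom_chart_at|]; last first.
  exact: (differential_chain hA OmO Ox test_fun_smooth (dom_chart_at hA x) cx).
have := H3 (differential test_fun); rewrite psiK// => ->; congr (_ * _).
rewrite test_fun_differential// mxE; apply: eq_bigr => j _; rewrite !mxE.
by congr (_ * _); apply: eq_bigr => i _; rewrite mxE.
Qed.

(** The root of a quadratic form with (n + 1)^2 coefficients of size at most [Kb], in a vector whose
    entries are at most (al + 4 Ks) t^al. It involves none of [a], [b], [L], [dl]. *)
Let C : R := n.+1%:R * (al + 4 * Ks) * Num.sqrt Kb.

Let C0 : 0 <= C.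
Proof.
have K4 : 0 <= al + 4 * Ks by apply: addr_ge0 => //; exact: mulr_ge0.
by apply: mulr_ge0 (sqrtr_ge0 _); exact: mulr_ge0.
Qed.

Let dprof_bound i (y : E) : 0 < y 0 0 ->
  `|'D_(basis_vec i) prof y| * y 0 0 <= (al + 4 * Ks) * y 0 0 `^ al.
Proof.
exact: (profile_derive_bound L p al0 a0 ab dl0 b_dl Ks0 stepK).
Qed.

Lemma conorm_le x : Om x ->
  conorm g (differential test_fun) x <= C * phi c x 0 0 `^ al.
Proof.
move=> Ox; have [cx [x0 _]] := Ox.
have [H [_ HK HE]] := test_fun_conorm2 Ox.
set t := phi c x 0 0 in x0 HE *.
have P0 : 0 <= t `^ al by exact: powR_ge0.
have CP0 : 0 <= C * t `^ al by exact: mulr_ge0 C0 P0.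
rewrite -[leRHS]ger0_norm// -sqrtr_sqr /conorm HE ler_wsqrtr//.
pose B := (al + 4 * Ks) * t `^ al.
pose d i := 'D_(basis_vec i) prof (phi c x).
have dB i : `|d i * t| <= B.
  by rewrite normrM [X in _ * X]gtr0_norm//; exact: dprof_bound.
have -> : t ^+ 2 * (\sum_j (\sum_i d i * H i j) * d j) =
    \sum_j \sum_i (d i * t) * (d j * t) * H i j.
  exact: quadratic_form_scale.
have -> : (C * t `^ al) ^+ 2 = \sum_(j < n.+1) \sum_(i < n.+1) B * B * Kb.
  exact: sum_const_square.
apply: ler_sum => j _; apply: ler_sum => i _.
exact: triple_product_le.
Qed.

Lemma core_box_slab x : core x -> core_box a b L p (phi c x).
Proof. by move=> /slabP[_ /andP[x1 x2] xL]; split=> //; rewrite x1 ltW. Qed.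

Lemma core_supp : core `<=` supp.
Proof.
move=> x /slabP[cx /andP[x1 x2] xL]; apply/slabP; split=> // [|i i0].
  rewrite (le_trans _ x1) ?(lt_trans x2)//; first by rewrite /hi ltr_pMl// ltr1n.
  by rewrite /lo ler_pdivrMr// ler_peMr ?ler1n// ltW.
by rewrite (le_trans (xL i i0))// lerDl ltW.
Qed.

Lemma supp_Om : supp `<=` Om.
Proof.
move=> x /slabP[cx /andP[x1 x2] xL]; split=> //; apply: hull_sublevel.
by split=> //; rewrite x1 ltW.
Qed.

Lemma not_supp_box x : Om x -> ~ supp x -> ~ support_box a b L dl p (phi c x).
Proof. by move=> [cx _] nS [y0 yi]; apply: nS; apply/slabP. Qed.

(** On the core only the 0-th partial derivative survives, and y_0 times it is al y_0^al. So the
    single coefficient [H 0 0], the one close to kappa^2, enters and the constant is sharp. *)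
Lemma conorm_core x : core x ->
  conorm g (differential test_fun) x <= Num.sqrt k2 * al * phi c x 0 0 `^ al.
Proof.
move=> Cx; have Ox := supp_Om (core_supp Cx); have [cx [x0 _]] := Ox.
have [H [HK _ HE]] := test_fun_conorm2 Ox.
have dE i := profile_derive_core al0 a0 ab dl0 Ks0 stepK i x0 (core_box_slab Cx).
set t := phi c x 0 0 in x0 HE dE *.
have P0 : 0 <= t `^ al by exact: powR_ge0.
have E0 : conorm2 g (differential test_fun) (chart_at A x) x = H 0 0 * (al * t `^ al) ^+ 2.
  rewrite HE (bigD1 0)//= [X in _ + X]big1 ?addr0 => [|j j0]; last first.
    by rewrite dE (negbTE j0) mulr0.
  rewrite (bigD1 0)//= [X in _ + X]big1 ?addr0 => [|j j0]; last first.
    by rewrite dE (negbTE j0) mul0r.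
  by rewrite dE eqxx (powR_pred al x0); ring.
rewrite /conorm E0.
apply: (@le_trans _ _ (Num.sqrt (k2 * (al * t `^ al) ^+ 2))).
  by rewrite ler_wsqrtr// ler_wpM2r// sqr_ge0.
rewrite sqrtrM// sqrtr_sqr (ger0_norm (mulr_ge0 al0 P0)).
by rewrite mulrA.
Qed.

Lemma conorm_out x : Om x -> ~ supp x -> conorm g (differential test_fun) x = 0.
Proof.
move=> Ox nS; have [cx [x0 _]] := Ox.
have [H [_ _ HE]] := test_fun_conorm2 Ox.
rewrite /conorm HE big1 ?mulr0 ?sqrtr0// => j _.
rewrite (profile_derive_out al0 a0 ab dl0 Ks0 stepK j x0 (not_supp_box Ox nS)).
by rewrite mulr0.
Qed.

(** As al q = n, the q-th power of t^al is exactly the weight t^n; pointwise bounds thereby become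
    bounds by [nu]. *)
Lemma power_bound (X D t : R) : 0 <= X -> 0 <= D -> 0 < t -> X <= D * t `^ al ->
  `|X| `^ q <= D `^ q * t ^+ n.
Proof.
move=> X0 D0 t0 XD; rewrite ger0_norm//.
apply: (le_trans (ge0_ler_powR (ltW q0) _ _ XD)); rewrite ?nnegrE ?mulr_ge0 ?powR_ge0//.
by rewrite powRM ?powR_ge0// -powRrM /al divfK ?gt_eqF// powR_mulrn// ltW.
Qed.

Let K0 : R := (Num.sqrt k2 * al) `^ q.
Let C' : R := C `^ q.

Lemma supp_dom : supp `<=` dom c.
Proof. by move=> x /slabP[]. Qed.

Lemma core_measurable : measurable (core : set (borel T)).
Proof. exact: slab_measurable. Qed.

Lemma supp_measurable : measurable (supp : set (borel T)).
Proof. exact: slab_measurable. Qed.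

Lemma supp_weight_measurable :
  measurable_fun (supp : set (borel T)) (weight c : borel T -> \bar R).
Proof. exact: (weight_measurable hA supp_measurable supp_dom). Qed.

Variables (r1 r2 : R).
Hypotheses (r10 : 0 < r1) (nu1 : nu vol c core = r1%:E) (nu2 : nu vol c supp = r2%:E).

Lemma nu_shell : (\int[vol]_(x in (supp `\` core : set (borel T))) weight c x)%E =
  (r2 - r1)%:E.
Proof.
have E : nu vol c supp = (nu vol c core +
    \int[vol]_(x in (supp `\` core : set (borel T))) weight c x)%E.
  rewrite /nu -[X in (\int[_]_(_ in X) _ = _)%E](setDUK core_supp).
  rewrite ge0_integral_setU//.
  - exact: core_measurable.
  - exact: measurableD supp_measurable core_measurable.
  - by rewrite setDUK; [exact: supp_weight_measurable|exact: core_supp].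
  - by move=> x; rewrite setDUK; [move/supp_dom; exact: weight_ge0|exact: core_supp].
  - by rewrite disj_set2E setDIK.
rewrite nu1 nu2 in E; rewrite EFinB E.
by rewrite [in RHS](addeC r1%:E) addeK.
Qed.

Lemma shell_ge0 : r1 <= r2.
Proof.
rewrite -subr_ge0 -lee_fin -nu_shell; apply: integral_ge0 => x [Sx _].
exact: (weight_ge0 hA (supp_dom Sx)).
Qed.

Lemma energy_le : (Lp_int vol q Om (conorm g (differential test_fun)) <=
  (K0 * r1 + C' * (r2 - r1))%:E)%E.
Proof.
have := split_integral_le vol core_measurable supp_measurable core_supp
  supp_weight_measurable (fun x Sx => weight_ge0 hA (supp_dom Sx))
  (powR_ge0 (Num.sqrt k2 * al) q) (powR_ge0 C q)
  (D := Om) (F := fun x => (`|conorm g (differential test_fun) x| `^ q)%:E).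
rewrite nu_shell -/(nu vol c core) nu1 -!EFinM -EFinD; apply.
- by move=> x _; rewrite lee_fin powR_ge0.
- move=> x Ox Cx; rewrite -EFinM lee_fin; have [cx [x0 _]] := Ox.
  apply: power_bound => //; first exact: sqrtr_ge0.
    by rewrite mulr_ge0// sqrtr_ge0.
  exact: conorm_core.
- move=> x Ox Sx; rewrite -EFinM lee_fin; have [cx [x0 _]] := Ox.
  by apply: power_bound => //; [exact: sqrtr_ge0|exact: conorm_le].
- by move=> x Ox nS; rewrite conorm_out// normr0 powR0// gt_eqF.
Qed.

Lemma mass_ge : (r1%:E <= Lp_int vol q Om test_fun)%E.
Proof.
rewrite -nu1 /nu /Lp_int integral_mkcond [leRHS]integral_mkcond.
apply: ge0_le_integralT => x.
  by apply: erestrict_ge0 => z /core_supp/supp_dom; exact: weight_ge0.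
rewrite /patch; case: ifPn => [/set_mem Cx|_]; last first.
  by case: ifPn => // _; rewrite lee_fin powR_ge0.
have Ox := supp_Om (core_supp Cx); rewrite mem_set// lee_fin test_funE//.
rewrite (profile_core al a0 ab dl0 (core_box_slab Cx)).
have [cx [x0 _]] := Ox.
by rewrite ger0_norm ?powR_ge0// -powRrM /al divfK ?gt_eqF// powR_mulrn// ltW.
Qed.

Lemma mass_lty : (Lp_int vol q Om test_fun < +oo)%E.
Proof.
have := split_integral_le vol core_measurable supp_measurable core_supp
  supp_weight_measurable (fun x Sx => weight_ge0 hA (supp_dom Sx))
  (@ler01 R) (@ler01 R)
  (D := Om) (F := fun x => (`|test_fun x| `^ q)%:E).
rewrite nu_shell -/(nu vol c core) nu1 -!EFinM -EFinD => H.
have one : (1 : R) `^ q = 1 by rewrite powR1.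
apply: (le_lt_trans (H _ _ _ _)); last exact: ltry.
- by move=> x _; rewrite lee_fin powR_ge0.
- move=> x Ox _; have [cx [x0 _]] := Ox; rewrite -EFinM lee_fin -[X in X * _]one.
  apply: power_bound => //; first by rewrite test_funE// profile_ge0.
  by rewrite mul1r test_funE// profile_le.
- move=> x Ox _; have [cx [x0 _]] := Ox; rewrite -EFinM lee_fin -[X in X * _]one.
  apply: power_bound => //; first by rewrite test_funE// profile_ge0.
  by rewrite mul1r test_funE// profile_le.
- move=> x Ox nS; rewrite test_funE// (profile_out _ a0 ab dl0 (not_supp_box Ox nS)).
  by rewrite normr0 powR0// gt_eqF.
Qed.

Lemma test_fun_W1p0 : W1p0 g vol q Om test_fun (differential test_fun).
Proof.
have fS := test_fun_smooth.
split.
- apply: continuous_on_measurable => // x Ox; exact: (smooth_on_continuous hA OmO fS Ox).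
- exact: (smooth_measurable_cofield hA OmO fS).
- exact: mass_lty.
- exact: (le_lt_trans energy_le (ltry _)).
(* The function already lies in C^infty_0 of the domain, so a constant sequence approximates it with
   zero error. *)
- exists (fun=> test_fun); split; first by move=> _; exact: test_fun_test.
  + rewrite [X in X @ _ --> _](_ : _ = fun=> 0%E); first exact: cvg_cst.
    apply/funext => k; rewrite /Lp_int integral0_eq// => x _.
    by rewrite /= subrr normr0 powR0// gt_eqF.
  + rewrite [X in X @ _ --> _](_ : _ = fun=> 0%E); first exact: cvg_cst.
    apply/funext => k; rewrite /Lp_int integral0_eq// => x _.
    rewrite /conorm /conorm2 subrr mul0mx mul0mx mxE sqrtr0.
    by rewrite normr0 powR0// gt_eqF.
Qed.

Lemma lambda1_le : (lambda1 g vol q <=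
  ((K0 * r1 + C' * (r2 - r1)) / r1)%:E)%E.
Proof.
apply: (@le_trans _ _ (lambda1_domain g vol q Om)).
  apply: ereal_inf_lbound; exists Om => //.
  exact: (Omega_smooth_bounded_domain hA lo0 lohi e10 hie p0 hV gm).
apply: (@le_trans _ _ (Lp_int vol q Om (conorm g (differential test_fun)) /
    Lp_int vol q Om test_fun)%E).
  apply: ereal_inf_lbound; exists test_fun, (differential test_fun); split=> //.
    exact: test_fun_W1p0.
  by rewrite gt_eqF// (lt_le_trans _ mass_ge)// lte_fin.
apply: quotient_le; [|exact: r10|exact: energy_le|exact: mass_ge|exact: mass_lty].
by rewrite addr_ge0// mulr_ge0 ?powR_ge0 ?subr_ge0 ?shell_ge0 ?(ltW r10).
Qed.

End test_function.

(** * Choice of the box *)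

(** [eta] is taken with k^2 + eta = (k s)^2 and s^q = 1 + d, so that the left side is exactly (1 +
    d) B. The choice d = eps / (B + 1) makes B d <= eps and also covers B = 0. *)
Lemma sqrt_powR_perturb {R : realType} (k al q eps : R) :
  0 < k -> 0 <= al -> 0 < q -> 0 < eps ->
  exists2 eta, 0 < eta &
    (Num.sqrt (k ^+ 2 + eta) * al) `^ q <= (k * al) `^ q + eps.
Proof.
move=> k0 al0 q0 eps0; set B := (k * al) `^ q.
have B0 : 0 <= B by exact: powR_ge0.
have B1 : 0 < B + 1 by lra.
pose d := eps / (B + 1).
have d0 : 0 < d by rewrite divr_gt0.
have Bd : B * d <= eps.
  rewrite /d mulrA ler_pdivrMr// mulrDr mulr1 mulrC lerDl; exact: ltW.
pose s := (1 + d) `^ q^-1.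
have s1 : 1 < s.
  rewrite /s -[X in X < _](_ : 1 `^ q^-1 = 1); last by rewrite powR1.
  apply: gt0_ltr_powR; rewrite ?invr_gt0// ?nnegrE; lra.
have s0 : 0 < s by lra.
have sq : s `^ q = 1 + d.
  rewrite /s -powRrM mulVf ?gt_eqF// powRr1//; lra.
exists (k ^+ 2 * (s ^+ 2 - 1)).
  by rewrite mulr_gt0 ?exprn_gt0// subr_gt0 exprn_egt1.
have -> : k ^+ 2 + k ^+ 2 * (s ^+ 2 - 1) = (k * s) ^+ 2 by ring.
rewrite sqrtr_sqr gtr0_norm ?mulr_gt0// mulrAC powRM ?mulr_ge0 ?(ltW k0) ?(ltW s0)//.
by rewrite -/B sq mulrDr mulr1 lerD2l.
Qed.

Section nested_slabs.
Context {R : realType} {n : nat} {T : ptopologicalType} (A : atlas R n T).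
Hypothesis hA : compact_manifold_with_boundary A.
Variables (theta : R) (g : tensor A) (vol : {measure set (borel T) -> \bar R}).
Hypotheses (gm : riemannian_metric theta (minterior A) g)
  (gvol : riemannian_volume g vol).
Variables (c : idx A) (p : 'rV[R]_n.+1) (e m1 m2 k2 Kb q : R).
Hypotheses (e0 : 0 < e) (m10 : 0 < m1) (m20 : 0 <= m2) (k20 : 0 <= k2)
  (Kb0 : 0 <= Kb) (q1 : 1 < q) (p0 : p 0 0 = 0).
Hypothesis hE : forall y : 'rV[R]_n.+1,
  (forall i, `|y 0 i - p 0 i| < e) -> 0 < y 0 0 ->
  [/\ chart_image c setT y,
      m1 <= y 0 0 ^+ n.+1 * Num.sqrt (\det (g c (psi c y))) <= m2 &
      exists H : 'M[R]_n.+1, [/\ H 0 0 <= k2, forall i j, `|H i j| <= Kb &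
        forall w : cofield A, conorm2 g w c (psi c y) =
          y 0 0 ^+ 2 * (w c (psi c y) *m H *m (w c (psi c y))^T) 0 0]].

Variables (l : R) (M : nat).
Hypotheses (l0 : 0 < l) (M0 : (0 < M)%N) (le : 8 * n.+1%:R * l = e).

(* The box P i consists of the N i = M + 2 i dyadic slabs below height t i;
   P i.+1 has one more slab at each end and sides longer by l / M. *)
Let t (i : nat) : R := l / (2 * M%:R) / 2 ^+ M * 2 ^+ i.
Let L (i : nat) : R := l + i%:R * (l / M%:R).
Let N (i : nat) : nat := (M + 2 * i)%N.
Let P (i : nat) : set T := slab c p (t i / 2 ^+ N i) (t i) (L i).
Let x (i : nat) : R := fine (nu vol c (P i)).

Let M0' : 0 < M%:R :> R. Proof. by rewrite ltr0n. Qed.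

Let M1 : 1 <= M%:R :> R. Proof. by rewrite ler1n. Qed.

Let le8 : 8 * l <= e.
Proof. by rewrite -le ler_pM2r// ler_peMr// ler1n. Qed.

Let t0 i : 0 < t i.
Proof. by rewrite /t mulr_gt0 ?divr_gt0 ?mulr_gt0 ?exprn_gt0. Qed.

(** The starting height is chosen so that the highest box has height t M = l / (2 M); twice any
    height is then at most l / M, the width of the lateral collar. *)
Let t_le i : (i <= M)%N -> 2 * t i <= l / M%:R.
Proof.
move=> iM; have -> : l / M%:R = 2 * (l / (2 * M%:R) / 2 ^+ M * 2 ^+ M).
  by rewrite divfK ?gt_eqF ?exprn_gt0//; field; rewrite gt_eqF.
rewrite ler_pM2l// /t ler_pM2l; first by rewrite ler_eXn2l// ltr1n.
by rewrite divr_gt0 ?divr_gt0 ?mulr_gt0 ?exprn_gt0.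
Qed.

Let lM : l / M%:R <= l.
Proof. by rewrite ler_pdivrMr// ler_peMr// ltW. Qed.

Let L_ge i : l <= L i.
Proof. by rewrite /L lerDl mulr_ge0// divr_ge0// ltW. Qed.

Let L_le i : (i <= M)%N -> L i <= 2 * l.
Proof.
move=> iM; rewrite /L mulrDl mul1r lerD2l mulrCA ler_piMr//; first exact: ltW.
by rewrite ler_pdivrMr// mul1r ler_nat.
Qed.

Let nu_bounds i : (i <= M)%N ->
  ((M%:R * (m1 * l ^+ n / 2))%:E <= nu vol c (P i) <=
   (3 * M%:R * (m2 * 4 ^+ n * (2 * l) ^+ n))%:E)%E.
Proof.
move=> iM; have Li := L_ge i; have Li2 := L_le iM; have ti := t_le iM.
have hE' (y : 'rV[R]_n.+1) : (forall i, `|y 0 i - p 0 i| < e) -> 0 < y 0 0 ->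
    chart_image c setT y /\
    m1 <= y 0 0 ^+ n.+1 * Num.sqrt (\det (g c (psi c y))) <= m2.
  by move=> ye yp; have [? ? _] := hE ye yp.
have L0 : 0 <= L i by lra.
have te : t i <= e by have := t0 i; have := lM; have := le8; have := l0; lra.
have Le : L i < e by have := le8; have := l0; lra.
have /andP[lo hi] := nu_slabs hA gvol m10 m20 hE' p0 (N i) (t0 i) L0 te Le.
apply/andP; split.
  apply: le_trans lo; rewrite lee_fin ler_pM//.
  - by rewrite divr_ge0// mulr_ge0 ?exprn_ge0 ?(ltW m10) ?(ltW l0).
  - by rewrite ler_nat leq_addr.
  - by rewrite ler_pM2r// ler_pM2l// lerXn2r ?nnegrE// ltW.
apply: (le_trans hi); rewrite lee_fin ler_pM//.
- by rewrite !mulr_ge0 ?exprn_ge0.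
- by rewrite -natrM ler_nat /N (mulSn 2 M) leq_add2l leq_mul2l iM orbT.
- by rewrite ler_wpM2l ?mulr_ge0 ?exprn_ge0// lerXn2r ?nnegrE// mulr_ge0// ltW.
Qed.

Let nuE i : (i <= M)%N -> nu vol c (P i) = (x i)%:E.
Proof.
move=> /nu_bounds/andP[lo hi]; rewrite fineK// fin_numE.
by rewrite -ltNye -ltey (lt_le_trans _ lo) ?ltNyr// (le_lt_trans hi) ?ltry.
Qed.

Let x_bounds i : (i <= M)%N -> M%:R * (m1 * l ^+ n / 2) <= x i <=
  3 * M%:R * (m2 * 4 ^+ n * (2 * l) ^+ n).
Proof. by move=> iM; have := nu_bounds iM; rewrite nuE// !lee_fin. Qed.

Lemma nested_slabs_bound (Ks : R) : 0 <= Ks ->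
  (forall t : R, exists2 d, is_derive t 1 step d &
     [/\ `|d| <= Ks, t <= 0 -> d = 0 & 1 <= t -> d = 0]) ->
  (lambda1 g vol q <= ((Num.sqrt k2 * (n%:R / q)) `^ q +
    (n.+1%:R * (n%:R / q + 4 * Ks) * Num.sqrt Kb) `^ q *
    (6 * 8 ^+ n * m2 / m1 / M%:R))%:E)%E.
Proof.
move=> Ks0 stepK.
have w0 : 0 < M%:R * (m1 * l ^+ n / 2).
  by rewrite mulr_gt0// divr_gt0// mulr_gt0// exprn_gt0.
have x0_ge0 : 0 <= x 0%N by have /andP[? _] := x_bounds (leq0n M); lra.
(* The increments add up to at most x M because x 0 >= 0. Comparing x M with x i then turns the
   bound x M / M into one relative to the mass of the core. *)
have [i iM xi] := pigeonhole_increment M0 (x := x) (a := x M)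
  (ltac:(by rewrite gerBl)).
have /andP[xi0 _] := x_bounds (ltnW iM).
have xi_gt0 : 0 < x i by exact: lt_le_trans xi0.
have /andP[_ xM] := x_bounds (leqnn M).
(* The ratio of the two bounds in [x_bounds]: 3 m2 4^n 2^n against m1 / 2, the powers of [l] and the
   factor [M] cancelling. *)
have {}xM : x M <= 6 * 8 ^+ n * m2 / m1 * x i.
  apply: (le_trans xM); apply: le_trans (_ : _ <=
      6 * 8 ^+ n * m2 / m1 * (M%:R * (m1 * l ^+ n / 2))) _; last first.
    by rewrite ler_wpM2l// divr_ge0 ?(ltW m10)// mulr_ge0// mulr_ge0 ?exprn_ge0.
  rewrite exprMn (_ : 8 = 4 * 2)%R; last by ring.
  rewrite exprMn le_eqVlt; apply/orP; left; apply/eqP.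
  by field; rewrite gt_eqF.
(* The next three identities say that, when P i is the core with collar dl = l / M, its support box
   (a / 2, 2 b, L + dl) is precisely P i.+1. *)
have E1 : t i.+1 = 2 * t i by rewrite /t exprS; ring.
have E2 : t i.+1 / 2 ^+ N i.+1 = t i / 2 ^+ N i / 2.
  rewrite E1 (_ : N i.+1 = (N i).+2); last by rewrite /N mulnS addnCA.
  by rewrite !exprS; field; rewrite gt_eqF// exprn_gt0.
have E3 : L i.+1 = L i + l / M%:R by rewrite /L -natr1; ring.
have nui : nu vol c (slab c p (t i / 2 ^+ N i) (t i) (L i)) = (x i)%:E.
  exact: nuE (ltnW iM).
have nui1 : nu vol c (slab c p (t i / 2 ^+ N i / 2) (2 * t i) (L i + l / M%:R)) =
    (x i.+1)%:E.
  by rewrite -E1 -E2 -E3; exact: nuE.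
have t1 := t_le iM; rewrite E1 in t1; have tp := t0 i.
have a0 : 0 < t i / 2 ^+ N i by rewrite divr_gt0 ?exprn_gt0.
have ab : t i / 2 ^+ N i < t i.
  rewrite ltr_pdivrMr ?exprn_gt0// ltr_pMr// exprn_egt1// ?ltr1n//.
  by rewrite /N addn_eq0 negb_and -lt0n M0.
have dl0 : 0 < l / M%:R by rewrite divr_gt0.
have e10 : 0 < e / 2 by rewrite divr_gt0.
have b_dl : 2 * t i <= l / M%:R by exact: t_le (ltnW iM).
have b_e1 : 8 * t i <= e / 2.
  rewrite ler_pdivlMr//; apply: le_trans le8; rewrite -mulrA ler_pM2l// mulrC.
  exact: le_trans b_dl lM.
(* The relation 8 (n + 1) l = e is made for this: the right side equals 2 l, which bounds all the
   [L i] with i <= M. *)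
have L_e1 : L i + l / M%:R <= e / 2 / (2 * n.+1%:R).
  have -> : e / 2 / (2 * n.+1%:R) = 2 * l.
    have N0 : n.+1%:R != 0 :> R by rewrite pnatr_eq0.
    by rewrite -le; move: (n.+1%:R) N0 => k k0; field.
  by rewrite -E3; exact: L_le.
(* With e1 = e / 2, the closed cube of the domain lies in the open cube where [hE] holds. *)
have e12 : e / 2 < e by rewrite ltr_pdivrMr// ltr_pMr// ltr1n.
have hV (y : 'rV[R]_n.+1) : (forall i, `|y 0 i - p 0 i| <= e / 2) -> 0 < y 0 0 ->
    chart_image c setT y.
  by move=> ye yp; have [] := hE (fun i => le_lt_trans (ye i) e12) yp.
have hH (y : 'rV[R]_n.+1) : (forall i, `|y 0 i - p 0 i| <= e / 2) -> 0 < y 0 0 ->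
    exists H : 'M[R]_n.+1, [/\ H 0 0 <= k2, forall i j, `|H i j| <= Kb &
      forall w : cofield A, conorm2 g w c (psi c y) =
        y 0 0 ^+ 2 * (w c (psi c y) *m H *m (w c (psi c y))^T) 0 0].
  by move=> ye yp; have [] := hE (fun i => le_lt_trans (ye i) e12) yp.
have := lambda1_le hA gm a0 ab dl0 e10 q1 b_dl b_e1 L_e1 p0 hV k20 Kb0 hH Ks0 stepK
  xi_gt0 nui nui1.
move=> /le_trans; apply.
rewrite lee_fin mulrDl mulfK ?gt_eqF// lerD2l -mulrA ler_wpM2l ?powR_ge0//.
rewrite ler_pdivrMr//; apply: (le_trans xi).
by rewrite mulrAC ler_pM2r ?invr_gt0.
Qed.

End nested_slabs.

(** * The eigenvalue bound: choice of the constants *)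

Theorem corollary1p3 (R : realType) (n : nat) (T : ptopologicalType)
    (A : atlas R n T) (theta kappa p : R) (g : tensor A)
    (vol : {measure set (borel T) -> \bar R}) :
  compact_manifold_with_boundary A ->
  0 < theta < 1 ->
  0 < kappa ->
  asymptotically_hyperbolic theta kappa g ->
  riemannian_volume g vol ->
  1 < p ->
  (lambda1 g vol p <= (((n%:R * kappa) / p) `^ p)%:E)%E.
Proof.
move=> hA _ kappa0 [[gm _ [r [gbar gC]]] hK] gvol p1.
have gK := hK _ _ gC.
have p0 : 0 < p by lra.
(* Half of [eps] pays for replacing kappa^2 by kappa^2 + eta on the core, the other half for the
   shell. *)
apply/lee_addgt0Pr => eps eps0.
have eps2 : 0 < eps / 2 by lra.
have al0 : 0 <= n%:R / p by rewrite divr_ge0// ltW.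
have [eta eta0 etaP] := sqrt_powR_perturb kappa0 al0 p0 eps2.
have [_ _ [x0 [c cx0 phi0]] _ _] := hA.
have [e [m1 [m2 [Kb [e0 m10 m20 Kb0 hE]]]]] := local_asymptotics hA gC gK cx0 phi0 eta0.
have [Ks Ks0 stepK] := @step_derive R.
(* The shell contributes at most B / M. All constants in [B] are fixed before [M], so [M] can be
   taken larger than B / (eps / 2). *)
set B := (n.+1%:R * (n%:R / p + 4 * Ks) * Num.sqrt Kb) `^ p * (6 * 8 ^+ n * m2 / m1).
pose M := (Num.truncn (B / (eps / 2))).+1.
have BM : B / M%:R <= eps / 2.
  rewrite ler_pdivrMr ?ltr0n// -ler_pdivrMl// mulrC ltW//.
  exact: truncnS_gt.
have l0 : 0 < e / (8 * n.+1%:R) by rewrite divr_gt0// mulr_gt0.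
have le : 8 * n.+1%:R * (e / (8 * n.+1%:R)) = e.
  by rewrite mulrC divfK// mulf_neq0// pnatr_eq0.
have k20 : 0 <= kappa ^+ 2 + eta by rewrite addr_ge0 ?sqr_ge0 ?ltW.
have := nested_slabs_bound hA gm gvol e0 m10 m20 k20 Kb0 p1 phi0 hE l0 (ltn0Sn _ : (0 < M)%N)
  le Ks0 stepK.
move=> /le_trans; apply; rewrite -EFinD lee_fin mulrA -/B.
rewrite (_ : n%:R * kappa / p = kappa * (n%:R / p)); last by rewrite mulrCA mulrA.
lra.
Qed.
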